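(* Let $(\mathbf{A},\mathbf{E})$ be a regular matrix pencil, $\mathbf{A},\mathbf{E}\in\mathbb{C}^{n\times n}$, all of whose finite eigenvalues have strictly negative real part, and let $\mu\in\mathbb{C}$ be such that $\mathbf{A}-\mu\mathbf{E}$ is invertible. For all $\varepsilon>0$ and $t>0$, $$\big\|\mathrm{e}^{t(\mathbf{G}_\mu^{-1}+\mu\mathbf{I})}\big\|\ \le\ \frac{L_\varepsilon\,\mathrm{e}^{t\,\alpha_\varepsilon(\mathbf{A},\mathbf{E})}}{2\pi\varepsilon},$$ where $L_\varepsilon$ is the contour length of a Jordan curve that contains $\sigma_\varepsilon(\mathbf{A},\mathbf{E})$ in its interior. Moreover, for all $t\ge0$, $$\big\|\mathrm{e}^{t(\mathbf{G}_\mu^{-1}+\mu\mathbf{I})}\big\|\le\mathrm{e}\,(n-d)\,\mathcal{K}(\mathbf{A},\mathbf{E}),$$ where $n-d$ is the dimension of $\mathbf{G}_\mu$, $\mathrm{e}$ is Euler's number, and $\mathcal{K}(\mathbf{A},\mathbf{E})$ is the Kreiss constant of the pencil.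
   Context: $\|\cdot\|$ is the Euclidean vector norm and the matrix norm it induces, with the convention $\|\mathbf{X}^{-1}\|=\infty$ when $\mathbf{X}$ is a square matrix that is not invertible. The pencil $(\mathbf{A},\mathbf{E})$ is regular if $\mathbf{A}-\mu\mathbf{E}$ is invertible for some $\mu\in\mathbb{C}$; its finite eigenvalues are the $\lambda\in\mathbb{C}$ with $\mathbf{A}-\lambda\mathbf{E}$ singular. For $\mu\in\mathbb{C}$ with $\mathbf{A}-\mu\mathbf{E}$ invertible, let $\mathbf{E}_\mu:=(\mathbf{A}-\mu\mathbf{E})^{-1}\mathbf{E}$, let $d$ be the algebraic multiplicity of $0$ as an eigenvalue of $\mathbf{E}_\mu$ (with $d<n$ understood, so that $\mathbf{G}_\mu$ below is not empty), and take a Schur factorization $$\mathbf{E}_\mu=[\mathbf{Q}_\mu\ \widetilde{\mathbf{Q}}_\mu]\begin{bmatrix}\mathbf{G}_\mu&\mathbf{D}_\mu\\ \mathbf{0}&\mathbf{N}_\mu\end{bmatrix}[\mathbf{Q}_\mu\ \widetilde{\mathbf{Q}}_\mu]^*$$ with $[\mathbf{Q}_\mu\ \widetilde{\mathbf{Q}}_\mu]$ unitary, the middle factor upper triangular, $\mathbf{N}_\mu\in\mathbb{C}^{d\times d}$ nilpotent, and $\mathbf{G}_\mu\in\mathbb{C}^{(n-d)\times(n-d)}$ with $0\notin\sigma(\mathbf{G}_\mu)$. The $\varepsilon$-pseudospectrum of the pencil is $\sigma_\varepsilon(\mathbf{A},\mathbf{E}):=\{z\in\mathbb{C}:\|(z\mathbf{I}-(\mathbf{G}_\mu^{-1}+\mu\mathbf{I}))^{-1}\|>1/\varepsilon\}$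 (independent of $\mu$); the $\varepsilon$-pseudospectral abscissa is $\alpha_\varepsilon(\mathbf{A},\mathbf{E}):=\sup_{z\in\sigma_\varepsilon(\mathbf{A},\mathbf{E})}\mathrm{Re}\,z$; the Kreiss constant (with respect to the left-half plane) is $\mathcal{K}(\mathbf{A},\mathbf{E}):=\sup_{\varepsilon>0}\alpha_\varepsilon(\mathbf{A},\mathbf{E})/\varepsilon$. *)

(* Defs.v *)
From HB Require Import structures.
From mathcomp Require Import all_boot all_order all_algebra.
From mathcomp Require Import all_classical all_reals all_analysis.
From mathcomp Require Import complex.

Set Implicit Arguments.
Unset Strict Implicit.
Unset Printing Implicit Defensive.

Import Order.TTheory GRing.Theory Num.Theory.
Import numFieldNormedType.Exports.

Local Open Scope classical_set_scope.
Local Open Scope ring_scope.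
Local Open Scope complex_scope.
Local Open Scope sesquilinear_scope.

(* R[i] itself carries no topology in the libraries: wherever one is needed,
   its convertible alias R[i]^o is used, which has the topology of the complex
   modulus. *)

(* ** Norms *)

Definition enorm (R : realType) n (v : 'cV[R[i]]_n) : R :=
  Num.sqrt (\sum_i Normc.normc (v i 0) ^+ 2).

Definition opnorm (R : realType) m n (X : 'M[R[i]]_(m, n)) : R :=
  sup [set enorm (X *m v) | v in [set v | enorm v <= 1]].

Definition inv_norm (R : realType) n (X : 'M[R[i]]_n) : \bar R :=
  if X \in unitmx then (opnorm (invmx X))%:E else +oo%E.

(* ** Matrix exponential *)

Definition expmx (R : realType) n (X : 'M[R[i]]_n) : 'M[R[i]]_n :=
  lim (series (fun k => k`!%:R^-1 *: X ^+ k : 'M[R[i]^o]_n) @ \oo).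

(* ** Matrix pencils *)

Definition regular_pencil (R : realType) n (A E : 'M[R[i]]_n) : Prop :=
  exists mu : R[i], A - mu *: E \in unitmx.

Definition finite_eigenvalue (R : realType) n (A E : 'M[R[i]]_n)
  (lambda : R[i]) : Prop := A - lambda *: E \notin unitmx.

Definition Emu (R : realType) n (A E : 'M[R[i]]_n) (mu : R[i]) : 'M[R[i]]_n :=
  invmx (A - mu *: E) *m E.

(* [Q Qt] has n rows and (n - d) + d columns; together with d < n this makes it
   a square matrix, so that one-sided unitarity (unitarymx) is unitarity.
   is_trig_mx means lower triangular, hence the transpose. *)
Record schur_splitting (R : realType) n d (A E : 'M[R[i]]_n) (mu : R[i])
    (Q : 'M[R[i]]_(n, n - d)) (Qt : 'M[R[i]]_(n, d)) (G : 'M[R[i]]_(n - d))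
    (D : 'M[R[i]]_(n - d, d)) (N : 'M[R[i]]_d) : Prop := SchurSplitting {
  schur_mu : A - mu *: E \in unitmx;
  schur_mult : d = mup 0 (char_poly (Emu A E mu));
  schur_ltn : (d < n)%N;
  schur_unitary : row_mx Q Qt \is unitarymx;
  schur_factorization :
    Emu A E mu = row_mx Q Qt *m block_mx G D 0 N *m (row_mx Q Qt)^t*;
  schur_triangular : is_trig_mx (block_mx G D 0 N)^T;
  schur_nilpotent : exists k, N ^+ k = 0;
  schur_spectrum : ~~ eigenvalue G 0 }.

(* ** Pseudospectrum of a pencil *)

(* The condition on z does not depend on the choice of mu and of the Schur
   factorization: for another choice mu', Q', G' there is a unitary V with
   G'^-1 + mu' I = V^* (G^-1 + mu I) V. *)
Definition pseudospectrum (R : realType) n (A E : 'M[R[i]]_n) (eps : R) :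
    set R[i] :=
  [set z | exists mu d (Q : 'M[R[i]]_(n, n - d)) (Qt : 'M[R[i]]_(n, d))
             (G : 'M[R[i]]_(n - d)) (D : 'M[R[i]]_(n - d, d)) (N : 'M[R[i]]_d),
      schur_splitting A E mu Q Qt G D N /\
      ((eps^-1)%:E < inv_norm (z%:M - (invmx G + mu%:M)))%E].

Definition pseudospectral_abscissa (R : realType) n (A E : 'M[R[i]]_n)
    (eps : R) : \bar R :=
  ereal_sup [set (complex.Re z)%:E | z in pseudospectrum A E eps].

Definition kreiss_constant (R : realType) n (A E : 'M[R[i]]_n) : \bar R :=
  ereal_sup [set (pseudospectral_abscissa A E eps * (eps^-1)%:E)%E
            | eps in [set eps : R | 0 < eps]].

(* ** Jordan curves *)

Definition jordan_curve (R : realType) (gamma : R -> R[i]^o) : Prop :=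
  [/\ {within `[0, 1], continuous gamma},
      gamma 0 = gamma 1 &
      {in `[0, 1[ &, injective gamma}].

(* The points lying in a bounded connected component of the complement of the
   curve. *)
Definition jordan_interior (R : realType) (gamma : R -> R[i]^o) : set R[i] :=
  let complement : set R[i]^o := ~` (gamma @` `[0, 1]) in
  [set z | complement z /\ bounded_set (connected_component complement z)].

(* Supremum of the lengths of inscribed polygons; +oo if not rectifiable. *)
Definition curve_length (R : realType) (gamma : R -> R[i]^o) : \bar R :=
  ereal_sup
    [set (\sum_(0 <= k < size s)
           Normc.normc (gamma (nth 1 (0 :: s) k.+1) - gamma (nth 1 (0 :: s) k)))%:E
    | s in itv_partition (0 : R) 1].

(* Main.v *)
Require Import Defs.
From HB Require Import structures.
From mathcomp Require Import all_boot all_order all_algebra.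
From mathcomp Require Import all_classical all_reals all_analysis.
From mathcomp Require Import complex.
From mathcomp Require Import separable cyclic cyclotomic.
From mathcomp Require Import ring lra zify.
Import Order.TTheory GRing.Theory Num.Theory.
Import numFieldNormedType.Exports.
Local Open Scope classical_set_scope.
Local Open Scope ring_scope.
Local Open Scope complex_scope.

(** Write B for G^-1 + mu and m for n - d, the size of B. The pseudospectrum of
the pencil contains every z such that |(z - B) v| < eps |v| for some vector v;
these z form [near_spectrum B eps]. Both bounds are therefore statements about
the single matrix B and its near-spectra.

First bound. Integrating e^(tz) (z - B)^-1 over the given curve is not good
enough: the curve may run far to the right of the abscissa, where e^(tz) is too
large. Integrate instead over a polygon circumscribed about the near-spectrum,
with 2H sides in equally spaced directions, one of them vertical on the right.
Outside the near-spectrum the resolvent is at most 1/eps, and on the polygon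
Re z is at most the abscissa ([support_cauchy]). The perimeter of the polygon
is a multiple of the sum of the support function over the 2H directions, and a
discrete Cauchy-Crofton formula bounds this sum by the length L of any closed
curve whose convex hull contains the near-spectrum: in each direction the curve
has to cross the width of the set twice ([crofton_closed_curve]). The perimeter
is thus at most L / cos (pi / 2H), which tends to L as H grows. A Jordan curve
has its interior inside its convex hull, since a point outside the hull can
escape to infinity along a ray ([jordan_interior_enclosed]).

Contour integrals never appear: Riemann sums over a polygon whose sides are cut
into N equal pieces satisfy exact discrete forms of the resolvent identities,
and these give Cauchy's formula for the powers of a + bz up to O(1/N)
([cauchy_bound]). Powers suffice, because e^(tB) is the limit of
(1 + tB/N)^N ([opnorm_expmx_le]).

Second bound. The factor e m is the one of the sharp Kreiss matrix theorem. Let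
r be a rational function of degree at most m with its poles outside the closed
unit disc. By Bernstein's inequality ([bernstein]), at a point of the unit
circle |r'| is at most sup |r| times the sum of the Poisson kernels attached to
the poles. Each Poisson kernel has mean value one on the circle, so the mean of
|r'| is at most m sup |r|. Applied to r(z) = u (1 - zX)^-1 v, whose derivative
has k u X^k v as a Taylor coefficient, this gives k |u X^k v| <= m sup |r|
([power_bound]). Take X = (1 - 1/K) (1 - tB/K)^-1, a damped step of the implicit
Euler method. The resolvents (1 - zX)^-1 with |z| = 1 are expressed by those of
B on the half-plane Re z >= 1/t, where the Kreiss constant controls them, and
undoing the damping after K steps costs the factor (1 - 1/K)^-K, which tends to
e ([implicit_euler_bound]). Since K implicit Euler steps of length t/K approach
e^(tB), the second bound follows ([kreiss_semigroup]). *)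

Set Implicit Arguments.
Unset Strict Implicit.
Unset Printing Implicit Defensive.

(** * Bernstein's inequality for rational functions *)
Section Bernstein.
Local Open Scope ring_scope.
Variable C : numClosedFieldType.
Implicit Types (a z x : C) (s : seq C) (p g M : {poly C}).

Lemma lagrange_interpolation M : M != 0 -> separable_poly M ->
  exists r : seq C, (forall z, (z \in r) = root M z) /\
    forall g x, (size g < size M)%N -> ~~ root M x ->
    g.[x] = \sum_(z <- r) g.[z] * M.[x] / ((x - z) * M^`().[z]).
Proof.
move=> M0 Msep.
have [r Mr] := closed_field_poly_normal M.
have lc0 : lead_coef M != 0 by rewrite lead_coef_eq0.
have r_root z : (z \in r) = root M z.
  by rewrite Mr rootZ // root_prod_XsubC.
have r_uniq : uniq r.
  rewrite -separable_prod_XsubC -(eqp_separable (eqp_scale _ lc0)).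
  by move: Msep; rewrite Mr; congr (separable_poly _); rewrite -Mr.
have szr : size M = (size r).+1.
  by rewrite Mr size_scale // size_prod_XsubC.
exists r; split => // g x gM Mx.
pose q z := M %/ ('X - z%:P).
have qM z : z \in r -> M = q z * ('X - z%:P).
  by rewrite r_root => /factor_theorem[u Mu]; rewrite /q {2}Mu mulpK ?polyXsubC_eq0.
have dq z : z \in r -> M^`().[z] = (q z).[z].
  move=> /qM {1}->; rewrite derivM derivXsubC mulr1 hornerD hornerM.
  by rewrite hornerXsubC subrr mulr0 add0r.
have dM0 z : z \in r -> M^`().[z] != 0.
  rewrite r_root => Mz; move: Msep; rewrite unlock => /Pdiv.ClosedField.coprimepP; exact.
have q0 z y : z \in r -> y \in r -> y != z -> (q z).[y] = 0.
  move=> zr yr yz; have: M.[y] == 0 by rewrite -rootE -r_root.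
  rewrite (qM _ zr) hornerM hornerXsubC mulf_eq0 subr_eq0 (negbTE yz) orbF.
  by move/eqP.
pose L := \sum_(z <- r) (g.[z] / M^`().[z]) *: q z.
have szq z : z \in r -> (size (q z) <= size r)%N.
  move=> zr; rewrite -ltnS -szr (qM _ zr) size_Mmonic ?monicXsubC //; last first.
    apply: contraNneq M0 => q00; by rewrite (qM _ zr) q00 mul0r.
  by rewrite size_XsubC addn2.
have gL : g = L.
  apply/eqP; rewrite -subr_eq0; apply/eqP.
  apply: (@roots_geq_poly_eq0 _ _ r) => //.
    apply/allP => y yr; rewrite /root hornerD hornerN /L horner_sum.
    rewrite (bigD1_seq y) //= hornerZ -dq // divfK ?dM0 // big1_seq ?addr0 ?subrr //.
    by move=> z /andP[zy zr]; rewrite hornerZ q0 ?mulr0 // eq_sym.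
  rewrite (leq_trans (size_polyD _ _)) // geq_max -ltnS -szr gM /= size_polyN.
  rewrite (leq_trans (size_sum _ _ _)) //; apply/bigmax_leqP_seq => z zr _.
  exact: (leq_trans (size_scale_leq _ _) (szq _ zr)).
rewrite {1}gL /L horner_sum; apply: eq_big_seq => z zr.
have xz : x - z != 0.
  by rewrite subr_eq0; apply: contraNneq Mx => ->; rewrite -r_root.
rewrite hornerZ [in RHS](qM _ zr) hornerM hornerXsubC.
rewrite -(qM _ zr).
by field; rewrite dM0 // xz.
Qed.

(** The quotient of [blaschke_num s] by [blaschke_den s] is the finite Blaschke
product whose zeros are the conjugates of the entries of s; the entries
themselves are the inverses of its poles. *)
Definition blaschke_den s : {poly C} := \prod_(a <- s) (1 - a *: 'X).
Definition blaschke_num s : {poly C} := \prod_(a <- s) ('X - (a^*)%:P).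
Definition poisson a z : C := (1 - `|a| ^+ 2) / `|1 - a * z| ^+ 2.

Lemma blaschke_denE s z : (blaschke_den s).[z] = \prod_(a <- s) (1 - a * z).
Proof.
rewrite /blaschke_den horner_prod; apply: eq_bigr => a _.
by rewrite hornerD hornerN hornerZ hornerX hornerC.
Qed.

Lemma blaschke_numE s z : (blaschke_num s).[z] = \prod_(a <- s) (z - a^*).
Proof. by rewrite /blaschke_num horner_prod; apply: eq_bigr => a _; rewrite hornerXsubC. Qed.

Lemma blaschke_factor_norm a z :
  `|1 - a * z| ^+ 2 - `|z - a^*| ^+ 2 = (1 - `|a| ^+ 2) * (1 - `|z| ^+ 2).
Proof.
rewrite !normCK !rmorphB !rmorphM /= !rmorph1 conjCK.
ring.
Qed.

Lemma conjC_unit z : `|z| = 1 -> z * z^* = 1.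
Proof. by move=> z1; rewrite -normCK z1 expr1n. Qed.

Lemma factor_neq0 a z : `|a| < 1 -> `|z| <= 1 -> 1 - a * z != 0.
Proof.
move=> a1 z1; rewrite subr_eq0; apply: contraTneq (a1) => /(congr1 Num.norm).
rewrite normr1 normrM => az; rewrite -real_leNgt ?realE ?normr_ge0 ?ler01 //.
by rewrite az ler_piMr.
Qed.

Lemma poisson_gt0 a z : `|a| < 1 -> `|z| = 1 -> 0 < poisson a z.
Proof.
move=> a1 z1; rewrite divr_gt0 //.
  by rewrite subr_gt0 expr_lt1 // normr_ge0.
by rewrite exprn_gt0 // normr_gt0 factor_neq0 // z1.
Qed.

(** This is the logarithmic derivative z b' / b of one Blaschke factor b, with
its denominators cleared. *)
Lemma poissonE a z : `|a| < 1 -> `|z| = 1 ->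
  z * (1 - `|a| ^+ 2) = (z - a^*) * (1 - a * z) * poisson a z.
Proof.
move=> a1 z1; have n0 : 1 - a * z != 0 by rewrite factor_neq0 // z1.
have zc : z - a^* = z * (1 - a * z)^*.
  by rewrite rmorphB rmorphM rmorph1 mulrBr mulr1 mulrCA conjC_unit // mulr1.
rewrite /poisson (normCK (1 - a * z)) zc.
have n0' : (1 - a * z)^* != 0 by rewrite conjC_eq0.
by move: (_^*) n0' => c c0; field; rewrite n0 c0.
Qed.

(** The logarithmic derivative of a product is the sum of those of its factors.
Denominators are cleared, so that the identity is one between polynomials. *)
Lemma blaschke_logderiv s z : all (fun a => `|a| < 1) s -> `|z| = 1 ->
  z * ((blaschke_num s)^`().[z] * (blaschke_den s).[z] - (blaschke_num s).[z] * (blaschke_den s)^`().[z]) =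
  (blaschke_num s).[z] * (blaschke_den s).[z] * \sum_(a <- s) poisson a z.
Proof.
move=> + z1; elim: s => [_|a s IH /= /andP[a1 s1]].
  by rewrite /blaschke_num /blaschke_den !big_nil derivC horner0 !(mul0r, mulr0, subrr).
have := IH s1; rewrite /blaschke_num /blaschke_den !big_cons -/(blaschke_num s) -/(blaschke_den s).
rewrite !derivM !derivB !derivX !derivC derivZ derivX.
rewrite !(hornerD, hornerN, hornerM, hornerZ, hornerC, hornerX).
set n := (blaschke_num s).[z]; set d := (blaschke_den s).[z]; set n' := _.[z]; set d' := _.[z].
move: (\sum_(j <- s) _) => P IHs.
have pE := poissonE a1 z1.
transitivity (n * d * (z * (1 - a * a^*)) +
    (z - a^*) * (1 - a * z) * (z * (n' * d - n * d'))); first by ring.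
rewrite -normCK pE IHs; ring.
Qed.

Lemma blaschke_den_neq0 s z : all (fun a => `|a| < 1) s -> `|z| <= 1 -> (blaschke_den s).[z] != 0.
Proof.
move=> s1 z1; rewrite blaschke_denE prodf_seq_neq0; apply/allP => a /(allP s1) a1.
by rewrite /= factor_neq0.
Qed.

Lemma blaschke_num_norm s z : `|z| = 1 -> `|(blaschke_num s).[z]| = `|(blaschke_den s).[z]|.
Proof.
move=> z1; rewrite blaschke_denE blaschke_numE !normr_prod; apply: eq_bigr => a _.
have := blaschke_factor_norm a z; rewrite z1 expr1n subrr mulr0 => /eqP.
rewrite subr_eq0 => /eqP e; apply/eqP.
by rewrite -(@eqrXn2 _ 2) // e.
Qed.

Lemma ltr_prod_seq s (F G : C -> C) : (0 < size s)%N ->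
  (forall a, a \in s -> 0 <= F a < G a) -> \prod_(a <- s) F a < \prod_(a <- s) G a.
Proof.
move=> s0 H; rewrite big_seq [X in _ < X]big_seq; apply: ltr_prod => //.
by case: s s0 {H} => // a s _; apply/hasP; exists a; exact: mem_head.
Qed.

Lemma blaschke_num_lt s z : (0 < size s)%N -> all (fun a => `|a| < 1) s -> `|z| < 1 ->
  `|(blaschke_num s).[z]| < `|(blaschke_den s).[z]|.
Proof.
move=> s0 s1 z1; rewrite blaschke_denE blaschke_numE !normr_prod.
apply: (@ltr_prod_seq s (fun a => `|z - a^*|) (fun a => `|1 - a * z|)) => // a /(allP s1) a1.
rewrite normr_ge0 /= -(@ltr_pXn2r _ 2) ?nnegrE // -subr_gt0 blaschke_factor_norm.
by rewrite mulr_gt0 // subr_gt0 expr_lt1.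
Qed.

Lemma blaschke_num_gt s z : (0 < size s)%N -> all (fun a => `|a| < 1) s -> 1 < `|z| ->
  `|(blaschke_den s).[z]| < `|(blaschke_num s).[z]|.
Proof.
move=> s0 s1 z1; rewrite blaschke_denE blaschke_numE !normr_prod.
apply: (@ltr_prod_seq s (fun a => `|1 - a * z|) (fun a => `|z - a^*|)) => // a /(allP s1) a1.
rewrite normr_ge0 /= -(@ltr_pXn2r _ 2) ?nnegrE // -subr_lt0 blaschke_factor_norm.
by rewrite pmulr_rlt0 ?subr_gt0 ?subr_lt0 ?expr_lt1 // exprn_egt1.
Qed.

Lemma blaschke_den_top s : (size (blaschke_den s) <= (size s).+1)%N /\
  (blaschke_den s)`_(size s) = \prod_(a <- s) (- a).
Proof.
elim: s => [|a s [IH1 IH2]]; rewrite /blaschke_den ?big_nil ?big_cons -?/(blaschke_den s).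
  by rewrite size_poly1 coefC.
rewrite mulrBl mul1r -scalerAl; split.
  rewrite (leq_trans (size_polyD _ _)) // geq_max (leq_trans IH1) //= size_polyN.
  rewrite (leq_trans (size_scale_leq _ _)) //.
  rewrite (leq_trans (size_polyMleq _ _)) // size_polyX /=.
  by rewrite ltnS.
rewrite coefB coefZ coefXM /= IH2.
by rewrite (nth_default 0 IH1) sub0r mulNr.
Qed.

Lemma blaschke_num_monic s : blaschke_num s \is monic.
Proof. exact: monic_prod_XsubC. Qed.

Lemma size_blaschke_num s : size (blaschke_num s) = (size s).+1.
Proof.
rewrite /blaschke_num -(big_map (fun a => a^*) xpredT (fun b => 'X - b%:P)).
by rewrite size_prod_XsubC size_map.
Qed.

Section Nodes.
Local Open Scope ring_scope.
Variables (s : seq C) (w : C).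
Hypotheses (s0 : (0 < size s)%N) (s1 : all (fun a => `|a| < 1) s) (w1 : `|w| = 1).
Let M := blaschke_num s + w *: blaschke_den s.

Lemma size_nodes : size M = (size s).+1.
Proof.
have [D1 D2] := blaschke_den_top s.
apply/eqP; rewrite eqn_leq; apply/andP; split.
  rewrite (leq_trans (size_polyD _ _)) // geq_max size_blaschke_num leqnn /=.
  exact: (leq_trans (size_scale_leq _ _)).
rewrite ltnNge; apply/negP => sM.
have: M`_(size s) == 0 by rewrite nth_default.
have := blaschke_num_monic s; rewrite monicE lead_coefE size_blaschke_num /= => /eqP NE.
rewrite coefD coefZ NE D2 addr_eq0 => /eqP /(congr1 Num.norm).
rewrite normr1 normrN normrM w1 mul1r normr_prod => e.
(* The top coefficients cannot cancel: 1 against a product of modulus below 1. *)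
have: \prod_(a <- s) `|- a| < \prod_(a <- s) (1 : C).
  apply: (@ltr_prod_seq s (fun a => `|- a|)) => // a /(allP s1) a1.
  by rewrite normrN normr_ge0.
by rewrite -e big1 // ltxx.
Qed.

(** At a root of M the Blaschke product takes the value - w, of modulus one, and
its modulus is below one inside the disc and above one outside. *)
Lemma nodes_circle z : root M z -> `|z| = 1.
Proof.
rewrite rootE hornerD hornerZ addr_eq0 => /eqP /(congr1 Num.norm).
rewrite normrN normrM w1 mul1r => e.
have zr : `|z| \is Num.real by rewrite realE normr_ge0.
have [z1|z1|//] := real_ltgtP zr (real1 C).
  by have := blaschke_num_lt s0 s1 z1; rewrite e ltxx.
by have := blaschke_num_gt s0 s1 z1; rewrite e ltxx.
Qed.

(** M is the denominator times b + w, with b the Blaschke product. Where b + w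
vanishes, the derivative of M is therefore the denominator times b', and
[blaschke_logderiv] computes b'. *)
Lemma nodes_deriv z : root M z ->
  z * M^`().[z] = (blaschke_num s).[z] * \sum_(a <- s) poisson a z.
Proof.
move=> Mz; have z1 := nodes_circle Mz.
have d0 : (blaschke_den s).[z] != 0 by rewrite blaschke_den_neq0 ?z1.
have := blaschke_logderiv s1 z1.
move: Mz; rewrite rootE hornerD hornerZ addr_eq0 => /eqP NE.
have -> : (blaschke_num s)^`().[z] * (blaschke_den s).[z] - (blaschke_num s).[z] * (blaschke_den s)^`().[z]
  = (blaschke_den s).[z] * M^`().[z].
  rewrite /M derivD derivZ hornerD hornerZ NE; ring.
move=> H; apply: (mulfI d0); rewrite mulrCA H; ring.
Qed.

Lemma sum_poisson_gt0 z : `|z| = 1 -> 0 < \sum_(a <- s) poisson a z.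
Proof.
move=> z1; case: (s) s0 s1 => // a s' _ /= /andP[a1 s1'].
rewrite big_cons ltr_pwDl ?poisson_gt0 //.
by rewrite big_seq sumr_ge0 // => b /(allP s1') b1; rewrite ltW // poisson_gt0.
Qed.

(** The Poisson kernels are positive, so [nodes_deriv] rules out multiple
roots. *)
Lemma nodes_separable : separable_poly M.
Proof.
rewrite unlock; apply/Pdiv.ClosedField.coprimepP => z Mz.
have z1 := nodes_circle Mz.
have P0 := sum_poisson_gt0 z1.
have n0 : (blaschke_num s).[z] != 0.
  by rewrite -normr_gt0 blaschke_num_norm // normr_gt0 blaschke_den_neq0 // z1.
have : z * M^`().[z] != 0 by rewrite nodes_deriv // mulf_neq0 // gt_eqF.
by rewrite mulf_eq0 negb_or => /andP[].
Qed.
End Nodes.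

Section BernsteinInequality.
Local Open Scope ring_scope.
Variables (s : seq C) (z0 : C).
Hypotheses (s0 : (0 < size s)%N) (s1 : all (fun a => `|a| < 1) s) (z01 : `|z0| = 1).
(* The value of the Blaschke product at z0: the nodes are the points of the
   circle where it takes the opposite value. *)
Let w := (blaschke_num s).[z0] / (blaschke_den s).[z0].
Let M := blaschke_num s + w *: blaschke_den s.
Let P z := \sum_(a <- s) poisson a z.

Let d0 : (blaschke_den s).[z0] != 0.
Proof. by rewrite blaschke_den_neq0 // z01. Qed.
Let w1 : `|w| = 1.
Proof. by rewrite normf_div blaschke_num_norm // divff // normr_eq0. Qed.
Let w0 : w != 0.
Proof. by rewrite -normr_eq0 w1 oner_eq0. Qed.
Let z00 : z0 != 0.
Proof. by rewrite -normr_eq0 z01 oner_eq0. Qed.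
Let wD : (blaschke_num s).[z0] = w * (blaschke_den s).[z0].
Proof. by rewrite /w divfK. Qed.

Let Mz0 : M.[z0] = w * (blaschke_den s).[z0] *+ 2.
Proof. by rewrite hornerD hornerZ wD mulr2n. Qed.

Let dMz0 : z0 * (M^`().[z0] * (blaschke_den s).[z0] - M.[z0] * (blaschke_den s)^`().[z0]) =
  w * (blaschke_den s).[z0] ^+ 2 * P z0.
Proof.
have := blaschke_logderiv s1 z01; rewrite -/(P z0) wD => H.
rewrite expr2 mulrA -H /M derivD derivZ !hornerD !hornerZ wD; ring.
Qed.

(** Subtracting from p a multiple of M makes it vanish at z0 without changing
it at the nodes. Lagrange interpolation of the quotient by X - z0 then gives
the derivative of p / D at z0, with D the Blaschke denominator, in terms of the
values of p / D at z0 and at the nodes. What matters is that the weights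
1 / (P z |z - z0|^2) are positive. *)
Lemma riesz_formula :
  exists r : seq C, (forall z, z \in r -> root M z) /\
  forall p, (size p <= (size s).+1)%N ->
  z0 * (p^`().[z0] * (blaschke_den s).[z0] - p.[z0] * (blaschke_den s)^`().[z0]) =
  (blaschke_den s).[z0] ^+ 2 *
  (p.[z0] / (blaschke_den s).[z0] * P z0 / 2 -
   2 * \sum_(z <- r) (p.[z] / (blaschke_den s).[z]) / (P z * `|z - z0| ^+ 2)).
Proof.
have szM := size_nodes s0 s1 w1.
have MX : M != 0 by rewrite -size_poly_gt0 szM.
have M0 : M.[z0] != 0 by rewrite Mz0 mulrn_eq0 /= mulf_neq0.
have [r [rM lag]] := lagrange_interpolation MX (nodes_separable s0 s1 w1).
exists r; split => [z|p szp]; first by rewrite rM.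
pose f := p - (p.[z0] / M.[z0]) *: M.
have f0 : root f z0 by rewrite rootE hornerD hornerN hornerZ divfK // subrr.
have [g fg] := factor_theorem _ _ f0.
have szg : (size g < size M)%N.
  have [->|gn0] := eqVneq g 0; first by rewrite size_poly0 szM.
  have : (size f <= (size s).+1)%N.
    rewrite (leq_trans (size_polyD _ _)) // geq_max szp size_polyN.
    by rewrite (leq_trans (size_scale_leq _ _)) // szM.
  by rewrite fg size_Mmonic ?monicXsubC // size_XsubC addn2 /= szM ltnS.
have gE := lag _ _ szg M0.
have g0 : g.[z0] = p^`().[z0] - p.[z0] / M.[z0] * M^`().[z0].
  have := congr1 (fun q => q^`().[z0]) fg.
  rewrite /= derivM derivXsubC mulr1 hornerD hornerM hornerXsubC subrr mulr0 add0r.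
  by rewrite /f derivD derivN derivZ hornerD hornerN hornerZ => <-.
have gz z : z \in r -> g.[z] = p.[z] / (z - z0).
  rewrite rM => /[dup] Mz /rootP Mz00.
  have zz0 : z - z0 != 0.
    by rewrite subr_eq0; apply: contraNneq M0 => <-; rewrite Mz00.
  have := congr1 (fun q => q.[z]) fg.
  rewrite /f /= hornerD hornerN hornerZ Mz00 mulr0 subr0 hornerM hornerXsubC => ->.
  by rewrite mulfK.
have sumE : g.[z0] = - (2 / z0 * (blaschke_den s).[z0]) *
    \sum_(z <- r) (p.[z] / (blaschke_den s).[z]) / (P z * `|z - z0| ^+ 2).
  rewrite gE mulr_sumr; apply: eq_big_seq => z zr; rewrite gz //.
  have Mz : root M z by rewrite -rM.
  have z1 := nodes_circle s0 s1 w1 Mz.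
  have zn0 : z != 0 by rewrite -normr_eq0 z1 oner_eq0.
  have zz0 : z - z0 != 0.
    by rewrite subr_eq0; apply: contraNneq M0 => e; rewrite -e (rootP Mz).
  have := nodes_deriv s0 s1 w1 Mz; rewrite -/(P z).
  have dz0 : (blaschke_den s).[z] != 0 by rewrite blaschke_den_neq0 ?z1.
  have Pz : P z != 0 by rewrite gt_eqF // sum_poisson_gt0.
  have -> : (blaschke_num s).[z] = - w * (blaschke_den s).[z].
    by move: Mz; rewrite rootE hornerD hornerZ addr_eq0 mulNr => /eqP.
  move=> zM; have -> : M^`().[z] = - w * (blaschke_den s).[z] * P z / z.
    by rewrite -zM mulrAC mulfV // mul1r.
  have -> : `|z - z0| ^+ 2 = - (z - z0) ^+ 2 / (z * z0).
    rewrite normCK rmorphB /=.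
    have -> : z^* = z^-1 by apply: (mulfI zn0); rewrite conjC_unit // mulfV.
    have -> : z0^* = z0^-1 by apply: (mulfI z00); rewrite conjC_unit // mulfV.
    by field; rewrite zn0 z00.
  rewrite Mz0; field.
  by rewrite z00 zn0 zz0 Pz dz0 w0 /= -opprB oppr_eq0 zz0.
move: sumE; rewrite g0.
set Sg := \sum_(z <- r) _ => gS.
have -> : p^`().[z0] = p.[z0] / M.[z0] * M^`().[z0] - 2 / z0 * (blaschke_den s).[z0] * Sg.
  by rewrite -mulNr -gS addrC subrK.
have -> : M^`().[z0] = ((w * (blaschke_den s).[z0] ^+ 2 * P z0) / z0
    + M.[z0] * (blaschke_den s)^`().[z0]) / (blaschke_den s).[z0].
  by rewrite -dMz0; field; rewrite z00 d0.
rewrite Mz0; field.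
by rewrite z00 d0 w0.
Qed.

(** The weights of [riesz_formula] do not depend on p, and their sum is found by
applying the formula to the Blaschke product, whose derivative is known. They
add up to P z0 / 4, and the two terms of the formula contribute at most
S P(z0) / 2 each. *)
Lemma bernstein p (S : C) : (size p <= (size s).+1)%N ->
  (forall z, `|z| = 1 -> `|p.[z]| <= S * `|(blaschke_den s).[z]|) ->
  `|p^`().[z0] * (blaschke_den s).[z0] - p.[z0] * (blaschke_den s)^`().[z0]| <=
  S * `|(blaschke_den s).[z0]| ^+ 2 * P z0.
Proof.
move=> szp pS.
have P0 := sum_poisson_gt0 s0 s1 z01; rewrite -/(P z0) in P0.
have dn0 : 0 < `|(blaschke_den s).[z0]| by rewrite normr_gt0.
have [r [rM riesz]] := riesz_formula.
have := riesz _ (eq_leq (size_blaschke_num s)).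
rewrite (blaschke_logderiv s1 z01) -/(P z0) wD mulfK // => NE.
have r1 z : z \in r -> `|z| = 1 by move=> /rM; exact: nodes_circle.
set Sg := \sum_(z <- r) (P z * `|z - z0| ^+ 2)^-1.
have SgE : Sg = P z0 / 4.
  have e : \sum_(z <- r) ((blaschke_num s).[z] / (blaschke_den s).[z]) / (P z * `|z - z0| ^+ 2)
     = - w * Sg.
    rewrite mulr_sumr; apply: eq_big_seq => z zr; congr (_ / _).
    have dz0 : (blaschke_den s).[z] != 0 by rewrite blaschke_den_neq0 // r1.
    have := rM _ zr; rewrite rootE hornerD hornerZ addr_eq0 -mulNr => /eqP ->.
    by rewrite mulfK.
  move: NE; rewrite e => NE.
  have wd : w * (blaschke_den s).[z0] ^+ 2 != 0 by rewrite mulf_neq0 // expf_neq0.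
  apply: (mulfI wd).
  have -> : w * (blaschke_den s).[z0] ^+ 2 * (P z0 / 4) =
     (w * (blaschke_den s).[z0] * (blaschke_den s).[z0] * P z0 -
     (blaschke_den s).[z0] ^+ 2 * (w * P z0 / 2)) / 2 by field.
  rewrite NE; by field.
rewrite -[X in X <= _]mul1r -z01 -normrM riesz // normrM normrX.
rewrite [leRHS]mulrAC [leRHS]mulrC ler_pM2l ?exprn_gt0 //.
have -> : S * P z0 = S * P z0 / 2 + 2 * (S * Sg) by rewrite SgE; field.
have S_ge z : `|z| = 1 -> `|p.[z] / (blaschke_den s).[z]| <= S.
  move=> z1; rewrite normf_div ler_pdivrMr ?pS // normr_gt0 blaschke_den_neq0 // z1 //.
rewrite (le_trans (ler_normB _ _)) // lerD //.
  rewrite normf_div normrM (gtr0_norm P0) normr_nat ler_pM2r ?invr_gt0 ?ltr0n //.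
  by rewrite ler_pM2r // S_ge.
rewrite normrM normr_nat ler_pM2l ?ltr0n // (le_trans (ler_norm_sum _ _ _)) //.
rewrite mulr_sumr big_seq [leRHS]big_seq; apply: ler_sum => z zr.
have z1 := r1 _ zr.
have Pz := sum_poisson_gt0 s0 s1 z1; rewrite -/(P z) in Pz.
rewrite normf_div [`|P z * _|]ger0_norm ?mulr_ge0 ?exprn_ge0 ?(ltW Pz) //.
by rewrite ler_wpM2r ?S_ge // invr_ge0 mulr_ge0 ?exprn_ge0 // ltW.
Qed.
End BernsteinInequality.
End Bernstein.

(** * Averages over the roots of unity *)
Section DFT.
Local Open Scope ring_scope.
Variable C : numClosedFieldType.

Lemma closed_prim_root n : (0 < n)%N -> exists z : C, n.-primitive_root z.
Proof.
move=> n_gt0; pose p : {poly C} := 'X^n - 1.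
have [r Dp] := closed_field_poly_normal p.
move: Dp; rewrite (monicP (monicXnsubC _ _)) // scale1r => Dp.
have sz_p : size p = n.+1 by apply: size_XnsubC.
have rn1 : all n.-unity_root r.
  by apply/allP => z; rewrite -root_prod_XsubC -Dp.
have sz_r : (n <= size r)%N by rewrite -ltnS -sz_p Dp size_prod_XsubC.
have r_uniq : uniq r.
  by rewrite -separable_prod_XsubC -Dp separable_Xn_sub_1 // pnatr_eq0 -lt0n.
by have /hasP[z _ zn] := has_prim_root n_gt0 rn1 r_uniq sz_r; exists z.
Qed.

Variables (N : nat) (w : C).
Hypothesis (wN : N.-primitive_root w).

Lemma prim_sum k : \sum_(i < N) (w ^+ i) ^+ k = (N %| k)%N%:R * N%:R.
Proof.
have [kN|kN] := boolP (N %| k)%N.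
  rewrite mul1r (eq_bigr (fun=> 1)) ?sumr_const ?card_ord // => i _.
  rewrite exprAC; move/dvdnP: kN => [q ->].
  by rewrite mulnC exprM (prim_expr_order wN) !expr1n.
rewrite mul0r; have wk : w ^+ k - 1 != 0.
  by rewrite subr_eq0 -(prim_order_dvd wN).
apply: (mulfI wk); rewrite mulr0 (eq_bigr (fun i : 'I_N => (w ^+ k) ^+ i)); last first.
  by move=> i _; rewrite exprAC.
by rewrite -subrX1 exprAC (prim_expr_order wN) expr1n subrr.
Qed.

Lemma prim_norm i : `|w ^+ i| = 1.
Proof.
have N0 : (0 < N)%N by apply: (prim_order_gt0 wN).
have: `|w| ^+ N = 1 by rewrite -normrX (prim_expr_order wN) normr1.
move=> /eqP; rewrite -[X in _ == X](expr1n C N) eqrXn2 // => /eqP w1.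
by rewrite normrX w1 expr1n.
Qed.

Lemma prim_exprN i : (w ^+ i) ^+ N = 1.
Proof. by rewrite exprAC (prim_expr_order wN) expr1n. Qed.

(** On the circle the Poisson kernel is 1/(1 - az) plus its conjugate minus 1.
Multiplying by 1 - a^N turns 1/(1 - az) into a sum of powers of z below N when
z^N = 1, and averaging over the N-th roots of unity leaves the constant one. *)
Lemma sum_poisson (a : C) : `|a| < 1 ->
  \sum_(i < N) poisson a (w ^+ i) =
  N%:R * ((1 - `|a ^+ N| ^+ 2) / `|1 - a ^+ N| ^+ 2).
Proof.
move=> a1; have N0 : (0 < N)%N by apply: (prim_order_gt0 wN).
have aN1 : `|a ^+ N| < 1 by rewrite normrX exprn_ilt1 // -?lt0n.
have nN : 1 - a ^+ N != 0.
  by have := @factor_neq0 _ (a ^+ N) 1 aN1; rewrite normr1 mulr1; apply.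
have inv z : z ^+ N = 1 -> `|z| = 1 ->
    (1 - a * z)^-1 = (1 - a ^+ N)^-1 * \sum_(j < N) a ^+ j * z ^+ j.
  move=> zN z1; have nz : 1 - a * z != 0 by rewrite factor_neq0 ?z1.
  have geo : (1 - a * z) * (\sum_(j < N) a ^+ j * z ^+ j) = 1 - a ^+ N.
    rewrite (eq_bigr (fun j : 'I_N => (a * z) ^+ j)) => [|j _]; last by rewrite exprMn.
    by rewrite -opprB mulNr -subrX1 opprB exprMn zN mulr1.
  by apply: (mulfI nz); rewrite mulfV // mulrCA geo mulVf.
have pE (b z : C) : 1 - b * z != 0 -> `|z| = 1 -> (1 - `|b| ^+ 2) / `|1 - b * z| ^+ 2 =
    (1 - b * z)^-1 + ((1 - b * z)^-1)^* - 1.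
  move=> nz z1; rewrite !normCK fmorphV.
  have nzc : (1 - b * z)^* != 0 by rewrite conjC_eq0.
  have e : b * b^* = (b * z) * (b * z)^*.
    by rewrite rmorphM /= mulrACA (conjC_unit z1) mulr1.
  rewrite e; move: nz nzc; rewrite !rmorphB !rmorph1 /=.
  by move: (b * z) (_^*) => x y nz nzc; field; rewrite nz nzc.
have sE : \sum_(i < N) (1 - a * w ^+ i)^-1 = N%:R / (1 - a ^+ N).
  rewrite (eq_bigr (fun i : 'I_N => (1 - a ^+ N)^-1 *
      \sum_(j < N) a ^+ j * (w ^+ i) ^+ j)) => [|i _]; last first.
    by rewrite inv ?prim_exprN ?prim_norm.
  rewrite -mulr_sumr exchange_big /= mulrC; congr (_ * _).
  under eq_bigr do rewrite -mulr_sumr prim_sum.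
  rewrite (bigD1 (Ordinal N0)) //= dvdn0 ?expr0 !mul1r big1 ?addr0 // => j j0.
  rewrite gtnNdvd ?mul0r ?mulr0 // lt0n; by apply: contra j0 => /eqP j0; apply/eqP/val_inj.
rewrite (eq_bigr (fun i : 'I_N => (1 - a * w ^+ i)^-1 + ((1 - a * w ^+ i)^-1)^* - 1)); last first.
  by move=> i _; rewrite /poisson pE ?prim_norm // factor_neq0 ?prim_norm.
rewrite big_split big_split /= -rmorph_sum /= sE sumrN sumr_const card_ord.
have := @pE (a ^+ N) 1; rewrite mulr1 normr1 => -> //.
by rewrite rmorphM rmorph_nat !mulrDr mulrN1.
Qed.
End DFT.

(** * Resolvents as rational functions *)
Section Newton.
Local Open Scope ring_scope.
Variables (C : numClosedFieldType) (m : nat) (X : 'M[C]_m.+1) (u : 'rV[C]_m.+1).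
Implicit Types (s : seq C) (v w : 'cV[C]_m.+1).

Definition newton_prod s : 'M[C]_m.+1 := \prod_(a <- s) (X - a%:M).

(** The numerator of z |-> u (1 - zX)^-1 v over the denominator
[blaschke_den s], up to a remainder that carries the factor [newton_prod s]:
see [newton_num_eval]. The recursion is Newton's interpolation scheme, one node
of s at a time. *)
Fixpoint newton_num s v : {poly C} := if s is a :: s' then
  (u *m v) 0 0 *: blaschke_den s' + 'X * newton_num s' ((X - a%:M) *m v) else 0.

Lemma size_newton_num s v : (size (newton_num s v) <= (size s).+1)%N.
Proof.
elim: s v => [|a s IH] v /=; first by rewrite size_poly0.
rewrite (leq_trans (size_polyD _ _)) // geq_max; apply/andP; split.
  rewrite (leq_trans (size_scale_leq _ _)) //.
  by have [D1 _] := blaschke_den_top s; exact: (leq_trans D1).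
rewrite (leq_trans (size_polyMleq _ _)) // size_polyX /=.
exact: IH.
Qed.

Lemma newton_prod_comm s : X *m newton_prod s = newton_prod s *m X.
Proof.
rewrite /newton_prod; elim: s => [|a s IH]; first by rewrite big_nil mulmx1 mul1mx.
rewrite big_cons [LHS]mulrA -[RHS]mulrA -[X in _ = _ * X]IH [RHS]mulrA; congr (_ * _).
by rewrite mulrBl mulrBr; congr (_ - _); exact: scalar_mxC.
Qed.

Lemma resolvent_step a v w (z : C) : (1%:M - z *: X) *m w = v ->
  (1%:M - z *: X) *m ((X - a%:M) *m w) = (X - a%:M) *m v.
Proof.
move=> <-; rewrite !mulmxA; congr (_ *m _).
rewrite !(mulmxBl, mulmxBr, mul1mx, mulmx1, mul_scalar_mx, mul_mx_scalar).
rewrite -scalemxAl -scalemxAr scalerA.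
by rewrite !opprB addrACA [RHS]addrACA (addrC (- a%:M)).
Qed.

Lemma newton_step a v w (z : C) : (1%:M - z *: X) *m w = v ->
  (u *m v) 0 0 = (1 - a * z) * (u *m w) 0 0 - z * (u *m ((X - a%:M) *m w)) 0 0.
Proof.
move=> <-; rewrite !mulmxBl mul1mx mulmxBr -!scalemxAl -!scalemxAr mul_scalar_mx.
rewrite mulmxBr -!scalemxAr !mxE; ring.
Qed.

Lemma newton_prod_cons p a s (w : 'M[C]_(m.+1, p)) :
  newton_prod (a :: s) *m w = newton_prod s *m ((X - a%:M) *m w).
Proof.
rewrite /newton_prod big_cons -/(newton_prod s) -mulmxE mulmxA; congr (_ *m _).
by rewrite mulmxBl mulmxBr -newton_prod_comm scalar_mxC.
Qed.

Lemma newton_num_eval s v w (z : C) : (1%:M - z *: X) *m w = v ->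
  (newton_num s v).[z] = (blaschke_den s).[z] * (u *m w) 0 0 - z ^+ size s * (u *m (newton_prod s *m w)) 0 0.
Proof.
elim: s v w => [|a s IH] v w wE /=.
  by rewrite /newton_prod /blaschke_den !big_nil horner0 hornerC expr0 !mul1r mul1mx subrr.
rewrite hornerD hornerZ hornerM hornerX (IH _ _ (resolvent_step a wE)) newton_prod_cons.
rewrite (newton_step a wE) /blaschke_den big_cons -/(blaschke_den s) hornerM hornerD hornerN hornerZ hornerX.
rewrite hornerC exprS; ring.
Qed.

(** Here w is (1 - zX)^-1 v and w' is (1 - zX)^-1 X w, the derivative of w with
respect to z; both are described by equations, so that no inverse occurs. *)
Lemma newton_num_deriv s v w w' (z : C) :
  (1%:M - z *: X) *m w = v -> (1%:M - z *: X) *m w' = X *m w ->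
  (newton_num s v)^`().[z] = (blaschke_den s)^`().[z] * (u *m w) 0 0 + (blaschke_den s).[z] * (u *m w') 0 0
    - ('X^(size s))^`().[z] * (u *m (newton_prod s *m w)) 0 0
    - z ^+ size s * (u *m (newton_prod s *m w')) 0 0.
Proof.
elim: s v w w' => [|a s IH] v w w' wE w'E /=.
  rewrite /newton_prod /blaschke_den !big_nil deriv0 expr0 derivC horner0 hornerC expr0 !mul1r.
  rewrite [1 *m w']mul1mx; ring.
rewrite derivD derivZ derivM derivX mul1r !hornerD hornerZ hornerM hornerX.
have w'E2 : (1%:M - z *: X) *m ((X - a%:M) *m w') = X *m ((X - a%:M) *m w).
  rewrite (resolvent_step a w'E) !mulmxA; congr (_ *m _).
  by rewrite mulmxBl mulmxBr scalar_mxC.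
rewrite (IH _ _ _ (resolvent_step a wE) w'E2) (newton_num_eval s (resolvent_step a wE)) !newton_prod_cons.
have w'u : (u *m (X *m w)) 0 0 = (1 - a * z) * (u *m w') 0 0
     - z * (u *m ((X - a%:M) *m w')) 0 0 := newton_step a w'E.
have wu : (u *m ((X - a%:M) *m w)) 0 0 = (u *m (X *m w)) 0 0 - a * (u *m w) 0 0.
  by rewrite mulmxBl mulmxBr mul_scalar_mx -scalemxAr !mxE.
rewrite (newton_step a wE) wu w'u /blaschke_den big_cons -/(blaschke_den s).
rewrite derivM derivB derivC derivZ derivX !hornerM !hornerD !hornerN !hornerZ !hornerX !hornerC.
rewrite !hornerM !hornerD !hornerN !hornerZ !hornerX !hornerC.
rewrite (exprS 'X) derivM derivX mul1r !hornerD hornerM hornerX hornerXn exprS.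
ring.
Qed.

Lemma newton_num_quotient s v w w' (z : C) : newton_prod s = 0 ->
  (1%:M - z *: X) *m w = v -> (1%:M - z *: X) *m w' = X *m w ->
  (newton_num s v)^`().[z] * (blaschke_den s).[z] - (newton_num s v).[z] * (blaschke_den s)^`().[z] =
  (blaschke_den s).[z] ^+ 2 * (u *m w') 0 0.
Proof.
move=> n0 wE w'E; rewrite (newton_num_deriv s wE w'E) (newton_num_eval s wE) n0 !mul0mx !mulmx0.
have -> : (0 : 'M[C]_1) 0 0 = 0 by rewrite mxE.
ring.
Qed.

(** Once [newton_prod s] vanishes, u (1 - zX)^-1 v is the rational function
[newton_num s v] over [blaschke_den s], to which [bernstein] applies. *)
Lemma resolvent_bernstein s v w w' (z S : C) : (0 < size s)%N ->
  all (fun a => `|a| < 1) s -> newton_prod s = 0 -> `|z| = 1 ->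
  (forall y, `|y| = 1 -> exists2 wy, (1%:M - y *: X) *m wy = v & `|(u *m wy) 0 0| <= S) ->
  (1%:M - z *: X) *m w = v -> (1%:M - z *: X) *m w' = X *m w ->
  `|(u *m w') 0 0| <= S * \sum_(a <- s) poisson a z.
Proof.
move=> s0 s1 n0 z1 HS wE w'E.
have d0 : 0 < `|(blaschke_den s).[z]| by rewrite normr_gt0 blaschke_den_neq0 // z1.
have H := @bernstein _ s z s0 s1 z1 (newton_num s v) S (size_newton_num s v).
rewrite (newton_num_quotient n0 wE w'E) normrM normrX in H.
rewrite -(ler_pM2l (exprn_gt0 2 d0)) mulrA [X in _ <= X * _]mulrC.
apply: H => y y1.
have [wy wyE le] := HS y y1.
rewrite (newton_num_eval s wyE) n0 mul0mx mulmx0.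
have -> : (0 : 'M[C]_1) 0 0 = 0 by rewrite mxE.
rewrite mulr0 subr0 normrM mulrC.
by rewrite ler_wpM2r.
Qed.
End Newton.

(** The list of eigenvalues with multiplicities; the product vanishes by the
Cayley-Hamilton theorem. *)
Lemma eigenvalue_seq (C : numClosedFieldType) m (X : 'M[C]_m.+1) :
  exists s : seq C, [/\ size s = m.+1, newton_prod X s = 0 &
    forall a, a \in s -> X - a%:M \notin unitmx].
Proof.
have [s sE] := closed_field_poly_normal (char_poly X).
rewrite (monicP (char_poly_monic X)) scale1r in sE.
exists s; split.
- by have := size_char_poly X; rewrite sE size_prod_XsubC => -[].
- have := Cayley_Hamilton X; rewrite sE rmorph_prod /newton_prod => <-.
  apply: eq_bigr => a _; by rewrite rmorphB /= horner_mx_X horner_mx_C.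
move=> a; rewrite -root_prod_XsubC -sE -eigenvalue_root_char.
by rewrite /eigenvalue /eigenspace kermx_eq0 row_free_unit.
Qed.

(** * Taylor coefficients of the derivative of a resolvent *)
Section CoefficientBound.
Local Open Scope ring_scope.
Variables (C : numClosedFieldType) (m : nat) (X : 'M[C]_m.+1) (u : 'rV[C]_m.+1).
Variables (s : seq C) (N l : nat) (v : 'cV[C]_m.+1) (S : C).
Hypotheses (s0 : (0 < size s)%N) (s1 : all (fun a => `|a| < 1) s) (ns : newton_prod X s = 0).
Hypothesis (lN : (l < N)%N).
Let Z := (1%:M - X ^+ N).
Hypothesis HS : forall y, `|y| = 1 ->
  exists2 w, (1%:M - y *: X) *m w = Z *m (Z *m v) & `|(u *m w) 0 0| <= S.

(** At an N-th root of unity the geometric sum inverts 1 - zX up to the factor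
Z = 1 - X^N, which does not depend on the root. *)
Lemma geom_mx (z : C) : z ^+ N = 1 ->
  (1%:M - z *: X) *m (\sum_(j < N) z ^+ j *: X ^+ j) = Z.
Proof.
move=> zN; rewrite -opprB mulNmx.
rewrite (eq_bigr (fun j : 'I_N => (z *: X) ^+ j)) => [|j _]; last by rewrite exprZn.
by rewrite [_ *m _](_ : _ = (z *: X - 1) * \sum_(j < N) (z *: X) ^+ j) // -subrX1 exprZn zN scale1r opprB.
Qed.

(** Instead of integrating z^-l X (1 - zX)^-2 over the circle, average it over
the N-th roots of unity, after applying Z twice so that the inverses become the
sums of [geom_mx]. Two sums of powers below N multiply to a combination of the
(zX)^(j+k); the average against z^(N-l) keeps those with j + k = l, which are
l + 1 in number, and those with j + k = N + l, which are N - l - 1. The upper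
bound is [resolvent_bernstein] at each root of unity, and [sum_poisson]. *)
Lemma discrete_coef_bound :
  `|(u *m ((X * (l.+1%:R *: X ^+ l + (N - l.+1)%:R *: X ^+ (N + l))) *m v)) 0 0| <=
  S * \sum_(a <- s) ((1 - `|a ^+ N| ^+ 2) / `|1 - a ^+ N| ^+ 2).
Proof.
have N0 : (0 < N)%N by apply: leq_trans lN.
have [w wN] := closed_prim_root C N0.
pose G z := \sum_(j < N) z ^+ j *: X ^+ j.
have XG z : G z * X = X * G z.
  rewrite /G mulr_suml mulr_sumr; apply: eq_bigr => j _.
  by rewrite -scalerAl -scalerAr -exprSr -exprS.
have ZG z : G z * Z = Z * G z.
  rewrite /G mulr_suml mulr_sumr; apply: eq_bigr => j _.
  by rewrite -scalerAl -scalerAr /Z mulrBr mulrBl mulr1 mul1r -!exprD addnC.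
have sumG : \sum_(i < N) (w ^+ i) ^+ (N - l) *: (G (w ^+ i) * G (w ^+ i)) =
    N%:R *: (l.+1%:R *: X ^+ l + (N - l.+1)%:R *: X ^+ (N + l)).
  transitivity (\sum_(j < N) N%:R *: (if (j <= l)%N then X ^+ l else X ^+ (N + l))).
    transitivity (\sum_(j < N) \sum_(k < N)
        (\sum_(i < N) (w ^+ i) ^+ (N - l + j + k)) *: X ^+ (j + k)).
      under eq_bigr => i _.
        rewrite /G mulr_suml scaler_sumr; under eq_bigr => j _.
          rewrite mulr_sumr scaler_sumr; under eq_bigr => k _.
            rewrite -scalerAl -scalerAr scalerA scalerA -!exprD; over.
          over.
        over.
      rewrite exchange_big; apply: eq_bigr => j _.
      rewrite exchange_big; apply: eq_bigr => k _.
      by rewrite scaler_suml.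
    apply: eq_bigr => j _.
    have jN := ltn_ord j.
    have jl : ((if (j <= l)%N then (l - j)%N else (N + l - j)%N) < N)%N.
      by case: (leqP j l) => jl; lia.
    pose k0 : 'I_N := Ordinal jl.
    rewrite (bigD1 k0) //= prim_sum // big1 ?addr0 => [|k kk0].
      case: (leqP j l) => jl'.
        have -> : (N - l + j + (l - j) = N)%N by lia.
        by rewrite subnKC // dvdnn mul1r.
      have -> : (N - l + j + (N + l - j) = 2 * N)%N by lia.
      by rewrite dvdn_mull // mul1r subnKC //; lia.
    rewrite prim_sum //; case: dvdnP; last by rewrite mul0r scale0r.
    move=> [q qN]; exfalso; move/eqP: kk0; apply; apply/val_inj => /=.
    have kN := ltn_ord k.
    (* The exponent N - l + j + k lies strictly between 0 and 3 N. *)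
    have q0 : (q != 0)%N by apply/eqP => q0; move: qN; rewrite q0; lia.
    have q3 : (q < 3)%N by rewrite ltnNge; apply/negP => q3; have := leq_mul2r N 3 q; rewrite q3 orbT; lia.
    case: q qN q0 q3 => [|[|[|q]]] // qN _ _; case: (leqP j l) => jl'; lia.
  rewrite -scaler_sumr; congr (_ *: _).
  rewrite -(big_mkord xpredT (fun j => if (j <= l)%N then X ^+ l else X ^+ (N + l))).
  rewrite (big_cat_nat _ (n := l.+1)) //=.
  congr (_ + _).
    rewrite (eq_big_nat _ _ (F2 := fun=> X ^+ l)) => [|j /andP[_ jl]].
      by rewrite sumr_const_nat subn0 scaler_nat.
    by rewrite -ltnS jl.
  rewrite (eq_big_nat _ _ (F2 := fun=> X ^+ (N + l))) => [|j /andP[jl _]].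
    by rewrite sumr_const_nat scaler_nat.
  by rewrite leqNgt jl.
have main : N%:R * (u *m ((X * (l.+1%:R *: X ^+ l + (N - l.+1)%:R *: X ^+ (N + l))) *m v)) 0 0 =
   \sum_(i < N) (w ^+ i) ^+ (N - l) * (u *m (X * (G (w ^+ i) * G (w ^+ i)) *m v)) 0 0.
  transitivity ((u *m (X * (N%:R *: (l.+1%:R *: X ^+ l + (N - l.+1)%:R *: X ^+ (N + l))) *m v)) 0 0).
    by rewrite -scalerAr -scalemxAl -scalemxAr [RHS]mxE.
  rewrite -sumG mulr_sumr mulmx_suml mulmx_sumr summxE; apply: eq_bigr => i _.
  by rewrite -scalerAr -scalemxAl -scalemxAr mxE.
have NC : 0 < N%:R :> C by rewrite ltr0n.
rewrite -(ler_pM2l NC) -[X in X * _ <= _]normr_nat -normrM main.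
rewrite (le_trans (ler_norm_sum _ _ _)) // mulrCA mulr_sumr.
rewrite (eq_big_seq (fun a => \sum_(i < N) poisson a (w ^+ i))); last first.
  by move=> a /(allP s1) a1; rewrite sum_poisson.
rewrite exchange_big /= mulr_sumr; apply: ler_sum => i _.
rewrite normrM normrX (prim_norm wN) expr1n mul1r.
set z := w ^+ i.
have zN : z ^+ N = 1 by rewrite /z (prim_exprN wN).
have gz : (1%:M - z *: X) *m G z = Z := geom_mx zN.
apply: (@resolvent_bernstein _ _ X u s (Z *m (Z *m v)) (G z *m (Z *m v)) _ z S) => //.
- by rewrite /z (prim_norm wN).
- by rewrite [LHS]mulmxA gz.
- rewrite !mulmxA; congr (_ *m _).
  transitivity (X * ((1%:M - z *: X) * G z) * G z); last first.
    by rewrite [(_ - _) * _]gz -mulrA -ZG mulrA.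
  rewrite [RHS](_ : _ = X *m (1%:M - z *: X) *m G z *m G z); last by rewrite mulrA.
  congr (_ *m _ *m _).
  by rewrite [LHS]mulmxBl [RHS]mulmxBr mul1mx mulmx1 -scalemxAl -scalemxAr.
Qed.
End CoefficientBound.

(** * Modulus, Euclidean norm and operator norm *)
Local Notation nc := Normc.normc.

Section Modulus.
Variable R : realType.
Implicit Types x y z : R[i].

Lemma norm_nc x : `|x| = (nc x)%:C. Proof. by []. Qed.

Lemma nc_ge0 x : 0 <= nc x. Proof. by case: x => a b; exact: sqrtr_ge0. Qed.

Lemma nc_eq0 x : (nc x == 0) = (x == 0).
Proof.
apply/eqP/eqP => [|->]; first exact: Normc.eq0_normc.
exact: Normc.normc0.
Qed.

Lemma nc_real (a : R) : nc a%:C = `|a|.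
Proof. by rewrite /= expr0n addr0 sqrtr_sqr. Qed.

Lemma ncX x k : nc (x ^+ k) = nc x ^+ k.
Proof. by elim: k => [|k IH]; rewrite ?Normc.normc1 // !exprS Normc.normcM IH. Qed.

Lemma ncB_le x y : nc (x - y) <= nc x + nc y.
Proof. by rewrite -(normcN y) le_normcD. Qed.

Lemma nc_conj x : nc (x^*) = nc x.
Proof. by case: x => a b /=; rewrite sqrrN. Qed.

Lemma nc_Re x : `|complex.Re x| <= nc x.
Proof. by rewrite -lecR -norm_nc normc_ge_Re. Qed.

Lemma nc_Im x : `|complex.Im x| <= nc x.
Proof.
by case: x => a b /=; rewrite -sqrtr_sqr ler_wsqrtr // lerDr sqr_ge0.
Qed.

Lemma nc_sum (I : Type) (r : seq I) (P : pred I) (F : I -> R[i]) :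
  nc (\sum_(i <- r | P i) F i) <= \sum_(i <- r | P i) nc (F i).
Proof.
apply: (big_ind2 (fun a b => nc a <= b)) => //; first by rewrite Normc.normc0.
by move=> a b c d ab cd; rewrite (le_trans (le_normcD _ _)) // lerD.
Qed.

Lemma nc_natr k : nc (k%:R : R[i]) = k%:R.
Proof. by rewrite -(rmorph_nat (real_complex R)) nc_real ger0_norm. Qed.

End Modulus.

(** Lagrange's identity writes the difference as half a sum of squares. *)
Lemma cauchy_schwarz_real (R : realType) n (a b : 'I_n -> R) :
  (\sum_i a i * b i) ^+ 2 <= (\sum_i a i ^+ 2) * (\sum_i b i ^+ 2).
Proof.
have : 0 <= \sum_i \sum_j (a i * b j - a j * b i) ^+ 2.
  by apply: sumr_ge0 => i _; apply: sumr_ge0 => j _; rewrite sqr_ge0.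
have -> : \sum_i \sum_j (a i * b j - a j * b i) ^+ 2 =
  2 * ((\sum_i a i ^+ 2) * (\sum_i b i ^+ 2) - (\sum_i a i * b i) ^+ 2).
  rewrite (eq_bigr (fun i => a i ^+ 2 * (\sum_j b j ^+ 2)
     + (b i ^+ 2 * \sum_j a j ^+ 2) - 2 * ((a i * b i) * \sum_j a j * b j))).
    rewrite !big_split /= sumrN -mulr_sumr -!mulr_suml; ring.
  move=> i _; rewrite !mulr_sumr -!sumrN -!big_split; apply: eq_bigr => j _ /=; ring.
by rewrite pmulr_rge0 // subr_ge0.
Qed.

Section EuclideanNorm.
Variable R : realType.
Implicit Types (n : nat).

Lemma enorm_ge0 n (v : 'cV[R[i]]_n) : 0 <= enorm v.
Proof. exact: sqrtr_ge0. Qed.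

Lemma enorm_sqr n (v : 'cV[R[i]]_n) : enorm v ^+ 2 = \sum_i nc (v i 0) ^+ 2.
Proof. by rewrite sqr_sqrtr // sumr_ge0 // => i _; rewrite sqr_ge0. Qed.

Lemma enorm_eq0 n (v : 'cV[R[i]]_n) : (enorm v == 0) = (v == 0).
Proof.
rewrite -sqrf_eq0 enorm_sqr psumr_eq0 => [|i _]; last exact: sqr_ge0.
apply/allP/eqP => [H|-> i _].
  apply/matrixP => i j; rewrite ord1 mxE.
  by have := H i (mem_index_enum i); rewrite sqrf_eq0 nc_eq0 => /eqP.
by rewrite mxE Normc.normc0 expr0n eqxx.
Qed.

Lemma enorm0 n : enorm (0 : 'cV[R[i]]_n) = 0.
Proof. by apply/eqP; rewrite enorm_eq0. Qed.

Lemma enorm_gt0 n (v : 'cV[R[i]]_n) : (0 < enorm v) = (v != 0).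
Proof. by rewrite lt_neqAle enorm_ge0 andbT eq_sym enorm_eq0. Qed.

Lemma enormZ n (a : R[i]) (v : 'cV[R[i]]_n) : enorm (a *: v) = nc a * enorm v.
Proof.
apply/eqP; rewrite -(@eqrXn2 _ 2) ?mulr_ge0 ?enorm_ge0 ?nc_ge0 //.
rewrite exprMn !enorm_sqr mulr_sumr; apply/eqP; apply: eq_bigr => i _.
by rewrite mxE Normc.normcM exprMn.
Qed.

Lemma enormD n (v w : 'cV[R[i]]_n) : enorm (v + w) <= enorm v + enorm w.
Proof.
rewrite -(@ler_pXn2r _ 2) ?nnegrE ?addr_ge0 ?enorm_ge0 //.
rewrite sqrrD !enorm_sqr.
have H : \sum_i nc (v i 0) * nc (w i 0) <= enorm v * enorm w.
  rewrite (le_trans (ler_norm _)) // -(@ler_pXn2r _ 2) ?nnegrE ?mulr_ge0 ?enorm_ge0 //.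
  by rewrite real_normK ?num_real // exprMn !enorm_sqr cauchy_schwarz_real.
apply: (@le_trans _ _ (\sum_i (nc (v i 0) ^+ 2 + nc (w i 0) ^+ 2 + nc (v i 0) * nc (w i 0) *+ 2))).
  apply: ler_sum => i _; rewrite mxE addrAC -sqrrD.
  by rewrite ler_pXn2r ?nnegrE ?addr_ge0 ?nc_ge0 // le_normcD.
rewrite !big_split /= -[X in _ <= X]addrAC lerD2l.
by rewrite mulr2n lerD.
Qed.

Lemma enormN n (v : 'cV[R[i]]_n) : enorm (- v) = enorm v.
Proof. by rewrite -scaleN1r enormZ normcN Normc.normc1 mul1r. Qed.

Lemma enormB n (v w : 'cV[R[i]]_n) : enorm (v - w) <= enorm v + enorm w.
Proof. by rewrite -(enormN w) enormD. Qed.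

Lemma enorm_sum n (I : Type) (r : seq I) (P : pred I) (F : I -> 'cV[R[i]]_n) :
  enorm (\sum_(i <- r | P i) F i) <= \sum_(i <- r | P i) enorm (F i).
Proof.
apply: (big_ind2 (fun a b => enorm a <= b)) => //; first by rewrite enorm0.
by move=> a b c d ab cd; rewrite (le_trans (enormD _ _)) // lerD.
Qed.

Lemma nc_enorm n (v : 'cV[R[i]]_n) i : nc (v i 0) <= enorm v.
Proof.
rewrite -(@ler_pXn2r _ 2) ?nnegrE ?nc_ge0 ?enorm_ge0 // enorm_sqr (bigD1 i) //=.
by rewrite lerDl sumr_ge0 // => j _; rewrite sqr_ge0.
Qed.

Lemma enorm_le_sum n (v : 'cV[R[i]]_n) : enorm v <= \sum_i nc (v i 0).
Proof.
have -> : v = \sum_i v i 0 *: delta_mx i 0.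
  by rewrite {1}[v]matrix_sum_delta; apply: eq_bigr => i _; rewrite big_ord1.
rewrite (le_trans (enorm_sum _ _ _)) //; apply: ler_sum => i _.
rewrite enormZ summxE (bigD1 i) //= big1 => [|j ji]; last first.
  by rewrite !mxE eq_sym (negbTE ji) mulr0.
rewrite !mxE !eqxx mulr1 addr0 -[leRHS]mulr1 ler_wpM2l ?nc_ge0 //.
rewrite -(@ler_pXn2r _ 2) ?nnegrE ?enorm_ge0 // enorm_sqr (bigD1 i) //=.
rewrite big1 => [|j ji]; last by rewrite mxE (negbTE ji) Normc.normc0 expr0n.
by rewrite mxE !eqxx Normc.normc1 addr0.
Qed.

Definition adjoint_row n (u : 'cV[R[i]]_n) : 'rV[R[i]]_n := \row_j (u j 0)^*.

Lemma nc_dot n (u v : 'cV[R[i]]_n) : nc ((adjoint_row u *m v) 0 0) <= enorm u * enorm v.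
Proof.
rewrite mxE (le_trans (nc_sum _ _ _)) //.
rewrite -(@ler_pXn2r _ 2) ?nnegrE ?mulr_ge0 ?enorm_ge0 //; last first.
  by apply: sumr_ge0 => i _; exact: nc_ge0.
rewrite exprMn !enorm_sqr (eq_bigr (fun i => nc (u i 0) * nc (v i 0))).
  exact: cauchy_schwarz_real.
by move=> i _; rewrite Normc.normcM mxE nc_conj.
Qed.

Lemma nc_dot_self n (v : 'cV[R[i]]_n) : nc ((adjoint_row v *m v) 0 0) = enorm v ^+ 2.
Proof.
have -> : (adjoint_row v *m v) 0 0 = (enorm v ^+ 2)%:C.
  rewrite enorm_sqr mxE rmorph_sum; apply: eq_bigr => i _ /=.
  by rewrite mxE mulrC -sqr_normc norm_nc rmorphXn.
by rewrite nc_real ger0_norm // sqr_ge0.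
Qed.

End EuclideanNorm.

Section OperatorNorm.
Variable R : realType.

(** A crude bound, only used to see that the supremum in [opnorm] is finite and
that entrywise convergence implies convergence in norm. *)
Lemma enorm_mulmx_le m n (X : 'M[R[i]]_(m, n)) (v : 'cV_n) :
  enorm (X *m v) <= (\sum_i \sum_j nc (X i j)) * enorm v.
Proof.
rewrite (le_trans (enorm_le_sum _)) // mulr_suml; apply: ler_sum => i _.
rewrite mxE (le_trans (nc_sum _ _ _)) // mulr_suml; apply: ler_sum => j _.
by rewrite Normc.normcM ler_wpM2l ?nc_ge0 ?nc_enorm.
Qed.

Lemma opnorm_has_sup m n (X : 'M[R[i]]_(m, n)) :
  has_sup [set enorm (X *m v) | v in [set v | enorm v <= 1]].
Proof.
split; first by exists (enorm (X *m 0)); exists 0 => //=; rewrite enorm0.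
exists (\sum_i \sum_j nc (X i j)) => _ [v /= v1 <-].
rewrite (le_trans (enorm_mulmx_le _ _)) // ler_piMr //.
by apply: sumr_ge0 => i _; apply: sumr_ge0 => j _; exact: nc_ge0.
Qed.

Lemma opnorm_ge0 m n (X : 'M[R[i]]_(m, n)) : 0 <= opnorm X.
Proof.
have [_ ub] := opnorm_has_sup X; apply: (ub_le_sup ub).
by exists 0 => /=; rewrite ?mulmx0 enorm0.
Qed.

Lemma opnormP m n (X : 'M[R[i]]_(m, n)) v : enorm (X *m v) <= opnorm X * enorm v.
Proof.
have [->|v0] := eqVneq v 0; first by rewrite mulmx0 !enorm0 mulr0.
have nv : 0 < enorm v by rewrite enorm_gt0.
rewrite -ler_pdivrMr //.
have -> : enorm (X *m v) / enorm v = enorm (X *m ((enorm v)^-1%:C *: v)).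
  by rewrite -scalemxAr enormZ nc_real ger0_norm ?invr_ge0 ?enorm_ge0 // mulrC.
have [_ ub] := opnorm_has_sup X; apply: (ub_le_sup ub).
exists ((enorm v)^-1%:C *: v) => //=.
by rewrite enormZ nc_real ger0_norm ?invr_ge0 ?enorm_ge0 // mulVf // gt_eqF.
Qed.

Lemma opnorm_le m n (X : 'M[R[i]]_(m, n)) (b : R) : 0 <= b ->
  (forall v, enorm (X *m v) <= b * enorm v) -> opnorm X <= b.
Proof.
move=> b0 H; apply: ge_sup; first by case: (opnorm_has_sup X).
by move=> _ [v /= v1 <-]; rewrite (le_trans (H v)) // ler_piMr.
Qed.

Lemma opnormM m n p (X : 'M[R[i]]_(m, n)) (Y : 'M[R[i]]_(n, p)) :
  opnorm (X *m Y) <= opnorm X * opnorm Y.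
Proof.
apply: opnorm_le => [|v]; first by rewrite mulr_ge0 ?opnorm_ge0.
rewrite -mulmxA (le_trans (opnormP _ _)) // -mulrA ler_wpM2l ?opnorm_ge0 //.
exact: opnormP.
Qed.

Lemma opnormD m n (X Y : 'M[R[i]]_(m, n)) : opnorm (X + Y) <= opnorm X + opnorm Y.
Proof.
apply: opnorm_le => [|v]; first by rewrite addr_ge0 ?opnorm_ge0.
by rewrite mulmxDl (le_trans (enormD _ _)) // mulrDl lerD ?opnormP.
Qed.

Lemma opnormZ m n (a : R[i]) (X : 'M[R[i]]_(m, n)) : opnorm (a *: X) <= nc a * opnorm X.
Proof.
apply: opnorm_le => [|v]; first by rewrite mulr_ge0 ?opnorm_ge0 ?nc_ge0.
by rewrite -scalemxAl enormZ -mulrA ler_wpM2l ?nc_ge0 ?opnormP.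
Qed.

Lemma opnormM_le m n p (X : 'M[R[i]]_(m, n)) (Y : 'M[R[i]]_(n, p)) (a b : R) :
  opnorm X <= a -> opnorm Y <= b -> opnorm (X *m Y) <= a * b.
Proof. by move=> Xa Yb; exact: le_trans (opnormM X Y) (ler_pM (opnorm_ge0 X) (opnorm_ge0 Y) Xa Yb). Qed.

Lemma opnormD_le m n (X Y : 'M[R[i]]_(m, n)) (a b : R) :
  opnorm X <= a -> opnorm Y <= b -> opnorm (X + Y) <= a + b.
Proof. by move=> Xa Yb; exact: le_trans (opnormD X Y) (lerD Xa Yb). Qed.

Lemma opnormZ_le m n (s : R[i]) (X : 'M[R[i]]_(m, n)) (a b : R) :
  nc s <= a -> opnorm X <= b -> opnorm (s *: X) <= a * b.
Proof. by move=> sa Xb; exact: le_trans (opnormZ s X) (ler_pM (nc_ge0 s) (opnorm_ge0 X) sa Xb). Qed.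

Lemma opnormN m n (X : 'M[R[i]]_(m, n)) : opnorm (- X) = opnorm X.
Proof.
have H (Y : 'M[R[i]]_(m, n)) : opnorm (- Y) <= opnorm Y.
  by rewrite -scaleN1r (le_trans (opnormZ _ _)) // normcN Normc.normc1 mul1r.
apply/eqP; rewrite eq_le; apply/andP; split; first exact: H.
have HX := H (- X); rewrite (opprK X) in HX; exact: HX.
Qed.

Lemma opnorm0 m n : opnorm (0 : 'M[R[i]]_(m, n)) = 0.
Proof.
apply/eqP; rewrite eq_le opnorm_ge0 andbT opnorm_le // => v.
by rewrite mul0mx enorm0 mul0r.
Qed.

Lemma opnorm1 n : opnorm (1%:M : 'M[R[i]]_n) <= 1.
Proof. by apply: opnorm_le => // v; rewrite mul1mx mul1r. Qed.

Lemma opnorm_sum m n (I : Type) (r : seq I) (P : pred I) (F : I -> 'M[R[i]]_(m, n)) :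
  opnorm (\sum_(i <- r | P i) F i) <= \sum_(i <- r | P i) opnorm (F i).
Proof.
apply: (big_ind2 (fun a b => opnorm a <= b)) => //; first by rewrite opnorm0.
by move=> a b c d ab cd; rewrite (le_trans (opnormD _ _)) // lerD.
Qed.

Lemma opnormX n (X : 'M[R[i]]_n) k : opnorm (X ^+ k) <= opnorm X ^+ k.
Proof.
elim: k => [|k IH]; first exact: opnorm1.
by rewrite !exprS (le_trans (opnormM _ _)) // ler_wpM2l ?opnorm_ge0.
Qed.

Lemma nc_opnorm m n (X : 'M[R[i]]_(m, n)) i j : nc (X i j) <= opnorm X.
Proof.
have := opnormP X (delta_mx j 0); rewrite -colE => H.
have := le_trans (nc_enorm (col j X) i) H; rewrite mxE => /le_trans; apply.
rewrite ler_piMr ?opnorm_ge0 // (le_trans (enorm_le_sum _)) //.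
rewrite (bigD1 j) //= big1 => [|k kj]; last by rewrite mxE (negbTE kj) Normc.normc0.
by rewrite mxE !eqxx Normc.normc1 addr0.
Qed.

Lemma lower_bound_unit n (X : 'M[R[i]]_n) (c : R) : 0 < c ->
  (forall v, c * enorm v <= enorm (X *m v)) -> X \in unitmx.
Proof.
move=> c0 H; rewrite -unitmx_tr -row_free_unit -kermx_eq0.
apply/eqP/row_matrixP => i; rewrite row0.
have : X *m (row i (kermx X^T))^T = 0.
  by rewrite -[X in X *m _]trmxK -trmx_mul -row_mul mulmx_ker row0 trmx0.
move=> /(congr1 (@enorm R n)); rewrite enorm0 => e.
have := H (row i (kermx X^T))^T; rewrite e pmulr_rle0 // => le0.
have : enorm (row i (kermx X^T))^T == 0 by rewrite eq_le le0 enorm_ge0.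
by rewrite enorm_eq0 -[X in _ == X]trmx0 => /eqP /trmx_inj.
Qed.

Lemma lower_bound_invmx n (X : 'M[R[i]]_n) (c : R) : 0 < c ->
  (forall v, c * enorm v <= enorm (X *m v)) -> opnorm (invmx X) <= c^-1.
Proof.
move=> c0 H; apply: opnorm_le => [|v]; first by rewrite invr_ge0 ltW.
have Xu := lower_bound_unit c0 H.
by rewrite mulrC ler_pdivlMr // mulrC (le_trans (H _)) // mulKVmx.
Qed.

End OperatorNorm.

(** * The matrix exponential as a limit of powers *)
Section EulerLimit.
Variable R : realType.

Lemma nc_le_ReIm (z : R[i]) : nc z <= `|complex.Re z| + `|complex.Im z|.
Proof.
rewrite {1}[z]complexE (le_trans (le_normcD _ _)) // nc_real lerD2l.
rewrite Normc.normcM nc_real /= expr0n expr1n add0r sqrtr1 mul1r //.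
Qed.

(** Series of real numbers have convergence criteria that are used below, hence
the passage to real and imaginary parts of the entries. *)
Lemma cvg_mx_ReIm m n (f : nat -> 'M[R[i]^o]_(m, n)) (L : 'M[R[i]^o]_(m, n)) :
  (forall i j, (fun k => complex.Re (f k i j)) @ \oo --> complex.Re (L i j)) ->
  (forall i j, (fun k => complex.Im (f k i j)) @ \oo --> complex.Im (L i j)) ->
  f @ \oo --> L.
Proof.
move=> HRe HIm; apply/cvg_ballP => e e0.
have eE : e = (complex.Re e)%:C by rewrite RRe_real // gtr0_real.
have e0' : 0 < complex.Re e by move: e0; rewrite {1}eE ltcR.
have : \forall k \near \oo, forall ij : 'I_m * 'I_n, ball (L ij.1 ij.2) e (f k ij.1 ij.2).
  apply: filter_forall => -[i j] /=.
  have /cvgrPdist_lt /(_ _ (divr_gt0 e0' (ltr0n R 2))) H1 := HRe i j.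
  have /cvgrPdist_lt /(_ _ (divr_gt0 e0' (ltr0n R 2))) H2 := HIm i j.
  near=> k; rewrite -ball_normE /= eE norm_nc ltcR.
  rewrite (le_lt_trans (nc_le_ReIm _)) // (splitr (complex.Re e)).
  have -> : complex.Re (L i j - f k i j) = complex.Re (L i j) - complex.Re (f k i j).
    by case: (L i j) (f k i j) => [a b] [c d].
  have -> : complex.Im (L i j - f k i j) = complex.Im (L i j) - complex.Im (f k i j).
    by case: (L i j) (f k i j) => [a b] [c d].
  by rewrite ltrD //; near: k.
by apply: filterS => k H; split=> // i j; exact: (H (i, j)).
Unshelve. all: by end_near. Qed.

Lemma exprZ_mx n (a : R[i]) (X : 'M[R[i]]_n) k : (a *: X) ^+ k = a ^+ k *: X ^+ k.
Proof.
elim: k => [|k IH]; first by rewrite !expr0 scale1r.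
by rewrite !exprS IH -!mulmxE -scalemxAl -scalemxAr scalerA.
Qed.

Definition exp_term n (X : 'M[R[i]]_n) (k : nat) : 'M[R[i]^o]_n := k`!%:R^-1 *: X ^+ k.

Lemma nc_exp_term n (X : 'M[R[i]]_n) k i j :
  nc (exp_term X k i j) <= exp_coeff (opnorm X) k.
Proof.
rewrite mxE Normc.normcM Normc.normcV nc_natr exp_coeffE ler_wpM2l ?invr_ge0 //.
by rewrite (le_trans (nc_opnorm _ _ _)) // opnormX.
Qed.

Lemma cvg_expmx n (X : 'M[R[i]]_n) :
  (series (exp_term X) : nat -> 'M[R[i]^o]_n) @ \oo --> (expmx X : 'M[R[i]^o]_n).
Proof.
suff [L HL] : exists L : 'M[R[i]^o]_n, series (exp_term X) @ \oo --> L by exact: (cvgP _ HL).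
pose re i j k := complex.Re (exp_term X k i j).
pose im i j k := complex.Im (exp_term X k i j).
have exp_cvg := is_cvg_series_exp_coeff (opnorm X).
have cvg_coef (u : nat -> R) : (forall k, `|u k| <= exp_coeff (opnorm X) k) -> cvgn (series u).
  move=> H; apply: (@normed_cvg R R^o); apply: series_le_cvg exp_cvg => [k|k|k].
  - exact: normr_ge0.
  - by apply: exp_coeff_ge0; exact: opnorm_ge0.
  - exact: H.
have re_cvg i j : cvgn (series (re i j)).
  by apply: cvg_coef => k; rewrite (le_trans (nc_Re _)) // nc_exp_term.
have im_cvg i j : cvgn (series (im i j)).
  by apply: cvg_coef => k; rewrite (le_trans (nc_Im _)) // nc_exp_term.
exists (\matrix_(i, j) (limn (series (re i j)) +i* limn (series (im i j)))).
apply: cvg_mx_ReIm => i j; rewrite mxE /=.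
  rewrite (_ : (fun k => _) = series (re i j)) //.
  by apply/funext => k; rewrite /series /= summxE raddf_sum.
rewrite (_ : (fun k => _) = series (im i j)) //.
by apply/funext => k; rewrite /series /= summxE raddf_sum.
Qed.

Lemma expmx_partial_sum_near n (X : 'M[R[i]]_n) (e : R) : 0 < e ->
  \forall N \near \oo, opnorm (expmx X - (series (exp_term X) N : 'M[R[i]]_n)) <= e.
Proof.
move=> e0; pose d : R := e / (1 + (n * n)%N%:R).
have n0 : 0 < 1 + (n * n)%N%:R :> R by rewrite ltr_pwDl.
have d0 : 0 < d by rewrite divr_gt0.
have d0c : (0 : R[i]) < d%:C by rewrite ltcR.
have /cvg_ballP /(_ _ d0c) := @cvg_expmx n X.
apply: filterS => N [_ H]; apply: opnorm_le => [|v]; first exact: ltW.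
rewrite (le_trans (enorm_mulmx_le _ _)) // ler_wpM2r ?enorm_ge0 //.
apply: (@le_trans _ _ (\sum_(i < n) \sum_(j < n) d)).
  apply: ler_sum => i _; apply: ler_sum => j _; rewrite !mxE.
  by have := H i j; rewrite -ball_normE /= norm_nc ltcR => /ltW.
rewrite !sumr_const card_ord -mulrnA -mulr_natr /d mulrAC ler_pdivrMr //.
by rewrite ler_pM2l // lerDr.
Qed.

Lemma exp_partial_le (x : R) N : 0 <= x -> series (exp_coeff x) N <= expR x.
Proof.
move=> x0; apply: nondecreasing_cvgn_le; last exact: is_cvg_series_exp_coeff.
by apply: nondecreasing_series => k _ _; rewrite exp_coeff_ge0.
Qed.

(** With y = x/N, this comes from e^(y - y^2) <= 1 + y raised to the power N. *)
Lemma euler_lower (x : R) N : 0 <= x -> (0 < N)%N ->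
  expR x - (1 + x / N%:R) ^+ N <= expR x * (x ^+ 2 / N%:R).
Proof.
move=> x0 N0; have Np : 0 < N%:R :> R by rewrite ltr0n.
pose y := x / N%:R; have y0 : 0 <= y by rewrite divr_ge0 // ltW.
have H : expR (y - y ^+ 2) <= 1 + y.
  have e1 := expR_ge1Dx (y ^+ 2 - y).
  rewrite -[y - _]opprB expRN; apply: (@le_trans _ _ ((1 + (y ^+ 2 - y))^-1)).
    rewrite lef_pV2 // ?posrE ?expR_gt0 //; nra.
  rewrite -div1r ler_pdivrMr; nra.
have : expR (x - x ^+ 2 / N%:R) <= (1 + y) ^+ N.
  have -> : x - x ^+ 2 / N%:R = N%:R * (y - y ^+ 2).
    by rewrite /y; field; rewrite gt_eqF.
  by rewrite expRM_natl lerXn2r ?nnegrE ?expR_ge0 ?addr_ge0.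
rewrite expRD => le1.
have e2 := expR_ge1Dx (- (x ^+ 2 / N%:R)).
have e3 : expR x * (1 + - (x ^+ 2 / N%:R)) <= expR x * expR (- (x ^+ 2 / N%:R)).
  by rewrite ler_pM2l ?expR_gt0.
rewrite lerBlDl -lerBlDr (le_trans _ le1) // (le_trans _ e3) //.
by rewrite mulrDr mulr1 mulrN.
Qed.

(** The coefficient of X^k in the partial sum of the exponential is at least
the one in (1 + X/N)^N. The norm of the difference is therefore at most its
value at the real number |X|, where [euler_lower] applies. *)
Lemma euler_mx n (X : 'M[R[i]]_n) N : (0 < N)%N ->
  opnorm ((series (exp_term X) N.+1 : 'M[R[i]]_n) - (1%:M + N%:R^-1 *: X) ^+ N) <=
  expR (opnorm X) * (opnorm X ^+ 2 / N%:R).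
Proof.
move=> N0; have Np : 0 < N%:R :> R by rewrite ltr0n.
have x0 := opnorm_ge0 X; set x := opnorm X in x0 *.
apply: le_trans (euler_lower x0 N0).
pose c k : R := k`!%:R^-1 - 'C(N, k)%:R / N%:R ^+ k.
have c0 k : 0 <= c k.
  rewrite subr_ge0 ler_pdivrMr ?exprn_gt0 // mulrC.
  rewrite ler_pdivlMr ?ltr0n ?fact_gt0 // -natrM -natrX ler_nat bin_ffact.
  (* A falling factorial of N is at most the power of N of the same order. *)
  elim: (k : nat) => [|j IH]; first by rewrite ffactn0.
  by rewrite ffactnSr expnSr leq_mul // leq_subr.
have -> : (series (exp_term X) N.+1 : 'M[R[i]]_n) - (1%:M + N%:R^-1 *: X) ^+ N =
   \sum_(k < N.+1) (c k)%:C *: X ^+ k.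
  rewrite /series /= big_mkord addrC [1%:M + _]addrC exprD1n -sumrN -big_split /=.
  apply: eq_bigr => k _; rewrite exprZ_mx /c rmorphB scalerBl addrC; congr (_ - _).
    by rewrite fmorphV rmorph_nat.
  by rewrite rmorphM fmorphV rmorphXn /= !rmorph_nat -scaler_nat scalerA exprVn.
apply: (@le_trans _ _ (\sum_(k < N.+1) c k * x ^+ k)).
  rewrite (le_trans (opnorm_sum _ _ _)) //; apply: ler_sum => k _.
  rewrite (le_trans (opnormZ _ _)) // nc_real ger0_norm // ler_wpM2l //.
  exact: opnormX.
apply: (@le_trans _ _ (series (exp_coeff x) N.+1 - (1 + x / N%:R) ^+ N)).
  rewrite /series /= big_mkord addrC [1 + _]addrC exprD1n -sumrN -big_split /=.
  apply: ler_sum => k _; rewrite exp_coeffE /c mulrBl addrC lerD2l.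
  by rewrite lerN2 expr_div_n -[leLHS]mulr_natl -mulrA [X in _ <= _ * X]mulrC.
by rewrite lerD2r exp_partial_le.
Qed.

(** This lemma replaces every estimate on the exponential by one on powers. *)
Lemma opnorm_expmx_le n (X : 'M[R[i]]_n) (b : R) :
  (forall e, 0 < e -> exists N0, forall N, (N0 <= N)%N ->
    opnorm ((1%:M + N%:R^-1 *: X) ^+ N) <= b + e) ->
  opnorm (expmx X) <= b.
Proof.
move=> H; apply/ler_addgt0Pr => e e0.
have e3 : 0 < e / 3 by rewrite divr_gt0.
have [N0 HN0] := H _ e3.
have [N1 _ HN1] := expmx_partial_sum_near X e3.
pose K := expR (opnorm X) * opnorm X ^+ 2.
have K0 : 0 <= K by rewrite mulr_ge0 ?expR_ge0 ?sqr_ge0.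
pose N := maxn (maxn N0 N1) (Num.bound (K / (e / 3))).+1.
have N0N : (N0 <= N)%N by rewrite /N !leq_max leqnn.
have N1N : (N1 <= N.+1)%N by rewrite ltnW // ltnS /N !leq_max leqnn orbT.
have Npos : (0 < N)%N by rewrite /N leq_max orbT.
have KN : K / N%:R <= e / 3.
  rewrite ler_pdivrMr ?ltr0n // mulrC -ler_pdivrMr //.
  apply: le_trans (ltW (archi_boundP (divr_ge0 K0 (ltW e3)))) _.
  by rewrite ler_nat /N leq_max leqnSn orbT.
rewrite -[expmx X](subrK (series (exp_term X) N.+1 : 'M[R[i]]_n)).
rewrite (le_trans (opnormD _ _)) //.
have h1 := HN1 _ N1N; have h2 := HN0 _ N0N; have h3 := euler_mx X Npos.
set S := (series _ _) in h1 h3 *.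
have h4 : opnorm (S : 'M[R[i]]_n) <= expR (opnorm X) * (opnorm X ^+ 2 / N%:R) + (b + e / 3).
  rewrite -[S](subrK ((1%:M + N%:R^-1 *: X) ^+ N : 'M[R[i]]_n)).
  by rewrite (le_trans (opnormD _ _)) // lerD.
rewrite /= in h1.
move: h4; rewrite mulrA => h4.
apply: le_trans (lerD h1 h4) _.
rewrite -/K; move: (K / N%:R) KN => z zle.
have -> : b + e = e / 3 + (e / 3 + (b + e / 3)) by field.
by rewrite lerD2l lerD2r.
Qed.

End EulerLimit.

(** * A Kreiss bound for powers *)
Section PowerDecay.
Variable R : realType.

(** Peel off one eigenvalue a at a time: X^N V satisfies a first order
recurrence with ratio a and a forcing term that decays by induction. The gap
between r0 and r absorbs the polynomial factors due to equal eigenvalues. *)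
Lemma pow_mul_decay m p (X : 'M[R[i]]_m.+1) (s : seq R[i]) (r0 r : R)
    (V : 'M[R[i]]_(m.+1, p)) :
  0 <= r0 -> r0 < r -> (forall a, a \in s -> nc a <= r0) -> newton_prod X s *m V = 0 ->
  exists2 K : R, 0 <= K & forall N, opnorm (X ^+ N *m V) <= K * r ^+ N.
Proof.
move=> r00 r0r; have rp : 0 < r by apply: le_lt_trans r0r.
elim: s V => [|a s IH] V sr.
  rewrite /newton_prod big_nil mul1mx => ->; exists 0 => // N.
  by rewrite mulmx0 opnorm0 mul0r.
rewrite newton_prod_cons => /IH[b bs|K K0 HK]; first by apply: sr; rewrite inE bs orbT.
have ar : nc a <= r0 by apply: sr; exact: mem_head.
have d0 : 0 < r - r0 by rewrite subr_gt0.
exists (opnorm V + K / (r - r0)).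
  by rewrite addr_ge0 ?opnorm_ge0 // divr_ge0 // ltW.
elim=> [|N IHN]; first by rewrite expr0 mul1mx expr0 mulr1 lerDl divr_ge0 // ltW.
have -> : X ^+ N.+1 *m V = a *: (X ^+ N *m V) + X ^+ N *m ((X - a%:M) *m V).
  rewrite mulmxBl mulmxBr mul_scalar_mx -scalemxAr addrCA subrr addr0.
  by rewrite exprSr -mulmxE mulmxA.
rewrite (le_trans (opnormD _ _)) // (le_trans (lerD (opnormZ _ _) (HK N))) //.
set K' := opnorm V + _.
have h1 : nc a * opnorm (X ^+ N *m V) <= r0 * (K' * r ^+ N).
  by rewrite ler_pM ?nc_ge0 ?opnorm_ge0.
rewrite (le_trans (lerD h1 (lexx _))) // exprS mulrA -mulrDl mulrA ler_pM2r ?exprn_gt0 //.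
rewrite -lerBrDl -[r0 * _]mulrC -mulrBr /K' mulrDl divfK ?gt_eqF //.
by rewrite lerDr mulr_ge0 ?opnorm_ge0 // ltW.
Qed.

Lemma seq_lt1_bound (s : seq R[i]) : (forall a, a \in s -> nc a < 1) ->
  exists r : R, [/\ 0 <= r, r < 1 & forall a, a \in s -> nc a <= r].
Proof.
elim: s => [|a s IH] H; first by exists 0.
have [|r [r0 r1 Hr]] := IH; first by move=> b bs; apply: H; rewrite inE bs orbT.
exists (Num.max r (nc a)); split.
- by rewrite le_max r0.
- by rewrite gt_max r1 H // mem_head.
move=> b; rewrite inE le_max => /orP[/eqP ->|/Hr ->//]; by rewrite lexx orbT.
Qed.

Lemma geom_linear_bound (q : R) N : 0 <= q -> q < 1 -> N%:R * q ^+ N <= (1 - q)^-1.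
Proof.
move=> q0 q1; have d0 : 0 < 1 - q by rewrite subr_gt0.
rewrite -div1r ler_pdivlMr //.
have -> : N%:R * q ^+ N = \sum_(k < N) q ^+ N.
  by rewrite sumr_const card_ord mulr_natl.
apply: (@le_trans _ _ ((\sum_(k < N) q ^+ k) * (1 - q))).
  rewrite ler_pM2r //; apply: ler_sum => k _.
  by rewrite ler_wiXn2l ?(ltW q1) // ltnW.
by rewrite mulrC -opprB mulNr -subrX1 opprB lerBlDr lerDl exprn_ge0.
Qed.

(** With q^2 = r, one factor q^N of r^N pays for the factor N. *)
Lemma power_decay m (X : 'M[R[i]]_m.+1) (s : seq R[i]) : newton_prod X s = 0 ->
  (forall a, a \in s -> nc a < 1) ->
  exists q K : R, [/\ 0 <= q, q < 1, 0 <= K &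
   forall N, [/\ opnorm (X ^+ N) <= K * q ^+ N, N%:R * opnorm (X ^+ N) <= K * q ^+ N
     & forall a, a \in s -> nc (a ^+ N) <= q ^+ N]].
Proof.
move=> n0 /seq_lt1_bound [r0 [r00 r01 Hr]].
pose r := (1 + r0) / 2; have r0r : r0 < r by rewrite /r; lra.
have r1 : r < 1 by rewrite /r; lra.
have rp : 0 < r by rewrite /r; lra.
have [|K K0 HK] := @pow_mul_decay _ _ X s r0 r 1%:M r00 r0r Hr.
  by rewrite n0 mul0mx.
pose q := Num.sqrt r.
have q0 : 0 < q by rewrite sqrtr_gt0.
have qq : q ^+ 2 = r by rewrite sqr_sqrtr // ltW.
have q1 : q < 1 by rewrite -(@ltr_pXn2r _ 2) ?nnegrE ?ler01 ?(ltW q0) // qq expr1n.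
have rq : r <= q by rewrite -qq expr2 ler_piMr // ltW.
exists q, (K / (1 - q)); split => //; rewrite ?(ltW q0) ?divr_ge0 ?subr_ge0 ?(ltW q1) //.
move=> N; have HN := HK N; rewrite mulmx1 in HN.
have d1 : 1 <= (1 - q)^-1.
  rewrite invf_ge1 ?subr_gt0 // lerBlDr lerDl ltW //.
have rqN : r ^+ N <= q ^+ N by rewrite lerXn2r ?nnegrE // ltW.
split.
- apply: (le_trans HN); rewrite -mulrA ler_wpM2l //.
  by rewrite (le_trans rqN) // ler_peMl // exprn_ge0 // ltW.
- apply: (@le_trans _ _ (N%:R * (K * r ^+ N))); first by rewrite ler_wpM2l.
  rewrite mulrCA -mulrA ler_wpM2l // -qq -exprM mulnC exprM expr2.
  rewrite mulrA ler_wpM2r ?exprn_ge0 ?(ltW q0) //.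
  by rewrite geom_linear_bound // ltW.
move=> a /Hr ar; rewrite ncX (le_trans _ rqN) // lerXn2r ?nnegrE ?nc_ge0 ?(ltW rp) //.
by rewrite (le_trans ar) // ltW.
Qed.

End PowerDecay.

Section KreissPower.
Variable R : realType.

(** Let N tend to infinity in [discrete_coef_bound]: the terms with a factor
X^N vanish by [power_decay], and each of the m.+1 averaged Poisson kernels tends
to 1. The explicit function G bounds the left-hand side in terms of x = q^N and
is continuous at x = 0, where its value is the right-hand side. *)
Lemma power_bound m (X : 'M[R[i]]_m.+1) (u : 'rV[R[i]]_m.+1) (v : 'cV[R[i]]_m.+1)
    (S : R) k :
  0 <= S ->
  (forall y : R[i], nc y <= 1 -> 1%:M - y *: X \in unitmx) ->
  (forall (y : R[i]) (w : 'cV_m.+1), nc y = 1 ->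
     nc ((u *m w) 0 0) <= S * enorm ((1%:M - y *: X) *m w)) ->
  k%:R * nc ((u *m (X ^+ k *m v)) 0 0) <= m.+1%:R * (S * enorm v).
Proof.
case: k => [|l] S0 Xu XS; first by rewrite mul0r !mulr_ge0 ?enorm_ge0.
have [s [szs ns sE]] := eigenvalue_seq X.
have s1 a : a \in s -> nc a < 1.
  move=> /sE; apply: contraR; rewrite -leNgt => a1.
  have a0 : a != 0 by rewrite -nc_eq0 gt_eqF // (lt_le_trans _ a1).
  have := Xu a^-1; rewrite Normc.normcV invf_le1 ?(lt_le_trans _ a1) // => /(_ a1).
  have -> : 1%:M - a^-1 *: X = - a^-1 *: (X - a%:M).
    rewrite scalerBr scale_scalar_mx mulNr mulVf // scaleNr.
    by rewrite rmorphN /= opprK addrC.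
  by rewrite unitmxZ // unitfE oppr_eq0 invr_eq0.
have [q [K [q0 q1 K0 HN]]] := power_decay ns s1.
set B := m.+1%:R * _.
pose G (x : R) := K * x * (opnorm u * opnorm X * opnorm X ^+ l * enorm v) +
   B * ((1 + K * x) * (1 + K * x)) * ((1 + x) / (1 - x)).
suff main N : (l < N)%N ->
    l.+1%:R * nc ((u *m (X ^+ l.+1 *m v)) 0 0) <= G (q ^+ N).
  have qc : (fun N => q ^+ N) @ \oo --> (0 : R).
    by apply: cvg_expr; rewrite ger0_norm.
  have Gc : (fun N => G (q ^+ N)) @ \oo --> G 0.
    apply: cvgD.
      by apply: cvgM; [apply: cvgM; [exact: cvg_cst|]|exact: cvg_cst].
    have Kc : (fun N => 1 + K * q ^+ N) @ \oo --> 1 + K * 0.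
      by apply: cvgD; [exact: cvg_cst|apply: cvgM => //; exact: cvg_cst].
    apply: cvgM; first by apply: cvgM; [exact: cvg_cst|exact: cvgM].
    apply: cvgM; first by apply: cvgD => //; exact: cvg_cst.
    apply: cvgV; first by rewrite subr0 oner_neq0.
    by apply: cvgB => //; exact: cvg_cst.
  have G0 : G 0 = B by rewrite /G !mulr0 mul0r add0r !addr0 subr0 divr1 !mulr1.
  rewrite -G0 -(cvg_lim _ Gc) //; apply: limr_ge; first by apply/cvg_ex; exists (G 0).
  by exists l.+1 => // N /= lN; exact: main.
move=> lN.
have [HN1 HN2 HN3] := HN N.
set x := q ^+ N in HN1 HN2 HN3 *.
have x0 : 0 <= x by exact: exprn_ge0.
have x1 : x < 1 by rewrite exprn_ilt1 // -lt0n (leq_trans _ lN).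
pose Z : 'M[R[i]]_m.+1 := 1%:M - X ^+ N.
have Zn w : enorm (Z *m w) <= (1 + K * x) * enorm w.
  rewrite (le_trans (opnormP _ _)) // ler_wpM2r ?enorm_ge0 //.
  rewrite (le_trans (opnormD _ _)) // opnormN lerD // opnorm1 //.
have sp : (0 < size s)%N by rewrite szs.
have s1' : all (fun a : R[i] => `|a| < 1) s.
  by apply/allP => a /s1; rewrite norm_nc -ltcR.
have prem (y : R[i]) : `|y| = 1 -> exists2 w, (1%:M - y *: X) *m w = Z *m (Z *m v) &
    `|(u *m w) 0 0| <= (S * enorm (Z *m (Z *m v)))%:C.
  move=> y1; have y1' : nc y = 1 by move: y1; rewrite norm_nc => -[].
  have yu : 1%:M - y *: X \in unitmx by apply: Xu; rewrite y1'.
  exists (invmx (1%:M - y *: X) *m (Z *m (Z *m v))); first by rewrite mulKVmx.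
  by have := XS y (invmx (1%:M - y *: X) *m (Z *m (Z *m v))) y1'; rewrite mulKVmx // norm_nc lecR.
have := discrete_coef_bound sp s1' ns lN prem.
pose p a : R := (1 - nc (a ^+ N) ^+ 2) / nc (1 - a ^+ N) ^+ 2.
have -> : \sum_(a <- s) (1 - `|a ^+ N| ^+ 2) / `|1 - a ^+ N| ^+ 2 = (\sum_(a <- s) p a)%:C.
  rewrite rmorph_sum; apply: eq_bigr => a _.
  by rewrite /p !norm_nc [RHS]rmorphM fmorphV rmorphB !rmorphXn rmorph1.
rewrite norm_nc -rmorphM lecR => le1.
have ple a : a \in s -> p a <= (1 + x) / (1 - x).
  move=> /HN3; rewrite /p; set b := a ^+ N => bx.
  have b0 := nc_ge0 b.
  have nb : 1 - nc b <= nc (1 - b).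
    rewrite lerBlDr -[X in X <= _](@Normc.normc1 R) -[X in nc X](subrK b).
    by rewrite (le_trans (le_normcD _ _)).
  have p1 : 0 < 1 - nc b by lra.
  have p2 : 0 < nc (1 - b) by lra.
  rewrite ler_pdivrMr ?exprn_gt0 // mulrAC ler_pdivlMr ?subr_gt0 //.
  apply: (@le_trans _ _ ((1 + x) * (1 - nc b) ^+ 2)); last first.
    rewrite ler_wpM2l //; first by lra.
    by rewrite lerXn2r ?nnegrE // ltW.
  nra.
have sum_le : \sum_(a <- s) p a <= m.+1%:R * ((1 + x) / (1 - x)).
  apply: (@le_trans _ _ (\sum_(a <- s) (1 + x) / (1 - x))).
    by rewrite big_seq [leRHS]big_seq; apply: ler_sum.
  by rewrite big_const_seq iter_addr_0 count_predT szs mulr_natl.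
have Kx0 : 0 <= 1 + K * x by rewrite addr_ge0 // mulr_ge0.
have Zvv : enorm (Z *m (Z *m v)) <= (1 + K * x) * (1 + K * x) * enorm v.
  by rewrite (le_trans (Zn _)) // -mulrA ler_wpM2l.
have c0 : 0 <= (1 + x) / (1 - x) by apply: divr_ge0; [rewrite addr_ge0|rewrite subr_ge0 ltW].
have le2 : S * enorm (Z *m (Z *m v)) * \sum_(a <- s) p a <=
    B * ((1 + K * x) * (1 + K * x)) * ((1 + x) / (1 - x)).
  apply: (@le_trans _ _ (S * enorm (Z *m (Z *m v)) * (m.+1%:R * ((1 + x) / (1 - x))))).
    by rewrite ler_wpM2l // mulr_ge0 ?enorm_ge0.
  rewrite mulrA ler_wpM2r // /B mulrC -[leRHS]mulrA ler_wpM2l // -mulrA ler_wpM2l //.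
  by rewrite [leRHS]mulrC.
have le3 := le_trans le1 le2.
pose tl := (u *m (X ^+ (N + l).+1 *m v)) 0 0.
have totE : (u *m (X * (l.+1%:R *: X ^+ l + (N - l.+1)%:R *: X ^+ (N + l)) *m v)) 0 0
   = l.+1%:R * (u *m (X ^+ l.+1 *m v)) 0 0 + (N - l.+1)%:R * tl.
  rewrite mulrDr -!scalerAr -!exprS mulmxDl mulmxDr -!scalemxAl -!scalemxAr.
  by rewrite mxE [X in X + _ = _]mxE [X in _ + X = _]mxE.
rewrite totE in le3.
have tl_le : (N - l.+1)%:R * nc tl <= K * x * (opnorm u * opnorm X * opnorm X ^+ l * enorm v).
  apply: (@le_trans _ _ (N%:R * (opnorm u * (opnorm (X ^+ N) * (opnorm X * opnorm X ^+ l) * enorm v)))).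
    rewrite ler_pM ?nc_ge0 ?ler_nat ?leq_subr // (le_trans (nc_enorm _ _)) //.
    rewrite (le_trans (opnormP _ _)) // ler_wpM2l ?opnorm_ge0 //.
    rewrite (le_trans (opnormP _ _)) // ler_wpM2r ?enorm_ge0 //.
    rewrite -addnS exprD (le_trans (opnormM _ _)) // ler_wpM2l ?opnorm_ge0 //.
    by rewrite -exprS opnormX.
  have -> : N%:R * (opnorm u * (opnorm (X ^+ N) * (opnorm X * opnorm X ^+ l) * enorm v)) =
    (N%:R * opnorm (X ^+ N)) * (opnorm u * opnorm X * opnorm X ^+ l * enorm v).
    move: (opnorm u) (opnorm (X ^+ N)) (opnorm X) (enorm v) => a1 a2 a3 a4; ring.
  by rewrite ler_wpM2r // !mulr_ge0 ?enorm_ge0 ?opnorm_ge0 // exprn_ge0 ?opnorm_ge0.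
rewrite -[l.+1%:R](@nc_natr R) -Normc.normcM.
have -> : l.+1%:R * (u *m (X ^+ l.+1 *m v)) 0 0 =
  (l.+1%:R * (u *m (X ^+ l.+1 *m v)) 0 0 + (N - l.+1)%:R * tl) - (N - l.+1)%:R * tl.
  by rewrite addrK.
rewrite (le_trans (ncB_le _ _)) // /G addrC lerD //.
by rewrite Normc.normcM nc_natr.
Qed.
End KreissPower.

(** * A Kreiss bound for the exponential *)
Section KreissSemigroup.
Variable R : realType.

Lemma expR_slack (b e y : R) : 0 <= b -> 0 < e -> y <= e / (b + e) ->
  b * expR y <= b + e.
Proof.
move=> b0 e0 ye; have be : 0 < b + e by rewrite ltr_wpDl.
have [->|bn0] := eqVneq b 0; first by rewrite mul0r add0r ltW.
have bp : 0 < b by rewrite lt_neqAle eq_sym bn0.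
have h := expR_ge1Dx (- (e / (b + e))).
have p : 0 < 1 + - (e / (b + e)).
  have -> : 1 + - (e / (b + e)) = b / (b + e) by field; rewrite gt_eqF.
  by rewrite divr_gt0.
apply: (@le_trans _ _ (b * expR (e / (b + e)))).
  by rewrite ler_wpM2l // ler_expR.
rewrite -[e / _]opprK expRN ler_pdivrMr ?expR_gt0 // mulrC -ler_pdivrMr //.
apply: le_trans h; rewrite le_eqVlt; apply/orP; left; apply/eqP.
by field; rewrite gt_eqF.
Qed.

Section Fixed.
Variables (m : nat) (B : 'M[R[i]]_m.+1) (kappa : R).
Hypothesis HB : forall (z : R[i]) v, 0 < complex.Re z ->
  complex.Re z * enorm v <= kappa * enorm ((z%:M - B) *m v).

(** Compare both sides of the hypothesis for real z tending to infinity. *)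
Lemma kreiss_ge1 : 1 <= kappa.
Proof.
pose v : 'cV[R[i]]_m.+1 := delta_mx 0 0.
have v0 : 0 < enorm v.
  rewrite enorm_gt0; apply/eqP => /matrixP /(_ 0 0); rewrite !mxE !eqxx.
  by move/eqP; rewrite oner_eq0.
pose b := opnorm B; have b0 : 0 <= b := opnorm_ge0 B.
have Ex (x : R) : 0 < x -> enorm ((x%:C%:M - B) *m v) <= (x + b) * enorm v.
  move=> x0; rewrite mulmxBl (le_trans (enormB _ _)) // mulrDl lerD ?opnormP //.
  by rewrite mul_scalar_mx enormZ nc_real gtr0_norm.
have kp : 0 < kappa.
  have := @HB 1%:C v ltr01; rewrite /= mul1r; apply: contraTT; rewrite -!leNgt => k0.
  by rewrite -ltNge (le_lt_trans _ v0) // mulr_le0_ge0 // enorm_ge0.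
have H (x : R) : 0 < x -> x <= kappa * (x + b).
  move=> x0; rewrite -(ler_pM2r v0) (le_trans (@HB x%:C v x0)) // -mulrA.
  by rewrite ler_pM2l // Ex.
rewrite leNgt; apply/negP => k1.
have d0 : 0 < 1 - kappa by rewrite subr_gt0.
have kb : 0 <= kappa * b by rewrite mulr_ge0 // ltW.
have x0 : 0 < (kappa * b + 1) / (1 - kappa) by rewrite divr_gt0 // ltr_wpDl.
have := H _ x0; rewrite mulrDr -lerBlDl -[X in X - _ <= _]mul1r -mulrBl mulrC divfK ?gt_eqF //.
by rewrite gerDl ler10.
Qed.

Lemma resolvent_unit (z : R[i]) : 0 < complex.Re z -> z%:M - B \in unitmx.
Proof.
move=> z0; have k1 := kreiss_ge1; have kp : 0 < kappa by apply: lt_le_trans k1.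
apply: (@lower_bound_unit _ _ _ (complex.Re z / kappa)); first exact: divr_gt0.
by move=> v; rewrite mulrAC ler_pdivrMr // [leRHS]mulrC HB.
Qed.

(** With K = k + 1, [power_bound] is applied to X = rho T with rho = 1 - 1/K. For
|y| = 1, 1 - yX is z - B up to the factor W, with z = (K/t) (1 - rho y) of real
part at least 1/t. One of the K factors T is used for W, so that k powers of X
remain, and k T^K is bounded by m.+1 kappa K rho^-k. *)
Lemma implicit_euler_bound (t : R) (k : nat) : 0 < t -> (0 < k)%N ->
  let T := invmx (1%:M - (t / k.+1%:R)%:C *: B) in
  1%:M - (t / k.+1%:R)%:C *: B \in unitmx /\
  opnorm (T ^+ k.+1) <= m.+1%:R * kappa * (expR 1 * expR (k%:R^-1)).
Proof.
move=> t0 k0; have k1 := kreiss_ge1; have kp : 0 < kappa by apply: lt_le_trans k1.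
pose tau : R := k.+1%:R / t; pose rho : R := k%:R / k.+1%:R.
have Kp : 0 < k.+1%:R :> R by rewrite ltr0n.
have kkp : 0 < k%:R :> R by rewrite ltr0n.
have tau0 : 0 < tau by rewrite divr_gt0.
have rho0 : 0 < rho by rewrite divr_gt0.
have rho1 : tau * (1 - rho) = t^-1.
  by rewrite /tau /rho -[k.+1]addn1 natrD; field; rewrite !gt_eqF // -natr1 gt_eqF // addr_gt0.
have tauu : tau%:C%:M - B \in unitmx by apply: resolvent_unit.
pose W := invmx (tau%:C%:M - B).
have tauC : tau%:C != 0 :> R[i] by rewrite -nc_eq0 nc_real gt_eqF // normr_gt0 gt_eqF.
have E1 : 1%:M - (t / k.+1%:R)%:C *: B = (tau^-1)%:C *: (tau%:C%:M - B).
  have tauV : tau^-1%:C * tau%:C = 1 by rewrite -rmorphM mulVf ?gt_eqF.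
  by rewrite scalerBr scale_scalar_mx tauV /tau invf_div.
move=> T.
have Tu : 1%:M - (t / k.+1%:R)%:C *: B \in unitmx.
  by rewrite E1 unitmxZ // unitfE fmorphV invr_eq0.
split=> //.
have TE : T = tau%:C *: W.
  have uu : (tau^-1)%:C \is a @GRing.unit R[i] by rewrite unitfE fmorphV invr_eq0.
  by rewrite /T E1 invmxZ ?unitmxZ // fmorphV invrK.
pose X := rho%:C *: T.
have XE y : 1%:M - y *: X = ((tau%:C * (1 - y * rho%:C))%:M - B) *m W.
  rewrite /X TE !scalerA mulrBr mulr1 raddfB /= addrAC mulmxBl mulmxV //.
  rewrite mul_scalar_mx; congr (_ - _ *: W); ring.
have ReE (y : R[i]) : complex.Re (tau%:C * (1 - y * rho%:C)) = tau * (1 - rho * complex.Re y).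
  case: y => a b; simpc => /=. by rewrite /= mulrC; ring.
have Re_ge (y : R[i]) : nc y <= 1 -> t^-1 <= complex.Re (tau%:C * (1 - y * rho%:C)).
  move=> y1; rewrite ReE -rho1 ler_pM2l // lerD2l lerN2 -[leRHS]mulr1 ler_pM2l //.
  by rewrite (le_trans (ler_norm _)) // (le_trans (nc_Re _)).
apply: opnorm_le => [|v]; first by rewrite !mulr_ge0 ?expR_ge0 // ltW.
(* Pairing T^K v with itself turns the bound on scalars u X^k v into a bound on
   the norm. *)
pose u := T ^+ k.+1 *m v.
have [->|u0] := eqVneq (enorm u) 0; first by rewrite !mulr_ge0 ?expR_ge0 ?enorm_ge0 // ltW.
have up : 0 < enorm u by rewrite lt_neqAle eq_sym u0 enorm_ge0.
have S0 : 0 <= enorm u * (kappa * t) by rewrite !mulr_ge0 ?enorm_ge0 // ltW.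
have tV0 : 0 < t^-1 by rewrite invr_gt0.
have Xu (y : R[i]) : nc y <= 1 -> 1%:M - y *: X \in unitmx.
  move=> y1; rewrite XE unitmx_mul unitmx_inv tauu andbT resolvent_unit //.
  by rewrite (lt_le_trans tV0) // Re_ge.
have Xb (y : R[i]) (w : 'cV_m.+1) : nc y = 1 -> nc ((adjoint_row u *m W *m w) 0 0) <=
    enorm u * (kappa * t) * enorm ((1%:M - y *: X) *m w).
  move=> y1; rewrite -mulmxA; apply: (le_trans (nc_dot _ _)); rewrite -mulrA ler_wpM2l ?enorm_ge0 //.
  have Rz : t^-1 <= complex.Re (tau%:C * (1 - y * rho%:C)) by rewrite Re_ge // y1.
  have := HB (W *m w) (lt_le_trans tV0 Rz); rewrite XE -mulmxA => H.
  rewrite mulrAC [_ * t]mulrC -ler_pdivrMl // (le_trans _ H) //.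
  by rewrite ler_wpM2r ?enorm_ge0.
have := @power_bound _ _ X (adjoint_row u *m W) v _ k S0 Xu Xb.
have -> : adjoint_row u *m W *m (X ^+ k *m v) = (rho ^+ k / tau)%:C *: (adjoint_row u *m u).
  rewrite /X exprZ_mx /u exprS TE -!mulmxA -!scalemxAl -!scalemxAr scalerA mulmxA.
  by rewrite -rmorphXn -rmorphM mulrVK ?unitfE ?gt_eqF.
rewrite mxE Normc.normcM nc_real nc_dot_self gtr0_norm ?divr_gt0 ?exprn_gt0 // => H.
have e1 : rho^-1 <= expR k%:R^-1.
  rewrite /rho invf_div -natr1 mulrDl mul1r mulfV ?gt_eqF //; exact: expR_ge1Dx.
have e2 : rho^-1 ^+ k.+1 <= expR 1 * expR k%:R^-1.
  have -> : expR 1 * expR k%:R^-1 = (expR k%:R^-1) ^+ k.+1 :> R.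
    rewrite -expRM_natl -expRD; congr expR.
    by rewrite -natr1 mulrDl mul1r mulfV ?gt_eqF.
  by rewrite lerXn2r ?nnegrE ?invr_ge0 ?expR_ge0 // ltW.
have e3 : enorm u <= m.+1%:R * kappa * rho^-1 ^+ k.+1 * enorm v.
  have c0 : 0 < k%:R * (rho ^+ k / tau) * enorm u.
    by rewrite !mulr_gt0 ?invr_gt0 ?exprn_gt0.
  rewrite -(ler_pM2l c0); apply: le_trans (le_trans _ H) _.
    by rewrite expr2 !mulrA.
  rewrite le_eqVlt; apply/orP; left; apply/eqP.
  rewrite exprS exprVn /tau /rho; field.
  by rewrite !gt_eqF // ?exprn_gt0.
apply: le_trans e3 _; rewrite ler_wpM2r ?enorm_ge0 // ler_wpM2l //.
by rewrite mulr_ge0 // ltW.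
Qed.

(** One explicit step 1 + Y is the implicit step T times 1 - Y^2, and the factors
1 - Y^2 contribute only e^(O(1/K)) over K steps. *)
Lemma explicit_euler_bound (t : R) (k : nat) : 0 < t -> (0 < k)%N ->
  opnorm ((1%:M + k.+1%:R^-1 *: (t%:C *: B)) ^+ k.+1) <=
  m.+1%:R * kappa * (expR 1 * expR (k%:R^-1)) * expR ((t * opnorm B) ^+ 2 / k.+1%:R).
Proof.
move=> t0 k0; have [Tu TB] := implicit_euler_bound t0 k0.
have Kp : 0 < k.+1%:R :> R by rewrite ltr0n.
set T := invmx _ in TB; set Y := (t / k.+1%:R)%:C *: B in Tu T TB.
have YE : k.+1%:R^-1 *: (t%:C *: B) = Y.
  by rewrite scalerA /Y mulrC rmorphM fmorphV rmorph_nat.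
rewrite YE.
have E : 1%:M + Y = (1%:M - Y * Y) * T.
  have -> : 1%:M - Y * Y = (1%:M + Y) * (1%:M - Y).
    by rewrite mulrBr mulr1 mulrDl mul1r opprD addrA addrK.
  by rewrite -mulrA [_ * T]mulmxV // mulr1.
have YT : GRing.comm (1%:M - Y * Y) T.
  rewrite /GRing.comm; have YT : Y * T = T * Y.
    have e : (1%:M - Y) * Y = Y * (1%:M - Y) by rewrite mulrBl mulrBr mulr1 mul1r.
    have l : T * (1%:M - Y) = 1 by exact: mulVmx.
    have r : (1%:M - Y) * T = 1 by exact: mulmxV.
    have e1 : T * ((1%:M - Y) * Y) * T = Y * T by rewrite [T * _]mulrA l mul1r.
    by rewrite -e1 e -[LHS]mulrA -[_ * _ * T]mulrA r mulr1.
  by rewrite mulrBl mulrBr mul1r mulr1 -mulrA YT mulrA YT mulrA.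
rewrite E (exprMn_comm _ YT).
apply: (le_trans (opnormM ((1%:M - Y * Y) ^+ k.+1) (T ^+ k.+1))); rewrite mulrC.
rewrite ler_pM ?opnorm_ge0 // (le_trans (opnormX _ _)) //.
set x := t * opnorm B.
have x0 : 0 <= x by rewrite mulr_ge0 ?opnorm_ge0 // ltW.
have Yx : opnorm Y <= x / k.+1%:R.
  by rewrite (le_trans (opnormZ _ _)) // nc_real gtr0_norm ?divr_gt0 // mulrAC.
have h1 : opnorm (1%:M - Y * Y) <= 1 + (x / k.+1%:R) ^+ 2.
  apply: (le_trans (opnormD 1%:M (- (Y * Y)))); rewrite opnormN.
  apply: lerD (opnorm1 _ _) _; apply: (le_trans (opnormM Y Y)).
  exact: (ler_pM (opnorm_ge0 _) (opnorm_ge0 _) Yx Yx).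
have h2 : opnorm (1%:M - Y * Y) <= expR ((x / k.+1%:R) ^+ 2).
  by apply: (le_trans h1); exact: expR_ge1Dx.
apply: (@le_trans _ _ (expR ((x / k.+1%:R) ^+ 2) ^+ k.+1)).
  by rewrite lerXn2r ?nnegrE ?opnorm_ge0 ?expR_ge0.
rewrite -expRM_natl ler_expR le_eqVlt; apply/orP; left; apply/eqP.
by field; rewrite gt_eqF.
Qed.

Lemma kreiss_semigroup (t : R) : 0 <= t ->
  opnorm (expmx (t%:C *: B)) <= expR 1 * m.+1%:R * kappa.
Proof.
move=> t0; have k1 := kreiss_ge1; have kp : 0 < kappa by apply: lt_le_trans k1.
have e1 : 1 <= expR 1 :> R by rewrite (le_trans _ (expR_ge1Dx 1)) // lerDl.
have b1 : 1 <= expR 1 * m.+1%:R * kappa.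
  by rewrite !mulr_ege1 // ler1n.
apply: opnorm_expmx_le => e e0.
have [tz|tn0] := eqVneq t 0.
  exists 0%N => N _; rewrite tz scale0r scaler0 addr0 expr1n.
  by rewrite (le_trans (opnorm1 _ _)) // (le_trans b1) // lerDl ltW.
have tp : 0 < t by rewrite lt_neqAle eq_sym tn0.
set b := _ * _ * _ in b1 *.
have b0 : 0 <= b by apply: le_trans b1.
pose x := 1 + (t * opnorm B) ^+ 2.
have x0 : 0 <= x by rewrite addr_ge0 // sqr_ge0.
have dp : 0 < e / (b + e) by rewrite divr_gt0 // ltr_wpDl.
exists (Num.bound (x / (e / (b + e)))).+2 => -[|k] // kN.
have k0 : (0 < k)%N by rewrite -ltnS (leq_trans _ kN).
have kkp : 0 < k%:R :> R by rewrite ltr0n.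
apply: le_trans (explicit_euler_bound tp k0) _.
have -> : m.+1%:R * kappa * (expR 1 * expR k%:R^-1) * expR ((t * opnorm B) ^+ 2 / k.+1%:R)
  = b * expR (k%:R^-1 + (t * opnorm B) ^+ 2 / k.+1%:R).
  by rewrite expRD /b; ring.
apply: expR_slack => //.
apply: (@le_trans _ _ (x / k%:R)).
  rewrite /x mulrDl mul1r lerD2l ler_wpM2l ?sqr_ge0 // lef_pV2 ?posrE ?ltr0n //.
  by rewrite ler_nat.
rewrite ler_pdivrMr // mulrC -ler_pdivrMr //.
apply: le_trans (ltW (archi_boundP (divr_ge0 x0 (ltW dp)))) _.
by rewrite ler_nat ltnW.
Qed.

End Fixed.
End KreissSemigroup.

(** * Angles *)
Section Atan.
Variable R : realType.

Lemma atan_step (a b : R) : a <= b ->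
  atan b - atan a <= (b - a) / (1 + a ^+ 2) + (b - a) ^+ 2.
Proof.
rewrite le_eqVlt => /orP[/eqP ->|ab].
  by rewrite !subrr mul0r add0r sqr_ge0.
have [c cab ->] : exists2 c, c \in `]a, b[ & atan b - atan a = (1 + c ^+ 2)^-1 * (b - a).
  apply: (@MVT R atan (fun x => (1 + x ^+ 2)^-1) _ _ ab).
  by apply: continuous_subspaceT => x; exact: continuous_atan.
have ac : a < c by have := cab; rewrite in_itv /= => /andP[].
have cb : c < b by have := cab; rewrite in_itv /= => /andP[].
have d0 : 0 < b - a by rewrite subr_gt0.
rewrite mulrC expr2 -mulrDr ler_pM2l //.
have pa : 0 < 1 + a ^+ 2 by rewrite ltr_pwDl // sqr_ge0.
have pc : 0 < 1 + c ^+ 2 by rewrite ltr_pwDl // sqr_ge0.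
rewrite -lerBlDl; apply: (@le_trans _ _ (c - a)); last by rewrite lerD2r ltW.
have -> : (1 + c ^+ 2)^-1 - (1 + a ^+ 2)^-1 =
  (c - a) * (- (a + c) / ((1 + c ^+ 2) * (1 + a ^+ 2))).
  by field; rewrite !gt_eqF.
rewrite -[leRHS]mulr1 ler_wpM2l ?subr_ge0 ?(ltW ac) //.
rewrite ler_pdivrMr ?mulr_gt0 // mul1r.
have : 0 <= (1 + a) ^+ 2 by exact: sqr_ge0.
have : 0 <= (1 + c) ^+ 2 by exact: sqr_ge0.
have : 0 <= (a * c) ^+ 2 by exact: sqr_ge0.
have : 0 <= a ^+ 2 by exact: sqr_ge0.
have : 0 <= c ^+ 2 by exact: sqr_ge0.
rewrite exprMn; move: (a ^+ 2) (c ^+ 2) (sqrrD 1 a) (sqrrD 1 c) => A C -> -> *.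
nra.
Qed.

(** The vector (r, y) is (r', y') turned by the angle delta. Sine and cosine of
the difference of the two arctangents are, up to a common positive factor A,
those of delta; both angles lie in an interval where this determines them. *)
Lemma atan_rotate (delta r y r' y' : R) : 0 < delta < pi -> 0 < r -> 0 < r' ->
  r = cos delta * r' - sin delta * y' -> y = sin delta * r' + cos delta * y' ->
  atan (y / r) - atan (y' / r') = delta.
Proof.
move=> /andP[d0 dpi] r0 r'0 rE yE.
set th := atan (y / r); set th' := atan (y' / r').
have c1 (z : R) : 0 < cos (atan z).
  by apply: cos_gt0_pihalf; rewrite atan_gtNpi2 atan_ltpi2.
have s1 (z : R) : sin (atan z) = z * cos (atan z).
  by rewrite -{2}[z]atanK /tan divfK // gt_eqF.
pose A := cos th * cos th' * (r' ^+ 2 + y' ^+ 2) / (r * r').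
have A0 : 0 < A.
  by rewrite divr_gt0 ?mulr_gt0 ?c1 // ltr_pwDl ?exprn_gt0 // sqr_ge0.
have sE : sin (th - th') = A * sin delta.
  rewrite sinB /th /th' !s1 -/th -/th' /A.
  transitivity (cos th * cos th' / (r * r') * (y * r' - r * y')).
    by field; rewrite !gt_eqF.
  by rewrite {2}rE yE; field; rewrite !gt_eqF.
have cE : cos (th - th') = A * cos delta.
  rewrite cosB /th /th' !s1 -/th -/th' /A.
  transitivity (cos th * cos th' / (r * r') * (r * r' + y * y')).
    by field; rewrite !gt_eqF.
  by rewrite {2}rE yE; field; rewrite !gt_eqF.
clearbody A; have A1 : A = 1.
  have := cos2Dsin2 (th - th'); rewrite sE cE !exprMn -mulrDr cos2Dsin2 mulr1 => /eqP.
  by rewrite -[X in _ == X](expr1n R 2) eqrXn2 ?(ltW A0) // => /eqP.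
rewrite A1 mul1r in sE; rewrite A1 mul1r in cE.
have lo : - pi < th - th'.
  have := atan_gtNpi2 (y / r); have := atan_ltpi2 (y' / r'); rewrite -/th -/th'.
  move: (@pi R) => p h1 h2; lra.
have hi : th - th' < pi.
  have := atan_gtNpi2 (y' / r'); have := atan_ltpi2 (y / r); rewrite -/th -/th'.
  move: (@pi R) => p h1 h2; lra.
have sd : 0 < sin delta by rewrite sin_gt0_pi // d0.
have pos : 0 < th - th'.
  rewrite ltNge; apply/negP => le0.
  have : 0 <= sin (- (th - th')).
    by apply: sin_ge0_pi; rewrite oppr_ge0 le0 /= lerNl ltW.
  by rewrite sinN sE oppr_ge0 leNgt sd.
have m1 : th - th' \in `[0, pi]%R by rewrite in_itv /= (ltW pos) (ltW hi).
have m2 : delta \in `[0, pi]%R by rewrite in_itv /= (ltW d0) (ltW dpi).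
exact: (cos_inj m1 m2 cE).
Qed.
End Atan.

(** * Riemann sums along closed polygons *)
Section Chain.
Variables (R : realType) (M : nat) (q : nat -> R[i]).
Hypothesis qM : q M = q 0%N.

(** The vertices q 0, ..., q M = q 0 of a closed polygon; each side is cut into N
equal pieces, of which [mesh_pt] are the ends and [mesh_step] the increments. *)
Definition mesh_pt N j k : R[i] := q j + (k%:R / N%:R) * (q j.+1 - q j).
Definition mesh_step N j : R[i] := (q j.+1 - q j) / N%:R.
Definition perimeter : R := \sum_(j < M) nc (q j.+1 - q j).

Lemma mesh_pt_step N j k : mesh_pt N j k.+1 = mesh_pt N j k + mesh_step N j.
Proof. rewrite /mesh_pt /mesh_step -[k.+1]addn1 natrD; ring. Qed.

Variable N : nat.
Hypothesis N0 : (0 < N)%N.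
Let Nn0 : (N%:R : R[i]) != 0. Proof. by rewrite pnatr_eq0 -lt0n. Qed.

Lemma telescope_chain (V : zmodType) (F : R[i] -> V) :
  \sum_(j < M) \sum_(k < N) (F (mesh_pt N j k.+1) - F (mesh_pt N j k)) = 0.
Proof.
have pt0 j : mesh_pt N j 0 = q j by rewrite /mesh_pt mul0r mul0r addr0.
have ptN j : mesh_pt N j N = q j.+1 by rewrite /mesh_pt divff // mul1r addrC subrK.
have inner j : \sum_(k < N) (F (mesh_pt N j k.+1) - F (mesh_pt N j k)) = F (q j.+1) - F (q j).
  by rewrite -(big_mkord xpredT (fun k => F (mesh_pt N j k.+1) - F (mesh_pt N j k)))
    telescope_sumr // pt0 ptN.
under eq_bigr do rewrite inner.
by rewrite -(big_mkord xpredT (fun j => F (q j.+1) - F (q j))) telescope_sumr // qM subrr.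
Qed.

Lemma nc_mesh_step j : nc (mesh_step N j) = nc (q j.+1 - q j) / N%:R.
Proof. by rewrite /mesh_step Normc.normcM Normc.normcV nc_natr. Qed.

Lemma sum_nc_mesh_step : \sum_(j < M) \sum_(k < N) nc (mesh_step N j) = perimeter.
Proof.
apply: eq_bigr => j _; rewrite sumr_const card_ord nc_mesh_step -[LHS]mulr_natr divfK //.
by rewrite pnatr_eq0 -lt0n.
Qed.

Lemma nc_mesh_step_le j : (j < M)%N -> nc (mesh_step N j) <= perimeter / N%:R.
Proof.
move=> jM; rewrite nc_mesh_step ler_pM2r ?invr_gt0 ?ltr0n // /perimeter (bigD1 (Ordinal jM)) //=.
by rewrite lerDl sumr_ge0 // => i _; exact: nc_ge0.
Qed.

(** The Riemann sum of the contour integral of g over the polygon. *)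
Definition chain_sum m (g : nat -> nat -> 'M[R[i]]_m) : 'M[R[i]]_m :=
  \sum_(j < M) \sum_(k < N) mesh_step N j *: g j k.

Lemma chain_sumB m (g h : nat -> nat -> 'M[R[i]]_m) :
  chain_sum g - chain_sum h = chain_sum (fun j k => g j k - h j k).
Proof.
rewrite /chain_sum -sumrB; apply: eq_bigr => j _; rewrite -sumrB.
by apply: eq_bigr => k _; rewrite scalerBr.
Qed.

Lemma chain_sumZ m s (g : nat -> nat -> 'M[R[i]]_m) :
  s *: chain_sum g = chain_sum (fun j k => s *: g j k).
Proof.
rewrite /chain_sum scaler_sumr; apply: eq_bigr => j _; rewrite scaler_sumr.
by apply: eq_bigr => k _; rewrite !scalerA mulrC.
Qed.

Lemma eq_chain_sum m (g h : nat -> nat -> 'M[R[i]]_m) :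
  (forall j k, (j < M)%N -> (k < N)%N -> g j k = h j k) -> chain_sum g = chain_sum h.
Proof. by move=> gh; apply: eq_bigr => j _; apply: eq_bigr => k _; rewrite gh. Qed.

Lemma chain_sum_le m (g : nat -> nat -> 'M[R[i]]_m) S :
  (forall j k, (j < M)%N -> (k < N)%N -> opnorm (g j k) <= S) ->
  opnorm (chain_sum g) <= S * perimeter.
Proof.
move=> H; rewrite /chain_sum (le_trans (opnorm_sum _ _ _)) // -sum_nc_mesh_step mulr_sumr.
apply: ler_sum => j _; rewrite (le_trans (opnorm_sum _ _ _)) // mulr_sumr.
apply: ler_sum => k _; rewrite (le_trans (opnormZ _ _)) // mulrC.
by rewrite ler_wpM2r ?nc_ge0 // H.
Qed.

End Chain.

Section PowerIntegral.
Variable R : realType.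

(** The second-order remainder of Taylor's formula for x |-> x^(l+1), which
compares a Riemann sum of x^l with a telescoping sum. *)
Lemma power_remainder l (rho : R) (x y : R[i]) : nc x <= rho -> nc y <= rho ->
  nc (y ^+ l.+1 - x ^+ l.+1 - l.+1%:R * x ^+ l * (y - x)) <=
  (l * l.+1)%:R * rho ^+ l.-1 * nc (y - x) ^+ 2.
Proof.
move=> xr yr; have r0 : 0 <= rho by apply: le_trans (nc_ge0 x) xr.
elim: l => [|l IH]; first by rewrite !mul0r expr0 mulr1 mul1r subrr Normc.normc0.
have -> : y ^+ l.+2 - x ^+ l.+2 - l.+2%:R * x ^+ l.+1 * (y - x) =
  y * (y ^+ l.+1 - x ^+ l.+1 - l.+1%:R * x ^+ l * (y - x))
   + l.+1%:R * x ^+ l * (y - x) ^+ 2.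
  rewrite -[l.+2%:R]natr1 !exprS; ring.
rewrite (le_trans (le_normcD _ _)) // !Normc.normcM ncX nc_natr -expr2.
have h1 : nc y * nc (y ^+ l.+1 - x ^+ l.+1 - l.+1%:R * x ^+ l * (y - x)) <=
   (l * l.+1)%:R * rho ^+ l * nc (y - x) ^+ 2.
  apply: le_trans (ler_pM (nc_ge0 _) (nc_ge0 _) yr IH) _.
  case: (l) => [|k]; first by rewrite !mul0r mulr0.
  by rewrite /= !mulrA [rho * _]mulrC -[_ * rho * _]mulrA -exprS.
have h2 : l.+1%:R * nc x ^+ l * nc (y - x) ^+ 2 <= l.+1%:R * rho ^+ l * nc (y - x) ^+ 2.
  by rewrite ler_wpM2r ?sqr_ge0 // ler_wpM2l // lerXn2r ?nnegrE ?nc_ge0.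
apply: le_trans (lerD h1 h2) _; rewrite -!mulrDl /= ler_wpM2r ?sqr_ge0 //.
by rewrite ler_wpM2r ?exprn_ge0 // -natrD ler_nat; nia.
Qed.

End PowerIntegral.

Section ChainIntegral.
Variables (R : realType) (M : nat) (q : nat -> R[i]).
Hypothesis qM : q M = q 0%N.
Let L := perimeter M q.

Definition chain_radius : R := \sum_(j < M) (nc (q j) + nc (q j.+1 - q j)).

Lemma mesh_pt_le N j k : (j < M)%N -> (k <= N)%N -> nc (mesh_pt q N j k) <= chain_radius.
Proof.
move=> jM kN; apply: (@le_trans _ _ (nc (q j) + nc (q j.+1 - q j))).
  rewrite (le_trans (le_normcD _ _)) // lerD2l Normc.normcM ler_piMl ?nc_ge0 //.
  rewrite Normc.normcM Normc.normcV !nc_natr.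
  have [->|N0] := eqVneq N 0%N; first by rewrite invr0 mulr0.
  by rewrite ler_pdivrMr ?ltr0n ?lt0n // mul1r ler_nat.
rewrite /chain_radius (bigD1 (Ordinal jM)) //= lerDl sumr_ge0 // => i _.
by rewrite addr_ge0 ?nc_ge0.
Qed.

(** The Riemann sum of a polynomial over a closed polygon differs from a
telescoping sum, which is zero, by second-order terms: O(N) pieces, each with an
error O(1/N^2). *)
Lemma power_chain_small (a b : R[i]) l : exists K : R, forall N, (0 < N)%N ->
  nc (b * \sum_(j < M) \sum_(k < N) mesh_step q N j * (a + b * mesh_pt q N j k) ^+ l) <= K / N%:R.
Proof.
pose rho := nc a + nc b * chain_radius.
pose K1 : R := (l * l.+1)%:R * rho ^+ l.-1 * (nc b ^+ 2).
have K10 : 0 <= K1.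
  apply: mulr_ge0 (sqr_ge0 _); apply: mulr_ge0 => //; apply: exprn_ge0.
  rewrite addr_ge0 ?nc_ge0 // mulr_ge0 ?nc_ge0 //.
  by apply: sumr_ge0 => i _; rewrite addr_ge0 ?nc_ge0.
exists (K1 * L ^+ 2) => N N0.
pose x j k := a + b * mesh_pt q N j k.
have xr j k : (j < M)%N -> (k <= N)%N -> nc (x j k) <= rho.
  move=> jM kN; rewrite (le_trans (le_normcD _ _)) // lerD2l Normc.normcM.
  by rewrite ler_wpM2l ?nc_ge0 // mesh_pt_le.
have xS j k : x j k.+1 - x j k = b * mesh_step q N j.
  by rewrite /x mesh_pt_step; ring.
set Sg := b * _.
have e (z : R[i]) : nc z = nc (l.+1%:R * z) / l.+1%:R.
  by rewrite Normc.normcM nc_natr mulrC mulKf // pnatr_eq0.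
rewrite (e Sg).
have -> : l.+1%:R * Sg = - \sum_(j < M) \sum_(k < N)
   (x j k.+1 ^+ l.+1 - x j k ^+ l.+1 - l.+1%:R * x j k ^+ l * (x j k.+1 - x j k)).
  have tel : \sum_(j < M) \sum_(k < N) (x j k.+1 ^+ l.+1 - x j k ^+ l.+1) = 0 :=
    telescope_chain qM N0 (fun w => (a + b * w) ^+ l.+1).
  transitivity (\sum_(j < M) \sum_(k < N) (l.+1%:R * x j k ^+ l * (x j k.+1 - x j k))).
    rewrite /Sg !mulr_sumr; apply: eq_bigr => j _; rewrite !mulr_sumr.
    by apply: eq_bigr => k _; rewrite xS; ring.
  rewrite -[LHS]opprK; congr (- _); rewrite -[LHS]add0r -[X in X + _]tel -sumrB.
  by apply: eq_bigr => j _; rewrite -sumrB.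
rewrite normcN ler_pdivrMr ?ltr0n // (le_trans (nc_sum _ _ _)) //.
apply: (@le_trans _ _ (\sum_(j < M) \sum_(k < N) K1 * (L / N%:R) * nc (mesh_step q N j))).
  apply: ler_sum => j _; rewrite (le_trans (nc_sum _ _ _)) //; apply: ler_sum => k _.
  rewrite (le_trans (power_remainder l (xr _ _ _ (ltnW (ltn_ord k))) (xr _ _ _ (ltn_ord k)))) //.
  rewrite xS Normc.normcM.
  have -> : (l * l.+1)%:R * rho ^+ l.-1 * (nc b * nc (mesh_step q N j)) ^+ 2 =
    K1 * (nc (mesh_step q N j) * nc (mesh_step q N j)) by rewrite /K1; ring.
  by rewrite -[leRHS]mulrA ler_wpM2l // ler_wpM2r ?nc_ge0 // nc_mesh_step_le.
under eq_bigr do rewrite -mulr_sumr.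
rewrite -mulr_sumr sum_nc_mesh_step // -/L.
have -> : K1 * (L / N%:R) * L = K1 * L ^+ 2 / N%:R by ring.
by rewrite ler_peMr // ?ler1n // divr_ge0 // mulr_ge0 ?sqr_ge0.
Qed.

End ChainIntegral.

(** * A discrete Cauchy formula for matrices *)
Section ResolventChain.
Variables (R : realType) (M : nat) (q : nat -> R[i]).
Hypothesis qM : q M = q 0%N.
Let L := perimeter M q.
Variables (m : nat) (B : 'M[R[i]]_m) (tau : R).
Hypothesis tau0 : 0 < tau.
Hypothesis Htau : forall (c : R) N j k (v : 'cV_m), 0 <= c <= 1 -> (0 < N)%N ->
  (j < M)%N -> (k <= N)%N ->
  tau * enorm v <= enorm (((mesh_pt q N j k)%:M - c%:C *: B) *m v).

(** The parameter c deforms the resolvent of B (c = 1) to that of the zero matrix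
(c = 0), whose contour integral is the winding number times the identity. *)
Definition scaled_resolvent (c : R) (w : R[i]) : 'M[R[i]]_m := invmx (w%:M - c%:C *: B).

Lemma scaled_resolventE c w : scaled_resolvent c w = invmx (w%:M - c%:C *: B). Proof. by []. Qed.

Section FixedMesh.
Variable N : nat.
Hypothesis N0 : (0 < N)%N.

Lemma scaled_resolvent_unit c j k : 0 <= c <= 1 -> (j < M)%N -> (k <= N)%N ->
  (mesh_pt q N j k)%:M - c%:C *: B \in unitmx.
Proof. by move=> *; apply: (lower_bound_unit tau0) => v; exact: Htau. Qed.

Lemma scaled_resolvent_le c j k : 0 <= c <= 1 -> (j < M)%N -> (k <= N)%N ->
  opnorm (scaled_resolvent c (mesh_pt q N j k)) <= tau^-1.
Proof. by move=> *; rewrite scaled_resolventE; apply: lower_bound_invmx => // v; exact: Htau. Qed.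

Lemma resolvent_identity (X Y : 'M[R[i]]_m) : X \in unitmx -> Y \in unitmx ->
  invmx X - invmx Y = invmx X *m (Y - X) *m invmx Y.
Proof.
move=> Xu Yu; rewrite mulmxBr mulmxBl mulVmx // mul1mx -mulmxA mulmxV //.
by rewrite mulmx1.
Qed.

Lemma scaled_resolvent_step_z c j k : 0 <= c <= 1 -> (j < M)%N -> (k < N)%N ->
  scaled_resolvent c (mesh_pt q N j k) - scaled_resolvent c (mesh_pt q N j k.+1) =
  mesh_step q N j *: (scaled_resolvent c (mesh_pt q N j k) *m scaled_resolvent c (mesh_pt q N j k.+1)).
Proof.
move=> c01 jM kN; have kN' := ltnW kN.
rewrite !scaled_resolventE resolvent_identity ?scaled_resolvent_unit //.
have -> : (mesh_pt q N j k.+1)%:M - c%:C *: B - ((mesh_pt q N j k)%:M - c%:C *: B) = (mesh_step q N j)%:M.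
  rewrite mesh_pt_step opprB addrA subrK raddfD /= addrAC subrr add0r //.
by rewrite mul_mx_scalar -scalemxAl.
Qed.

Lemma resolvent_shift (X Y : 'M[R[i]]_m) s : X \in unitmx -> Y \in unitmx ->
  Y *m B = B *m Y -> X - Y = s *: B ->
  invmx Y - invmx X = s *: (invmx X *m (invmx Y *m B)).
Proof.
move=> Xu Yu YB XY.
have iYB : invmx Y *m B = B *m invmx Y.
  by rewrite -[LHS]mulmx1 -(mulmxV Yu) mulmxA -(mulmxA (invmx Y)) -YB mulmxA mulVmx // mul1mx.
rewrite iYB mulmxA -[LHS]opprB (resolvent_identity Xu Yu) -mulNmx -mulmxN opprB XY.
by rewrite -scalemxAr -scalemxAl.
Qed.

Lemma scaled_resolvent_step_c c c' j k : 0 <= c <= 1 -> 0 <= c' <= 1 -> (j < M)%N -> (k <= N)%N ->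
  scaled_resolvent c' (mesh_pt q N j k) - scaled_resolvent c (mesh_pt q N j k) =
  (c' - c)%:C *: (scaled_resolvent c (mesh_pt q N j k) *m (scaled_resolvent c' (mesh_pt q N j k) *m B)).
Proof.
move=> c01 c01' jM kN.
rewrite !scaled_resolventE; apply: resolvent_shift; [exact: scaled_resolvent_unit|exact: scaled_resolvent_unit| |].
  by rewrite mulmxBl mulmxBr mul_scalar_mx mul_mx_scalar -scalemxAl -scalemxAr.
by rewrite opprB addrC addrA subrK rmorphB scalerBl.
Qed.

(** The discrete form of the fact that R(w)^2 has the primitive - R(w), where R
is the resolvent. *)
Lemma telescoping_resolvents c : 0 <= c <= 1 ->
  chain_sum M q N (fun j k => scaled_resolvent c (mesh_pt q N j k) *m (scaled_resolvent c (mesh_pt q N j k.+1) *m B)) = 0.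
Proof.
move=> c01; rewrite /chain_sum.
transitivity (- (\sum_(j < M) \sum_(k < N) (scaled_resolvent c (mesh_pt q N j k.+1) - scaled_resolvent c (mesh_pt q N j k))) *m B).
  rewrite -sumrN mulmx_suml; apply: eq_bigr => j _.
  rewrite -sumrN mulmx_suml; apply: eq_bigr => k _.
  by rewrite opprB (scaled_resolvent_step_z c01 (ltn_ord j) (ltn_ord k)) -scalemxAl mulmxA.
by rewrite telescope_chain // oppr0 mul0mx.
Qed.

Lemma homotopy_term (s : R[i]) (X Y Z W : 'M[R[i]]_m) : X - W = s *: (W *m (Y *m B)) ->
  (X - W) - s *: (W *m (Z *m B)) = s *: (W *m ((Y - Z) *m B)).
Proof. by move=> ->; rewrite mulmxBl mulmxBr scalerBr. Qed.

(** The derivative of the resolvent in c is R B R = R^2 B, whose contour integral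
vanishes by [telescoping_resolvents]. Subtracting this zero leaves the
difference of two resolvents with nearby parameters. *)
Lemma homotopy_increment c c' : 0 <= c <= 1 -> 0 <= c' <= 1 ->
  chain_sum M q N (fun j k => scaled_resolvent c' (mesh_pt q N j k)) - chain_sum M q N (fun j k => scaled_resolvent c (mesh_pt q N j k)) =
  (c' - c)%:C *: chain_sum M q N (fun j k => scaled_resolvent c (mesh_pt q N j k) *m
    ((scaled_resolvent c' (mesh_pt q N j k) - scaled_resolvent c (mesh_pt q N j k.+1)) *m B)).
Proof.
move=> c01 c01'.
transitivity (chain_sum M q N (fun j k => scaled_resolvent c' (mesh_pt q N j k)) - chain_sum M q N (fun j k => scaled_resolvent c (mesh_pt q N j k))
  - (c' - c)%:C *: chain_sum M q N (fun j k => scaled_resolvent c (mesh_pt q N j k) *m (scaled_resolvent c (mesh_pt q N j k.+1) *m B))).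
  by rewrite telescoping_resolvents // scaler0 subr0.
rewrite chain_sumB chain_sumZ chain_sumB chain_sumZ; apply: eq_chain_sum => j k jM kN.
exact: homotopy_term (scaled_resolvent_step_c c01 c01' jM (ltnW kN)).
Qed.

Lemma scaled_resolvent_near c c' j k : 0 <= c <= 1 -> 0 <= c' <= 1 -> `|c' - c| <= N%:R^-1 ->
  (j < M)%N -> (k < N)%N ->
  opnorm (scaled_resolvent c' (mesh_pt q N j k) - scaled_resolvent c (mesh_pt q N j k.+1)) <=
  N%:R^-1 * (tau^-1 * (tau^-1 * opnorm B)) + L / N%:R * (tau^-1 * tau^-1).
Proof.
move=> c01 c01' cc jM kN; have kN' := ltnW kN.
have e1 := scaled_resolvent_le c01 jM kN'; have e2 := scaled_resolvent_le c01' jM kN'; have e3 := scaled_resolvent_le c01 jM kN.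
have s1 := scaled_resolvent_step_c c01 c01' jM kN'; have s2 := scaled_resolvent_step_z c01 jM kN.
have d1 := nc_mesh_step_le q N0 jM.
move: (scaled_resolvent c' (mesh_pt q N j k)) (scaled_resolvent c (mesh_pt q N j k)) (scaled_resolvent c (mesh_pt q N j k.+1)) s1 s2 e1 e2 e3.
move=> X Y Z s1 s2 e1 e2 e3.
have -> : X - Z = (X - Y) + (Y - Z) by rewrite addrA subrK.
rewrite s1 s2; apply: opnormD_le.
  apply: opnormZ_le; first by rewrite nc_real.
  apply: opnormM_le e1 _; exact: opnormM_le e2 (lexx _).
exact: opnormZ_le d1 (opnormM_le e1 e3).
Qed.

Lemma homotopy_step c c' : 0 <= c <= 1 -> 0 <= c' <= 1 -> `|c' - c| <= N%:R^-1 ->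
  opnorm (chain_sum M q N (fun j k => scaled_resolvent c' (mesh_pt q N j k)) - chain_sum M q N (fun j k => scaled_resolvent c (mesh_pt q N j k))) <=
  (tau^-1 ^+ 3 * (opnorm B + L) * opnorm B * L) / N%:R ^+ 2.
Proof.
move=> c01 c01' cc; rewrite homotopy_increment //.
set S := N%:R^-1 * (tau^-1 * (tau^-1 * opnorm B)) + L / N%:R * (tau^-1 * tau^-1).
have -> : tau^-1 ^+ 3 * (opnorm B + L) * opnorm B * L / N%:R ^+ 2 =
    N%:R^-1 * (tau^-1 * (S * opnorm B) * L).
  rewrite /S; move: (opnorm B) => b; rewrite exprSr.
  by field; rewrite !gt_eqF ?ltr0n.
apply: opnormZ_le; first by rewrite nc_real.
apply: (chain_sum_le q N0) => j k jM kN.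
apply: opnormM_le (scaled_resolvent_le c01 jM (ltnW kN)) _.
exact: opnormM_le (scaled_resolvent_near c01 c01' cc jM kN) (lexx _).
Qed.

Lemma small_steps_le (I : R -> 'M[R[i]]_m) (K : R) :
  (forall c c', 0 <= c <= 1 -> 0 <= c' <= 1 -> `|c' - c| <= N%:R^-1 ->
    opnorm (I c' - I c) <= K / N%:R ^+ 2) ->
  opnorm (I 1 - I 0) <= K / N%:R.
Proof.
move=> HI; have Nn : N%:R != 0 :> R by rewrite pnatr_eq0 -lt0n.
have Np : 0 < N%:R :> R by rewrite ltr0n.
pose c i : R := i%:R / N%:R.
have -> : I 1 = I (c N) by rewrite /c divff.
have -> : I 0 = I (c 0%N) by rewrite /c mul0r.
rewrite -(telescope_sumr (fun i => I (c i)) (leq0n N)) big_mkord.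
apply: (le_trans (opnorm_sum _ _ _)).
apply: (@le_trans _ _ (\sum_(i < N) K / N%:R ^+ 2)).
  apply: ler_sum => i _.
  have ci l : (l <= N)%N -> 0 <= c l <= 1.
    by move=> lN; rewrite divr_ge0 //= ler_pdivrMr // mul1r ler_nat.
  apply: HI; [exact/ci/ltnW|exact: ci|].
  by rewrite /c -mulrBl -natrB // subSnn mul1r ger0_norm // invr_ge0.
rewrite sumr_const card_ord -[leLHS]mulr_natr le_eqVlt; apply/orP; left; apply/eqP.
by field.
Qed.

(** N steps of length 1/N in c, each with an error O(1/N^2). *)
Lemma homotopy_chain :
  opnorm (chain_sum M q N (fun j k => scaled_resolvent 1 (mesh_pt q N j k)) - chain_sum M q N (fun j k => scaled_resolvent 0 (mesh_pt q N j k))) <=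
  (tau^-1 ^+ 3 * (opnorm B + L) * opnorm B * L) / N%:R.
Proof.
apply: (@small_steps_le (fun c => chain_sum M q N (fun j k => scaled_resolvent c (mesh_pt q N j k)))).
exact: homotopy_step.
Qed.

End FixedMesh.

Definition winding_sum N : R[i] := \sum_(j < M) \sum_(k < N) mesh_step q N j / mesh_pt q N j k.

Lemma scaled_resolvent0 N : (0 < N)%N ->
  chain_sum M q N (fun j k => scaled_resolvent 0 (mesh_pt q N j k)) = (winding_sum N)%:M.
Proof.
move=> N0; rewrite /chain_sum /winding_sum raddf_sum; apply: eq_bigr => j _.
rewrite raddf_sum; apply: eq_bigr => k _ /=.
rewrite scaled_resolventE scale0r subr0 invmx_scalar scale_scalar_mx //.
Qed.

(** The Riemann sums of (a + bw)^l R(w) and of (a + bB)^l R(w) agree up to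
O(1/N). In passing from l to l + 1, the identity w R(w) = 1 + B R(w) produces
only a polynomial integrand, covered by [power_chain_small]. *)
Lemma resolvent_power (a b : R[i]) l : exists2 K : R, 0 <= K & forall N, (0 < N)%N ->
  opnorm (chain_sum M q N (fun j k => (a + b * mesh_pt q N j k) ^+ l *: scaled_resolvent 1 (mesh_pt q N j k)) -
    (a%:M + b *: B) ^+ l *m chain_sum M q N (fun j k => scaled_resolvent 1 (mesh_pt q N j k))) <= K / N%:R.
Proof.
elim: l => [|l [K K0 HK]].
  exists 0 => // N N0; rewrite mul0r.
  under [X in chain_sum _ _ _ X - _]eq_fun do under eq_fun do rewrite expr0 scale1r.
  by rewrite expr0 mul1mx subrr opnorm0.
have [K1 HK1] := power_chain_small qM a b l.
exists (opnorm (a%:M + b *: B) * K + `|K1|).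
  by rewrite addr_ge0 ?normr_ge0 // mulr_ge0 ?opnorm_ge0.
move=> N N0.
set T0 := chain_sum _ _ _ (fun j k => scaled_resolvent 1 _).
pose T l := chain_sum M q N (fun j k => (a + b * mesh_pt q N j k) ^+ l *: scaled_resolvent 1 (mesh_pt q N j k)).
have TS : T l.+1 = (a%:M + b *: B) *m T l +
   (b * \sum_(j < M) \sum_(k < N) mesh_step q N j * (a + b * mesh_pt q N j k) ^+ l)%:M.
  rewrite /T /chain_sum mulmx_sumr mulr_sumr raddf_sum -big_split; apply: eq_bigr => j _ /=.
  rewrite mulmx_sumr mulr_sumr raddf_sum -big_split; apply: eq_bigr => k _ /=.
  set w := mesh_pt q N j k.
  have wu : w%:M - 1%:C *: B \in unitmx by apply: scaled_resolvent_unit => //; rewrite ?ler01 ?lexx // ltnW.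
  have wR : w *: scaled_resolvent 1 w = 1%:M + B *m scaled_resolvent 1 w.
    have := mulmxV wu; rewrite -scaled_resolventE scale1r mulmxBl mul_scalar_mx => /eqP.
    by rewrite subr_eq => /eqP ->; rewrite addrC.
  have key : (a + b * w) *: scaled_resolvent 1 w = (a%:M + b *: B) *m scaled_resolvent 1 w + b%:M.
    rewrite scalerDl -scalerA wR scalerDr mulmxDl mul_scalar_mx -scalemxAl scalemx1.
    by rewrite -addrA [b%:M + _]addrC.
  rewrite -!scalemxAr exprSr -scalerA key !scalerDr; congr (_ + _).
  rewrite !scale_scalar_mx; congr (_%:M); ring.
rewrite -/(T l.+1) TS exprS -mulmxA addrAC -mulmxBr.
rewrite (le_trans (opnormD _ _)) // mulrDl lerD //.
  by rewrite (le_trans (opnormM _ _)) // -mulrA ler_wpM2l ?opnorm_ge0 // HK.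
rewrite -scalemx1 (le_trans (opnormZ _ _)) // -[leRHS]mulr1.
rewrite ler_pM ?nc_ge0 ?opnorm_ge0 ?opnorm1 // (le_trans (HK1 N N0)) //.
by rewrite ler_wpM2r ?invr_ge0 // ler_norm.
Qed.

End ResolventChain.

Lemma le_of_mesh (R : realType) (a b K : R) :
  (forall N, (0 < N)%N -> a <= b + K / N%:R) -> a <= b.
Proof.
move=> H; apply/ler_addgt0Pr => e e0.
have h0 : 0 <= `|K| / e by rewrite divr_ge0 // ltW.
pose N := (Num.bound (`|K| / e)).+1.
have Np : 0 < N%:R :> R by rewrite ltr0n.
apply: (le_trans (H N isT)); rewrite lerD2l ler_pdivrMr // mulrC -ler_pdivrMr //.
apply: (@le_trans _ _ (`|K| / e)); first by rewrite ler_pM2r ?invr_gt0 // ler_norm.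
by apply: le_trans (ltW (archi_boundP h0)) _; rewrite ler_nat /N.
Qed.

Section CauchyChain.
Variables (R : realType) (M : nat) (q : nat -> R[i]).
Hypothesis qM : q M = q 0%N.
Variables (m : nat) (B : 'M[R[i]]_m) (tau : R).
Hypothesis tau0 : 0 < tau.
Hypothesis Htau : forall (c : R) N j k (v : 'cV_m), 0 <= c <= 1 -> (0 < N)%N ->
  (j < M)%N -> (k <= N)%N ->
  tau * enorm v <= enorm (((mesh_pt q N j k)%:M - c%:C *: B) *m v).
Variable Kw : R.
Hypothesis winding : forall N, (0 < N)%N ->
  2 * pi - Kw / N%:R <= complex.Im (winding_sum M q N).

(** The Riemann sum of (a + bw)^l R(w) is at most S times the perimeter. By
[resolvent_power] and [homotopy_chain] it is also close to (a + bB)^l times the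
winding sum, of which a lower bound for the modulus suffices. *)
Lemma cauchy_bound (a b : R[i]) l (S : R) :
  (forall N j k, (0 < N)%N -> (j < M)%N -> (k < N)%N ->
    nc ((a + b * mesh_pt q N j k) ^+ l) * opnorm (scaled_resolvent B 1 (mesh_pt q N j k)) <= S) ->
  2 * pi * opnorm ((a%:M + b *: B) ^+ l) <= S * perimeter M q.
Proof.
move=> HS; set P := _ ^+ l; set p := opnorm P.
have p0 : 0 <= p by exact: opnorm_ge0.
have [K K0 HK] := resolvent_power qM tau0 Htau a b l.
pose K2 := tau^-1 ^+ 3 * (opnorm B + perimeter M q) * opnorm B * perimeter M q.
apply: (@le_of_mesh _ _ _ (p * K2 + K + `|Kw| * p)) => N N0.
have h1 : opnorm (chain_sum M q N (fun j k => scaled_resolvent B 1 (mesh_pt q N j k)) - (winding_sum M q N)%:M) <= K2 / N%:R.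
  by rewrite -(scaled_resolvent0 M q B N0); exact: homotopy_chain.
have h2 := HK N N0; rewrite -/P in h2.
set T0 := chain_sum M q N (fun j k => scaled_resolvent B 1 _) in h1 h2.
set T := chain_sum M q N _ in h2.
have h3 : opnorm T <= S * perimeter M q.
  apply: (chain_sum_le q N0) => j k jM kN.
  by rewrite (le_trans (opnormZ _ _)) // HS.
pose z := winding_sum M q N.
have h4 : nc z * p <= S * perimeter M q + K / N%:R + p * (K2 / N%:R).
  have -> : nc z * p = opnorm (z *: P).
    apply/eqP; rewrite eq_le opnormZ andbT.
    have [->|z0] := eqVneq z 0; first by rewrite Normc.normc0 mul0r opnorm_ge0.
    have nz : 0 < nc z by rewrite lt_neqAle eq_sym nc_eq0 z0 nc_ge0.
    rewrite -ler_pdivlMl //.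
    by have := opnormZ z^-1 (z *: P); rewrite scalerA mulVf // scale1r Normc.normcV.
  have -> : z *: P = T - (T - P *m T0) - P *m (T0 - z%:M).
    by rewrite mulmxBr mul_mx_scalar !subKr.
  rewrite (le_trans (opnormD _ _)) // lerD //.
    by rewrite (le_trans (opnormD _ _)) // opnormN lerD.
  by rewrite opnormN (le_trans (opnormM _ _)) // ler_wpM2l.
have h5 : (2 * pi - Kw / N%:R) * p <= nc z * p.
  by rewrite ler_wpM2r // (le_trans (winding N0)) // (le_trans (ler_norm _)) // nc_Im.
have Ni : 0 < N%:R^-1 :> R by rewrite invr_gt0 ltr0n.
have h6 : Kw / N%:R * p <= `|Kw| / N%:R * p.
  by rewrite ler_wpM2r // ler_pM2r // ler_norm.
move: h5; rewrite mulrBl lerBlDr => h5; apply: le_trans h5 _.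
apply: le_trans (lerD h4 h6) _.
rewrite le_eqVlt; apply/orP; left; apply/eqP; ring.
Qed.
End CauchyChain.

(** * Polygons around the origin *)
Section Polygon.
(* The j-th side lies on the line Re (conj(x j) w) = r j, at distance r j from the
   origin; y' j and y j are the coordinates of its two ends along that line. *)
Variables (R : realType) (M : nat) (q x : nat -> R[i]) (r y' y : nat -> R).
Hypothesis x1 : forall j, nc (x j) = 1.
Hypothesis r0 : forall j, 0 < r j.
Hypothesis y'y : forall j, y' j <= y j.
Hypothesis qE : forall j, q j = x j * (r j +i* y' j).
Hypothesis qSE : forall j, q j.+1 = x j * (r j +i* y j).

Definition edge_param N j k : R := y' j + (k%:R / N%:R) * (y j - y' j).

Lemma mesh_ptE N j k : mesh_pt q N j k = x j * (r j +i* edge_param N j k).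
Proof.
rewrite /mesh_pt qE qSE -mulrBr mulrCA -mulrDr; congr (_ * _).
have -> : k%:R / N%:R = (k%:R / N%:R : R)%:C :> R[i].
  by rewrite rmorphM fmorphV !rmorph_nat.
by apply/eqP; rewrite eq_complex /edge_param /=; apply/andP; split; apply/eqP; ring.
Qed.

Lemma mesh_stepE N j : mesh_step q N j = x j * (0 +i* ((y j - y' j) / N%:R)).
Proof.
rewrite /mesh_step qSE qE -mulrBr -mulrA; congr (_ * _).
have -> : N%:R^-1 = (N%:R^-1 : R)%:C :> R[i] by rewrite fmorphV rmorph_nat.
by apply/eqP; rewrite eq_complex /=; apply/andP; split; apply/eqP; ring.
Qed.

Lemma conj_dir_mul j : (x j)^* * x j = 1.
Proof. by rewrite mulrC -sqr_normc norm_nc x1 expr1n. Qed.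

Lemma Re_mesh_pt N j k : complex.Re ((x j)^* * mesh_pt q N j k) = r j.
Proof. by rewrite mesh_ptE mulrA conj_dir_mul mul1r. Qed.

Lemma edge_nc j : nc (q j.+1 - q j) = y j - y' j.
Proof.
rewrite qSE qE -mulrBr Normc.normcM x1 mul1r /= subrr expr0n add0r sqrtr_sqr ger0_norm //.
by rewrite subr_ge0.
Qed.

(** The j-th side is seen from the origin under the angle
atan (y j / r j) - atan (y' j / r j). *)
Lemma winding_polygon :
  \sum_(j < M) (atan (y j / r j) - atan (y' j / r j)) = 2 * pi ->
  exists K : R, forall N, (0 < N)%N -> 2 * pi - K / N%:R <= complex.Im (winding_sum M q N).
Proof.
move=> tot; exists (\sum_(j < M) ((y j - y' j) / r j) ^+ 2) => N N0.
have Nn : N%:R != 0 :> R by rewrite pnatr_eq0 -lt0n.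
have Np : 0 < N%:R :> R by rewrite ltr0n.
rewrite -tot mulr_suml -sumrB /winding_sum raddf_sum.
apply: ler_sum => j _; rewrite raddf_sum.
have rj := r0 j.
pose h := (y j - y' j) / r j / N%:R.
have h0 : 0 <= h by rewrite !divr_ge0 ?subr_ge0 // ltW.
have step k : atan (edge_param N j k.+1 / r j) - atan (edge_param N j k / r j) - h ^+ 2 <=
    complex.Im (mesh_step q N j / mesh_pt q N j k).
  have hE : edge_param N j k.+1 / r j - edge_param N j k / r j = h.
    by rewrite /edge_param /h -natr1; field; rewrite Nn gt_eqF.
  have le_s : edge_param N j k / r j <= edge_param N j k.+1 / r j by rewrite -subr_ge0 hE.
  rewrite lerBlDr; apply: le_trans (atan_step le_s) _; rewrite hE lerD2r.
  have -> : mesh_step q N j / mesh_pt q N j k = (0 +i* ((y j - y' j) / N%:R)) / (r j +i* edge_param N j k).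
    rewrite mesh_ptE mesh_stepE -mulf_div divff ?mul1r // -nc_eq0 x1 oner_eq0 //.
  have den : 0 < r j ^+ 2 + edge_param N j k ^+ 2 by rewrite ltr_pwDl ?exprn_gt0 ?sqr_ge0.
  have den' : 0 < 1 + (edge_param N j k / r j) ^+ 2 by rewrite ltr_pwDl ?sqr_ge0.
  rewrite le_eqVlt; apply/orP; left; apply/eqP.
  rewrite /= /h; simpc => /=; field.
  by rewrite Nn !gt_eqF.
apply: (@le_trans _ _ (\sum_(k < N) (atan (edge_param N j k.+1 / r j) - atan (edge_param N j k / r j) - h ^+ 2))).
  rewrite sumrB sumr_const card_ord -(big_mkord xpredT (fun k => atan (edge_param N j k.+1 / r j) - atan (edge_param N j k / r j))).
  rewrite (telescope_sumr (fun k => atan (edge_param N j k / r j))) //.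
  have -> : edge_param N j N = y j by rewrite /edge_param divff // mul1r addrC subrK.
  have -> : edge_param N j 0 = y' j by rewrite /edge_param mul0r mul0r addr0.
  rewrite lerD2l lerN2 le_eqVlt; apply/orP; left; apply/eqP.
  by rewrite -mulr_natr /h; field; rewrite Nn gt_eqF.
by apply: ler_sum => k _; exact: step.
Qed.

Variables (m : nat) (B : 'M[R[i]]_m) (eps : R).
Hypothesis eps0 : 0 < eps.
Hypothesis HB : forall j w v, r j <= complex.Re ((x j)^* * w) ->
  eps * enorm v <= enorm ((w%:M - B) *m v).

(** If c is not small, w - cB = c (w/c - B), and w/c lies still further out than
w because c <= 1. If c is small, w dominates cB since |w| >= r1. The threshold
r1 / (|B| + eps) is the value of c at which both arguments give the same bound. *)
Lemma polygon_lower_bound :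
  exists2 tau : R, 0 < tau & forall (c : R) N j k (v : 'cV_m), 0 <= c <= 1 -> (0 < N)%N ->
  (j < M)%N -> (k <= N)%N ->
  tau * enorm v <= enorm (((mesh_pt q N j k)%:M - c%:C *: B) *m v).
Proof.
have [r1 r10 r1r] : exists2 r1 : R, 0 < r1 & forall j, (j < M)%N -> r1 <= r j.
  elim: (M) => [|M' [r1 r10 IH]]; first by exists 1.
  exists (Num.min r1 (r M')); first by rewrite lt_min r10 r0.
  move=> j; rewrite ltnS leq_eqVlt => /orP[/eqP ->|/IH rj].
    by rewrite ge_min lexx orbT.
  by rewrite ge_min rj.
have b0 := opnorm_ge0 B; set b := opnorm B in b0.
have be : 0 < b + eps by rewrite ltr_wpDl.
exists (r1 * eps / (b + eps)) => [|c N j k v /andP[c0 c1] N0 jM kN].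
  by rewrite divr_gt0 // mulr_gt0.
set w := mesh_pt q N j k; have rw : complex.Re ((x j)^* * w) = r j by exact: Re_mesh_pt.
have rj := r1r _ jM.
have v0 := enorm_ge0 v.
have [cs|cb] := leP (r1 / (b + eps)) c.
  have cp : 0 < c by apply: lt_le_trans cs; rewrite divr_gt0.
  have -> : w%:M - c%:C *: B = c%:C *: ((c^-1%:C * w)%:M - B).
    rewrite scalerBr scale_scalar_mx mulrA -rmorphM mulfV ?gt_eqF // rmorph1 mul1r //.
  rewrite -scalemxAl enormZ nc_real gtr0_norm //.
  have Re_c : complex.Re ((x j)^* * (c^-1%:C * w)) = c^-1 * r j.
    rewrite mulrCA -rw; case: ((x j)^* * w) => a1 a2 /=; ring.
  have h := @HB j (c^-1%:C * w) v.
  rewrite Re_c in h.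
  have {}h : eps * enorm v <= enorm (((c^-1%:C * w)%:M - B) *m v).
    by apply: h; rewrite ler_peMl ?(ltW (r0 j)) // invf_ge1.
  apply: (@le_trans _ _ (c * (eps * enorm v))); last by rewrite ler_wpM2l // ltW.
  have -> : r1 * eps / (b + eps) = r1 / (b + eps) * eps by ring.
  by rewrite mulrA ler_wpM2r // ler_wpM2r // ltW.
have nw : r1 <= nc w.
  apply: (le_trans rj); rewrite -rw (le_trans (ler_norm _)) // (le_trans (nc_Re _)) //.
  by rewrite Normc.normcM nc_conj x1 mul1r.
have h1 : nc w * enorm v <= enorm ((w%:M - c%:C *: B) *m v) + c * b * enorm v.
  rewrite -enormZ -mul_scalar_mx -[X in enorm (X *m v)](subrK (c%:C *: B)).
  rewrite mulmxDl (le_trans (enormD _ _)) // lerD2l -scalemxAl enormZ nc_real ger0_norm //.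
  by rewrite -mulrA ler_wpM2l // opnormP.
have h2 : (r1 * eps / (b + eps)) * enorm v + c * b * enorm v <= nc w * enorm v.
  rewrite -mulrDl ler_wpM2r //; apply: le_trans nw.
  have -> : r1 = r1 * eps / (b + eps) + r1 / (b + eps) * b by field; rewrite gt_eqF.
  rewrite lerD //; last by rewrite ler_wpM2r // ltW.
  rewrite le_eqVlt; apply/orP; left; apply/eqP; field; rewrite gt_eqF //.
by rewrite -(lerD2r (c * b * enorm v)) (le_trans h2).
Qed.

Lemma polygon_cauchy (a b : R[i]) l (P : R) :
  q M = q 0%N ->
  \sum_(j < M) (atan (y j / r j) - atan (y' j / r j)) = 2 * pi ->
  (forall N j k, (0 < N)%N -> (j < M)%N -> (k < N)%N ->
    nc ((a + b * mesh_pt q N j k) ^+ l) <= P) ->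
  2 * pi * opnorm ((a%:M + b *: B) ^+ l) <= P / eps * \sum_(j < M) (y j - y' j).
Proof.
move=> qM tot HP.
have [Kw winding] := winding_polygon tot.
have [tau tau0 Htau] := polygon_lower_bound.
have -> : \sum_(j < M) (y j - y' j) = perimeter M q.
  by apply: eq_bigr => j _; rewrite edge_nc.
apply: (cauchy_bound qM tau0 Htau winding) => N j k N0 jM kN.
rewrite ler_pM ?nc_ge0 ?opnorm_ge0 // ?HP //.
apply: lower_bound_invmx => // v; rewrite scale1r; apply: (@HB j).
by rewrite Re_mesh_pt.
Qed.

End Polygon.

(** * A discrete Cauchy-Crofton formula *)
Section Crofton.
Variable R : realType.

(** The coordinate of z along the unit vector of argument t. *)
Definition coord_along (t : R) (z : R[i]) : R := complex.Re z * cos t + complex.Im z * sin t.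

Lemma coord_alongB t z w : coord_along t (z - w) = coord_along t z - coord_along t w.
Proof. by case: z w => [a b] [c d]; rewrite /coord_along /=; ring. Qed.

Lemma coord_along_Dpi t z : coord_along (t + pi) z = - coord_along t z.
Proof. by rewrite /coord_along cosDpi sinDpi; ring. Qed.

Lemma coord_le_nc t z : `|coord_along t z| <= nc z.
Proof.
case: z => a b; rewrite /coord_along /= -sqrtr_sqr ler_wsqrtr //.
have e := cos2Dsin2 t.
have := sqr_ge0 (a * sin t - b * cos t).
rewrite -subr_ge0 => h; rewrite -subr_ge0 (le_trans h) // le_eqVlt; apply/orP; left; apply/eqP.
by rewrite -[a ^+ 2]mulr1 -[b ^+ 2]mulr1 -e; ring.
Qed.

(** As a function of t the coordinate is a sinusoid of period 2 pi, determined
by its values at t and t - d. *)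
Lemma coord_interp t d p z :
  sin d * coord_along (t + p) z = sin (p + d) * coord_along t z - sin p * coord_along (t - d) z.
Proof. rewrite /coord_along !(cosD, sinD) cosN sinN; ring. Qed.

Variables (H : nat).
Hypothesis H1 : (1 < H)%N.
Let H0 : (0 < H)%N. Proof. exact: ltnW. Qed.
(* The angular step is d, and the formulas involve half of it, g. *)
Let g : R := pi / (2 * H%:R).
Let d : R := pi / H%:R.

Let Hp : 0 < H%:R :> R. Proof. by rewrite ltr0n. Qed.
Let Hd : H%:R * d = pi. Proof. by rewrite /d mulrC divfK // gt_eqF. Qed.
Let dg : d = g *+ 2. Proof. by rewrite /d /g -mulr_natr; field; rewrite gt_eqF. Qed.
Let d0 : 0 < d. Proof. by rewrite divr_gt0 // pi_gt0. Qed.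
Let g0 : 0 < g. Proof. by rewrite divr_gt0 ?pi_gt0 // mulr_gt0. Qed.

Lemma sin_g_gt0 : 0 < sin g.
Proof.
apply: sin_gt0_pi; rewrite g0 /= /g ltr_pdivrMr ?mulr_gt0 //.
rewrite ltr_pMr ?pi_gt0 // -natrM ltr1n; lia.
Qed.

Lemma period_sum_shift (f : nat -> R) n : (forall j, f (j + H)%N = f j) ->
  \sum_(i < H) f (n + i)%N = \sum_(i < H) f i.
Proof.
move=> fH; elim: n => [|n IH]; first by [].
rewrite -IH -(big_mkord xpredT (fun i => f (n.+1 + i)%N)) -(big_mkord xpredT (fun i => f (n + i)%N)).
apply/eqP; rewrite -subr_eq0 -sumrB; apply/eqP.
rewrite (eq_big_nat _ _ (F2 := fun i => f (n + i.+1)%N - f (n + i)%N)) => [|i _]; last by rewrite addSnnS.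
by rewrite (telescope_sumr (fun i => f (n + i)%N)) // fH addn0 subrr.
Qed.

(** Multiplied by sin g, a sum of equally spaced sinusoids telescopes; over a
half-turn it gives a coordinate of z. *)
Lemma coord_block_sum t z :
  \sum_(i < H) coord_along (t + i%:R * d) z <= nc z / sin g.
Proof.
have sg := sin_g_gt0.
rewrite ler_pdivlMr // -(ler_pM2r (ltr0n R 2)).
pose F i := complex.Re z * sin (t + i%:R * d - g) - complex.Im z * cos (t + i%:R * d - g).
have step i : coord_along (t + i%:R * d) z * sin g * 2 = F i.+1 - F i.
  rewrite /F /coord_along.
  have -> : t + i.+1%:R * d - g = t + i%:R * d + g by rewrite dg -natr1; ring.
  rewrite !(cosD (t + _), sinD (t + _)) cosN sinN; ring.
rewrite !mulr_suml; under eq_bigr do rewrite step.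
rewrite -(big_mkord xpredT (fun i => F i.+1 - F i)) telescope_sumr // /F Hd mul0r addr0.
have -> : t + pi - g = t - g + pi by ring.
rewrite sinDpi cosDpi.
have := coord_le_nc (t - g + pi / 2) z; rewrite /coord_along cosDpihalf sinDpihalf => h.
apply: le_trans (_ : 2 * (complex.Re z * - sin (t - g) + complex.Im z * cos (t - g)) <= _).
  by rewrite le_eqVlt; apply/orP; left; apply/eqP; ring.
by rewrite [leRHS]mulrC ler_pM2l // (le_trans (ler_norm _)).
Qed.

(** The coordinates change sign after H steps, that is a half-turn. The H
directions that follow a change of sign from negative to positive all have
nonnegative coordinates, by [coord_interp]; on such a block the absolute values
can be dropped and [coord_block_sum] applies. *)
Lemma crofton_half z : \sum_(j < H) `|coord_along (j%:R * d) z| <= nc z / sin g.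
Proof.
pose c j := coord_along (j%:R * d) z.
have cH j : c (j + H)%N = - c j.
  by rewrite /c natrD mulrDl Hd coord_along_Dpi.
have [k0 ck0] : exists k0, c k0 <= 0.
  have [c0|c0] := leP (c 0%N) 0; first by exists 0%N.
  by exists (0 + H)%N; rewrite cH oppr_le0 ltW.
have ex : exists i, (0 < i)%N && (0 <= c (k0 + i)%N).
  by exists H; rewrite H0 cH oppr_ge0.
case: (ex_minnP ex) => -[|k] /andP[// _ ck] kmin.
have ck1 : c (k0 + k)%N <= 0.
  case: k ck kmin => [|k] ck kmin; first by rewrite addn0.
  rewrite leNgt; apply/negP => /ltW ck'.
  by have := kmin k.+1; rewrite ck' /= => /(_ isT); rewrite ltnn.
set j0 := (k0 + k.+1)%N in ck.
have pos i : (i < H)%N -> 0 <= c (j0 + i)%N.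
  move=> iH; have sd : 0 < sin d.
    by rewrite sin_gt0_pi // d0 /d ltr_pdivrMr // ltr_pMr ?pi_gt0 // ltr1n.
  have s1 : 0 <= sin (i%:R * d + d).
    apply: sin_ge0_pi; rewrite -Hd -[X in _ + X]mul1r -mulrDl natr1 mulr_ge0 ?(ltW d0) //=.
    by rewrite ler_pM2r // ler_nat.
  have s2 : 0 <= sin (i%:R * d).
    apply: sin_ge0_pi; rewrite -Hd mulr_ge0 ?(ltW d0) //=.
    by rewrite ler_pM2r // ler_nat ltnW.
  rewrite -(pmulr_rge0 _ sd) /c natrD mulrDl coord_interp subr_ge0.
  apply: (@le_trans _ _ 0); last by rewrite mulr_ge0.
  rewrite mulr_ge0_le0 //.
  have -> : j0%:R * d - d = (k0 + k)%:R * d by rewrite /j0 addnS -natr1; ring.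
  exact: ck1.
rewrite -(period_sum_shift (f := fun j => `|c j|) j0) => [|j]; last by rewrite cH normrN.
rewrite (eq_bigr (fun i : 'I_H => coord_along (j0%:R * d + i%:R * d) z)) => [|i _].
  exact: coord_block_sum.
by rewrite ger0_norm ?pos // /c natrD mulrDl.
Qed.

End Crofton.

Section ClosedPolygonalChain.
Variable R : realType.

(** A closed chain travels from the i-th point to the j-th and back. *)
Lemma closed_chain_width (u : nat -> R) n i j : u 0%N = u n -> (i <= n)%N -> (j <= n)%N ->
  2 * `|u i - u j| <= \sum_(0 <= k < n) `|u k.+1 - u k|.
Proof.
move=> u0n.
have tv a b : (a <= b)%N -> `|u b - u a| <= \sum_(a <= k < b) `|u k.+1 - u k|.
  by move=> ab; rewrite -(telescope_sumr u ab) ler_norm_sum.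
wlog ij : i j / (i <= j)%N => [W i_n j_n|i_n j_n].
  by have [ij|/ltnW ji] := leqP i j; [exact: W|rewrite distrC; exact: W].
have h1 := tv _ _ ij; have h2 := tv _ _ (leq0n i); have h3 := tv _ _ j_n.
rewrite (big_cat_nat _ (n := i)) //= (big_cat_nat _ (n := j) (m := i)) //=.
move: (\sum_(i <= k < j) _) (\sum_(0 <= k < i) _) (\sum_(j <= k < n) _) h1 h2 h3 => a b c.
rewrite -u0n [`|u i - u j|]distrC => h1 h2 h3.
have : `|u j - u i| <= b + c; last by lra.
apply: (le_trans _ (lerD h2 h3)); rewrite distrC (le_trans _ (ler_normD _ _)) //.
by rewrite le_eqVlt; apply/orP; left; apply/eqP; congr (`|_|); ring.
Qed.

End ClosedPolygonalChain.

Section ClosedCurve.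
Variables (R : realType) (gamma : R -> R[i]) (L : R).
Hypothesis closed : gamma 0 = gamma 1.
Let inscribed (s : seq R) : R := \sum_(0 <= k < size s)
  nc (gamma (nth 1 (0 :: s) k.+1) - gamma (nth 1 (0 :: s) k)).
Hypothesis length_le : forall s, itv_partition 0 1 s -> inscribed s <= L.

(** Length is defined by partitions of [0, 1]: this one visits prescribed
parameters. *)
Lemma partition_through (s : seq R) : (forall x, x \in s -> 0 <= x <= 1) ->
  exists2 p, itv_partition 0 1 p & forall x, x \in s -> x \in (0 : R) :: p.
Proof.
move=> s01; pose p := sort <=%R (undup (1 :: [seq x <- s | 0 < x])).
have pE x : (x \in p) = (x == 1) || ((0 < x) && (x \in s)).
  by rewrite mem_sort mem_undup inE mem_filter.
have p_lt : sorted <%R p by rewrite sort_lt_sorted undup_uniq.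
exists p; last first.
  move=> x xs; rewrite inE pE xs andbT.
  by have /andP[] := s01 _ xs; rewrite le_eqVlt eq_sym => /orP[/eqP -> //|->]; rewrite ?eqxx ?orbT.
have p0 x : x \in p -> 0 < x by rewrite pE => /orP[/eqP ->//|/andP[]].
have p1 x : x \in p -> x <= 1.
  by rewrite pE => /orP[/eqP ->//|/andP[_ /s01/andP[]]].
have in1 : 1 \in p by rewrite pE eqxx.
split; last first.
  have p_le : sorted <=%R p by exact: sort_le_sorted.
  have lastE : last 0 p = nth 1 p (size p).-1.
    by rewrite nth_last; case: (p) in1.
  have idx1 : (index 1%R p < size p)%N by rewrite index_mem.
  have sz : ((size p).-1 < size p)%N by case: (p) in1.
  rewrite eq_le lastE p1 ?mem_nth //= -{1}(nth_index 1 in1).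
  by apply: le_sorted_leq_nth => //; rewrite -ltnS prednK // (leq_ltn_trans _ sz).
case: p p0 p_lt in1 {pE p1} => //= a l p0 -> _; rewrite andbT.
by apply: p0; exact: mem_head.
Qed.

(** By hypothesis the curve comes arbitrarily close to the height h j in the j-th
direction. Opposite directions add up to a width, which an inscribed polygon
through the relevant points covers twice ([closed_chain_width]). Summed over the
H directions of a half-turn, the variations of the coordinates are bounded by the
length of the polygon ([crofton_half]). *)
Lemma crofton_closed_curve H (h : nat -> R) : (1 < H)%N ->
  (forall j e, 0 < e -> exists2 s, 0 <= s <= 1 &
     h j - e <= coord_along (j%:R * (pi / H%:R)) (gamma s)) ->
  \sum_(j < H + H) h j <= L / (2 * sin (pi / (2 * H%:R))).
Proof.
move=> H1 Hh; have sg := sin_g_gt0 R H1; set g := pi / (2 * _) in sg *.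
have H0 : (0 < H)%N by exact: ltnW.
have Hp : 0 < H%:R :> R by rewrite ltr0n.
pose d : R := pi / H%:R.
apply/ler_addgt0Pr => e e0.
pose eta := e / (2 * H%:R).
have eta0 : 0 < eta by rewrite divr_gt0 // mulr_gt0.
have /choice[s Hs] : forall j : nat, exists s, 0 <= s <= 1 /\
    h j - eta <= coord_along (j%:R * d) (gamma s).
  by move=> j; have [s s01 hs] := Hh j _ eta0; exists s.
have [|p pP sp] := @partition_through [seq s j | j <- iota 0 (H + H)].
  by move=> x /mapP[j _ ->]; have [] := Hs j.
pose u k := gamma (nth 1 (0 :: p) k); pose n := size p.
have un : u 0%N = u n.
  rewrite /u /= closed; congr gamma; move: pP => [_ /eqP].
  by rewrite (last_nth 1) /n => ->.
have idx j : (j < H + H)%N -> exists2 i, (i <= n)%N & u i = gamma (s j).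
  move=> jH; have : s j \in 0 :: p by apply: sp; apply: map_f; rewrite mem_iota.
  move=> /(nthP 1)[i ip ui]; exists i; last by rewrite /u ui.
  by rewrite -ltnS.
have main j : (j < H)%N -> 2 * (h j + h (j + H)%N - 2 * eta) <=
    \sum_(0 <= k < n) `|coord_along (j%:R * d) (u k.+1 - u k)|.
  move=> jH.
  have [i1 i1n u1] := idx j (leq_trans jH (leq_addr _ _)).
  have [|i2 i2n u2] := idx (j + H)%N; first by rewrite ltn_add2r.
  have := @closed_chain_width R (fun k => coord_along (j%:R * d) (u k)) n i1 i2 _ i1n i2n.
  rewrite un => /(_ erefl); rewrite u1 u2.
  rewrite (eq_bigr (fun k => `|coord_along (j%:R * d) (u k.+1 - u k)|)) => [|k _]; last by rewrite coord_alongB.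
  apply: le_trans; rewrite ler_pM2l //.
  have [_ a1] := Hs j; have [_ a2] := Hs (j + H)%N.
  have e2 : coord_along ((j + H)%:R * d) (gamma (s (j + H)%N)) = - coord_along (j%:R * d) (gamma (s (j + H)%N)).
    rewrite natrD mulrDl [H%:R * d]mulrC divfK ?gt_eqF //; exact: coord_along_Dpi.
  rewrite e2 in a2; rewrite (le_trans _ (ler_norm _)) //; lra.
have total : \sum_(j < H) \sum_(0 <= k < n) `|coord_along (j%:R * d) (u k.+1 - u k)| <= L / sin g.
  rewrite exchange_big /=; apply: (@le_trans _ _ (\sum_(0 <= k < n) nc (u k.+1 - u k) / sin g)).
    by apply: ler_sum => k _; exact: crofton_half.
  by rewrite -mulr_suml ler_pM2r ?invr_gt0 // length_le.
have sumE : \sum_(j < H + H) h j = \sum_(j < H) (h j + h (j + H)%N).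
  rewrite big_split_ord big_split /=; congr (_ + _); apply: eq_bigr => j _; by rewrite addnC.
have tot2 : \sum_(j < H) (2 * (h j + h (j + H)%N - 2 * eta)) <= L / sin g.
  by apply: le_trans total; apply: ler_sum => j _; exact: main.
rewrite -mulr_sumr sumrB -sumE sumr_const card_ord in tot2.
have etaE : 2 * eta * H%:R = e by rewrite /eta; field; rewrite gt_eqF.
have e3 : (2 * eta) *+ H = e by rewrite -[LHS]mulr_natr etaE.
rewrite e3 in tot2.
have -> : L / (2 * sin g) = (L / sin g) / 2 by field; rewrite gt_eqF.
lra.
Qed.

End ClosedCurve.

(** * Polygons circumscribed about a near-spectrum *)
(** Stated with vectors rather than the norm of an inverse, this set is visibly
open, and eigenvalues need no separate treatment. *)
Definition near_spectrum (R : realType) m (B : 'M[R[i]]_m) (eps : R) : set R[i] :=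
  [set z | exists v : 'cV_m, enorm ((z%:M - B) *m v) < eps * enorm v].

Definition unit_vec (R : realType) (t : R) : R[i] := cos t +i* sin t.

Section Directions.
Variable R : realType.
Implicit Types (t : R) (z : R[i]).

Lemma nc_unit_vec t : nc (unit_vec t) = 1.
Proof. by rewrite /= cos2Dsin2 sqrtr1. Qed.

Lemma coord_alongE t z : coord_along t z = complex.Re ((unit_vec t)^* * z).
Proof. by case: z => a b; rewrite /coord_along /=; ring. Qed.

Lemma coord_alongD t z w : coord_along t (z + w) = coord_along t z + coord_along t w.
Proof. by case: z w => [a b] [c d]; rewrite /coord_along /=; ring. Qed.

Lemma coord_along_unit_vec t (a : R) : coord_along t (a%:C * unit_vec t) = a.
Proof.
rewrite /coord_along /= !mul0r subr0 addr0 -!mulrA -mulrDr -!expr2 cos2Dsin2 mulr1 //.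
Qed.
End Directions.

Section SupportFunction.
Variables (R : realType) (m : nat) (B : 'M[R[i]]_m) (eps D : R).
Hypothesis eps0 : 0 < eps.
Let P := near_spectrum B eps.
Hypothesis P0 : P 0.
Hypothesis PD : forall z, P z -> nc z <= D.

Definition support_fun (t : R) : R := sup [set coord_along t z | z in P].

Lemma support_has_sup t : has_sup [set coord_along t z | z in P].
Proof.
split; first by exists (coord_along t 0); exists 0.
exists D => _ [z Pz <-]; rewrite (le_trans (ler_norm _)) // (le_trans (coord_le_nc _ _)) //.
exact: PD.
Qed.

Lemma coord_le_support t z : P z -> coord_along t z <= support_fun t.
Proof. by move=> Pz; apply: (ub_le_sup (support_has_sup t).2); exists z. Qed.

Lemma support_le t c : (forall z, P z -> coord_along t z <= c) -> support_fun t <= c.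
Proof.
by move=> H; apply: ge_sup; [exact: (support_has_sup t).1|move=> _ [z /H ? <-]].
Qed.

Lemma near_spectrum_open z : P z -> exists2 e, 0 < e &
  forall w, nc (w - z) < e -> P w.
Proof.
move=> [v vz].
have v0 : 0 < enorm v.
  rewrite lt_neqAle enorm_ge0 andbT; apply: contraTneq vz => <-.
  by rewrite mulr0 -leNgt enorm_ge0.
exists ((eps * enorm v - enorm ((z%:M - B) *m v)) / enorm v).
  by rewrite divr_gt0 // subr_gt0.
move=> w; rewrite (ltr_pdivlMr _ _ v0) => wz; exists v.
have -> : w%:M - B = (w - z)%:M + (z%:M - B) by rewrite raddfB /= addrA subrK.
rewrite mulmxDl mul_scalar_mx (le_lt_trans (enormD _ _)) // enormZ.
by rewrite -ltrBrDr.
Qed.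

(** The supremum is not attained on an open set; hence the support lines
themselves avoid the near-spectrum. *)
Lemma coord_lt_support t z : P z -> coord_along t z < support_fun t.
Proof.
move=> /near_spectrum_open[e e0 He].
have : P (z + (e / 2)%:C * unit_vec t).
  apply: He; rewrite addrAC subrr add0r Normc.normcM nc_unit_vec mulr1 nc_real ger0_norm.
    by rewrite ltr_pdivrMr // ltr_pMr // ltr1n.
  by rewrite divr_ge0 // ltW.
move=> /(coord_le_support t); rewrite coord_alongD coord_along_unit_vec; apply: lt_le_trans.
by rewrite ltrDl divr_gt0.
Qed.

Lemma support_gt0 t : 0 < support_fun t.
Proof. by have := coord_lt_support t P0; rewrite /coord_along /= !mul0r addr0. Qed.

Lemma outside_support t w v : support_fun t <= coord_along t w ->
  eps * enorm v <= enorm ((w%:M - B) *m v).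
Proof.
move=> sw; rewrite leNgt; apply/negP => vw.
have : P w by exists v.
by move=> /(coord_lt_support t); rewrite ltNge sw.
Qed.

(** This convexity inequality says that the sides of the circumscribed polygon
have nonnegative lengths. It holds because the coordinates of a point along
t + d and t - d add up to 2 cos d times the one along t. *)
Lemma support_subadd t d : 0 < cos d ->
  2 * cos d * support_fun t <= support_fun (t + d) + support_fun (t - d).
Proof.
move=> c0; have c2 : 0 < 2 * cos d by rewrite mulr_gt0.
rewrite mulrC -ler_pdivlMr //; apply: support_le => z Pz.
rewrite ler_pdivlMr //.
have -> : coord_along t z * (2 * cos d) = coord_along (t + d) z + coord_along (t - d) z.
  rewrite /coord_along !(cosD, sinD) cosN sinN; ring.
by rewrite lerD // coord_le_support.
Qed.

Lemma support_period t : support_fun (t + pi *+ 2) = support_fun t.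
Proof.
rewrite /support_fun; congr sup; apply: eq_imagel => z _.
by rewrite /coord_along cosD2pi sinD2pi.
Qed.

Variable H : nat.
Hypothesis H3 : (2 < H)%N.
Let d : R := pi / H%:R.
Let Hp : 0 < H%:R :> R. Proof. by rewrite ltr0n ltnW // ltnW. Qed.
Let Hd : H%:R * d = pi. Proof. by rewrite /d mulrC divfK // gt_eqF. Qed.
Let d0 : 0 < d. Proof. by rewrite divr_gt0 // pi_gt0. Qed.
Let dpi2 : d < pi / 2.
Proof. by rewrite /d ltr_pM2l ?pi_gt0 // ltf_pV2 ?posrE // ltr_nat. Qed.
Let cd : 0 < cos d.
Proof. by apply: cos_gt0_pihalf; rewrite dpi2 (lt_trans _ d0) // oppr_lt0 divr_gt0 ?pi_gt0. Qed.
Let dpi : d < pi.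
Proof. by rewrite (lt_trans dpi2) // ltr_pdivrMr // ltr_pMr ?pi_gt0 // ltr1n. Qed.
Let sd : 0 < sin d. Proof. by rewrite sin_gt0_pi // d0 dpi. Qed.

(* The polygon with its sides on the support lines in the directions th j: y j and
   y' j locate the intersections with the next and the previous support line. *)
Let th j : R := j%:R * d.
Let x j : R[i] := unit_vec (th j).
Let r j : R := support_fun (th j).
Let y' j : R := (cos d * support_fun (th j) - support_fun (th j - d)) / sin d.
Let y j : R := (support_fun (th j + d) - cos d * support_fun (th j)) / sin d.
Let q j : R[i] := x j * (r j +i* y' j).

Let thS j : th j.+1 = th j + d. Proof. by rewrite /th -natr1; ring. Qed.

Let y'y j : y' j <= y j.
Proof.
rewrite /y' /y ler_pM2r ?invr_gt0 //.
have := support_subadd (th j) cd; lra.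
Qed.

Let qSE j : q j.+1 = x j * (r j +i* y j).
Proof.
rewrite /q /x /r /y /y' thS addrK; set S1 := support_fun (_ + d); set S0 := support_fun _.
rewrite /unit_vec cosD sinD; have e := cos2Dsin2 d.
move: (cos d) (sin d) sd e (cos _) (sin _) => c s s0 e ct st.
apply/eqP; rewrite eq_complex /=; apply/andP; split; apply/eqP/subr0_eq.
  transitivity (st * S1 / s * (1 - (c ^+ 2 + s ^+ 2))); last by rewrite e subrr mulr0.
  by field; rewrite gt_eqF.
transitivity (- (ct * S1 / s) * (1 - (c ^+ 2 + s ^+ 2))); last by rewrite e subrr mulr0.
by field; rewrite gt_eqF.
Qed.

Let th0 : th 0 = 0. Proof. by rewrite /th mul0r. Qed.
Let thM : th (H + H) = 0 + pi *+ 2.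
Proof. by rewrite /th natrD mulrDl Hd add0r mulr2n. Qed.

Let qM : q (H + H)%N = q 0%N.
Proof.
rewrite /q /x /r /y' thM th0 /unit_vec cosD2pi sinD2pi support_period.
have -> : 0 + pi *+ 2 - d = 0 - d + pi *+ 2 by rewrite addrAC.
by rewrite support_period.
Qed.

(* A vertex seen from the frame of one side is turned by d in the frame of the
   next: the angles of the sides add up to 2 H d = 2 pi. *)
Let total_turn : \sum_(j < H + H) (atan (y j / r j) - atan (y' j / r j)) = 2 * pi.
Proof.
have step j : atan (y j / r j) - atan (y' j.+1 / r j.+1) = d.
  apply: atan_rotate; rewrite ?d0 ?dpi ?support_gt0 //.
    by rewrite /r /y' thS addrK; field; rewrite gt_eqF.
  rewrite /r /y' /y thS addrK; apply/subr0_eq; have e := cos2Dsin2 d.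
  set S1 := support_fun (_ + d); set S0 := support_fun _.
  move: (cos d) (sin d) sd e => c s s0 e.
  transitivity (S1 / s * (1 - (c ^+ 2 + s ^+ 2))); last by rewrite e subrr mulr0.
  by field; rewrite gt_eqF.
rewrite (eq_bigr (fun j : 'I_(H + H) => (atan (y' j.+1 / r j.+1) - atan (y' j / r j)) + d)).
  rewrite big_split /= sumr_const card_ord.
  rewrite -(big_mkord xpredT (fun j => atan (y' j.+1 / r j.+1) - atan (y' j / r j))).
  rewrite (telescope_sumr (fun j => atan (y' j / r j))) //.
  have -> : y' (H + H)%N / r (H + H)%N = y' 0%N / r 0%N.
    rewrite /r /y' thM th0 support_period.
    have -> : 0 + pi *+ 2 - d = 0 - d + pi *+ 2 by rewrite addrAC.
    by rewrite support_period.
  by rewrite subrr add0r -[LHS]mulr_natl natrD mulrDl Hd mulrDl mul1r.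
by move=> j _; rewrite -[in RHS](step j); ring.
Qed.

Let edges : \sum_(j < H + H) (y j - y' j) =
  2 * (1 - cos d) / sin d * \sum_(j < H + H) support_fun (th j).
Proof.
have shift : \sum_(j < H + H) support_fun (th j + d) = \sum_(j < H + H) support_fun (th j).
  apply/eqP; rewrite -subr_eq0 -sumrB.
  rewrite -(big_mkord xpredT (fun j => support_fun (th j + d) - support_fun (th j))).
  rewrite (eq_bigr (fun j => support_fun (th j.+1) - support_fun (th j))) => [|j _]; last by rewrite thS.
  by rewrite (telescope_sumr (fun j => support_fun (th j))) // thM th0 support_period subrr.
have shift' : \sum_(j < H + H) support_fun (th j - d) = \sum_(j < H + H) support_fun (th j).
  apply/eqP; rewrite eq_sym -subr_eq0 -sumrB.
  rewrite -(big_mkord xpredT (fun j => support_fun (th j) - support_fun (th j - d))).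
  rewrite (eq_bigr (fun j => support_fun (th j.+1 - d) - support_fun (th j - d))) => [|j _]; last by rewrite thS addrK.
  rewrite (telescope_sumr (fun j => support_fun (th j - d))) // thM th0.
  have -> : 0 + pi *+ 2 - d = 0 - d + pi *+ 2 by rewrite addrAC.
  by rewrite support_period subrr.
rewrite (eq_bigr (fun j : 'I_(H + H) => (sin d)^-1 * support_fun (th j + d) +
   (sin d)^-1 * support_fun (th j - d) - 2 * cos d / sin d * support_fun (th j))) => [|j _].
  rewrite sumrB big_split /= -!mulr_sumr shift shift'; field; by rewrite gt_eqF.
by rewrite /y /y'; field; rewrite gt_eqF.
Qed.

(* The first side lies on the rightmost support line. From there the sides go left
   during the first half-turn; the second half-turn is handled backwards from the
   closing vertex. *)
Let Re_vertex j : (j <= H + H)%N -> complex.Re (q j) <= support_fun 0.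
Proof.
have q0 : complex.Re (q 0%N) = support_fun 0.
  by rewrite /q /x /r th0 /unit_vec cos0 sin0 /= mul1r mul0r subr0.
have q1 : complex.Re (q 1%N) = support_fun 0.
  by rewrite qSE /x /r th0 /unit_vec cos0 sin0 /= mul1r mul0r subr0.
have step j' : complex.Re (q j'.+1) = complex.Re (q j') - sin (th j') * (y j' - y' j').
  by rewrite qSE /q /x /unit_vec /=; ring.
have low k : (k <= H)%N -> complex.Re (q k.+1) <= support_fun 0.
  elim: k => [|k IH] kH; first by rewrite q1.
  rewrite step (le_trans _ (IH (ltnW kH))) // gerBl mulr_ge0 ?subr_ge0 ?y'y //.
  apply: sin_ge0_pi; rewrite -Hd /th mulr_ge0 ?(ltW d0) //= ler_pM2r // ler_nat //.
have high k : (k <= H)%N -> complex.Re (q (H + H - k)%N) <= support_fun 0.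
  elim: k => [|k IH] kH; first by rewrite subn0 qM q0.
  have e : (H + H - k = (H + H - k.+1).+1)%N by lia.
  have := IH (ltnW kH); rewrite e step; apply: le_trans.
  rewrite -[leLHS]subr0 lerB // mulr_le0_ge0 ?subr_ge0 ?y'y //.
  have -> : th (H + H - k.+1) = (H - k.+1)%:R * d + pi.
    by rewrite /th -addnBA // natrD mulrDl Hd addrC.
  rewrite sinDpi oppr_le0; apply: sin_ge0_pi; rewrite -Hd mulr_ge0 ?(ltW d0) //=.
  by rewrite ler_pM2r // ler_nat leq_subr.
case: j => [|j] jM; first by rewrite q0.
have [jH|Hj] := leqP j H; first exact: low.
have -> : j.+1 = (H + H - (H + H - j.+1))%N by rewrite subKn.
by apply: high; lia.
Qed.

(** The bound on z^l is needed only on a half-plane and a disc that do not depend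
on a, b and l: these are the parameters that vary with N in (1 + tB/N)^N. *)
Lemma support_cauchy :
  exists rho : R, forall (a b : R[i]) l (K : R),
  (forall z, complex.Re z <= support_fun 0 -> nc z <= rho -> nc ((a + b * z) ^+ l) <= K) ->
  2 * pi * opnorm ((a%:M + b *: B) ^+ l) <=
  K / eps * (2 * (1 - cos d) / sin d * \sum_(j < H + H) support_fun (j%:R * d)).
Proof.
exists (chain_radius (H + H) q) => a b l K HK; rewrite -edges.
apply: (@polygon_cauchy R (H + H) q x r y' y _ _ y'y _ qSE m B eps eps0 _ a b l K qM total_turn).
- by move=> j; exact: nc_unit_vec.
- by move=> j; exact: support_gt0.
- by [].
- by move=> j w v; rewrite -coord_alongE; exact: outside_support.
move=> N j k N0 jM kN; apply: HK; last by apply: mesh_pt_le => //; exact: ltnW.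
have -> : complex.Re (mesh_pt q N j k) =
    (1 - k%:R / N%:R) * complex.Re (q j) + k%:R / N%:R * complex.Re (q j.+1).
  rewrite /mesh_pt.
  have -> : k%:R / N%:R = (k%:R / N%:R : R)%:C :> R[i].
    by rewrite rmorphM fmorphV !rmorph_nat.
  by case: (q j) (q j.+1) => [a1 a2] [b1 b2] /=; ring.
have Np : 0 < N%:R :> R by rewrite ltr0n.
have k0 : 0 <= k%:R / N%:R :> R by rewrite divr_ge0.
have k1 : k%:R / N%:R <= 1 :> R by rewrite ler_pdivrMr // mul1r ler_nat ltnW.
have h1 := Re_vertex (ltnW jM); have h2 := Re_vertex jM.
move: (k%:R / N%:R) k0 k1 => c k0 k1.
have e1 : (1 - c) * complex.Re (q j) <= (1 - c) * support_fun 0.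
  by rewrite ler_wpM2l // subr_ge0.
have e2 : c * complex.Re (q j.+1) <= c * support_fun 0 by rewrite ler_wpM2l.
rewrite (le_trans (lerD e1 e2)) // -mulrDl subrK mul1r //.
Qed.
End SupportFunction.

(** * The exponential bound for an enclosing curve *)
Lemma curve_dist_le (R : realType) (gamma : R -> R[i]) (L : R) (s : R) :
  gamma 0 = gamma 1 ->
  (forall p, itv_partition 0 1 p -> \sum_(0 <= k < size p)
    nc (gamma (nth 1 (0 :: p) k.+1) - gamma (nth 1 (0 :: p) k)) <= L) ->
  0 <= s <= 1 -> nc (gamma s - gamma 0) <= L.
Proof.
move=> closed length_le /andP[]; rewrite le_eqVlt => /orP[/eqP <- _|s0].
  have pt1 : itv_partition (0 : R) 1 [:: 1] by split => //=; rewrite ltr01.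
  rewrite subrr Normc.normc0; apply: le_trans (length_le _ pt1).
  by apply: sumr_ge0 => k _; exact: nc_ge0.
rewrite le_eqVlt => /orP[/eqP ->|s1].
  have pt1 : itv_partition (0 : R) 1 [:: 1] by split => //=; rewrite ltr01.
  by apply: le_trans (length_le _ pt1); rewrite big_nat1.
have pt2 : itv_partition (0 : R) 1 [:: s; 1] by split => //=; rewrite s0 s1.
apply: le_trans (length_le _ pt2); rewrite /= big_nat_recl // big_nat1 /= lerDl nc_ge0 //.
Qed.

Section CurveBound.
Variables (R : realType) (m : nat) (B : 'M[R[i]]_m) (eps L alpha t : R).
Variables (gamma : R -> R[i]) (z0 : R[i]).
Hypotheses (eps0 : 0 < eps) (t0 : 0 < t) (closed : gamma 0 = gamma 1).
Hypothesis length_le : forall s, itv_partition 0 1 s ->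
  \sum_(0 <= k < size s)
    nc (gamma (nth 1 (0 :: s) k.+1) - gamma (nth 1 (0 :: s) k)) <= L.
Let P := near_spectrum B eps.
Hypothesis Pz0 : P z0.
Hypothesis enclosed : forall th z, P z ->
  exists2 s, 0 <= s <= 1 & coord_along th z <= coord_along th (gamma s).
Hypothesis Pre : forall z, P z -> complex.Re z <= alpha.

(* The polygons have to surround the origin, so z0 is moved there. *)
Let B' := B - z0%:M.
Let P' := near_spectrum B' eps.
Let gamma' s := gamma s - z0.

Let P'E z : P' z -> P (z + z0).
Proof.
move=> [v vz]; exists v; have <- : z%:M - B' = (z + z0)%:M - B by rewrite /B' opprB addrA raddfD.
exact: vz.
Qed.

Let P'0 : P' 0.
Proof.
have [v vz] := Pz0; exists v.
have -> : (0 : R[i])%:M - B' = z0%:M - B by rewrite raddf0 sub0r /B' opprB.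
exact: vz.
Qed.

Let enclosed' th z : P' z -> exists2 s, 0 <= s <= 1 & coord_along th z <= coord_along th (gamma' s).
Proof.
move=> /P'E /(enclosed th)[s s01]; rewrite coord_alongD => h; exists s => //.
by rewrite /gamma' coord_alongB lerBrDr.
Qed.

Let gamma_le s : 0 <= s <= 1 -> nc (gamma s - gamma 0) <= L.
Proof. exact: curve_dist_le. Qed.

Let L0 : 0 <= L.
Proof. by have := @gamma_le 0; rewrite subrr Normc.normc0 lexx ler01 => /(_ isT). Qed.

Let D : R := 2 * (L + nc (gamma' 0)).

(* The near-spectrum is bounded because the curve is, and the curve is bounded
   because its length is finite. *)
Let P'D z : P' z -> nc z <= D.
Proof.
move=> Pz; have H th : coord_along th z <= L + nc (gamma' 0).
  have [s s01 le1] := enclosed' th Pz; apply: (le_trans le1).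
  rewrite (le_trans (ler_norm _)) // (le_trans (coord_le_nc _ _)) //.
  have -> : gamma' s = (gamma s - gamma 0) + gamma' 0 by rewrite /gamma' addrA subrK.
  by rewrite (le_trans (le_normcD _ _)) // lerD2r gamma_le.
have c0 : coord_along 0 z = complex.Re z by rewrite /coord_along cos0 sin0 mulr1 mulr0 addr0.
have c1 : coord_along (pi / 2) z = complex.Im z by rewrite /coord_along cos_pihalf sin_pihalf mulr1 mulr0 add0r.
have h0 := H 0; have h0' := H (0 + pi); have h1 := H (pi / 2); have h1' := H (pi / 2 + pi).
rewrite coord_along_Dpi c0 in h0'; rewrite coord_along_Dpi c1 in h1'; rewrite c0 in h0; rewrite c1 in h1.
rewrite (le_trans (nc_le_ReIm _)) // /D mulr_natl mulr2n lerD // ler_norml.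
  by rewrite h0 lerNl h0'.
by rewrite h1 lerNl h1'.
Qed.

(** The square of the modulus is 1 + 2 (tau Re Z + tau^2 |Z|^2 / 2), at most the
exponential of the second term. *)
Lemma nc_euler_factor (Z : R[i]) (tau : R) :
  nc (1 + tau%:C * Z) <= expR (tau * complex.Re Z + tau ^+ 2 * nc Z ^+ 2 / 2).
Proof.
rewrite -(@ler_pXn2r _ 2) ?nnegrE ?nc_ge0 ?expR_ge0 // -expRM_natl.
case: Z => X Y; set w := expR _.
have -> : nc (1 + tau%:C * (X +i* Y)) ^+ 2 =
    1 + (2 * (tau * X + tau ^+ 2 * (nc (X +i* Y)) ^+ 2 / 2)).
  by rewrite /= !sqr_sqrtr ?addr_ge0 ?sqr_ge0 //; field.
exact: expR_ge1Dx.
Qed.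

(** With g half the angle d between consecutive sides, the perimeter is
2 (1 - cos d) / sin d = 2 tan g times a sum of support values that is at most
L / (2 sin g). This gives L / cos g. *)
Lemma polygon_exp_bound n : (2 < n)%N ->
  opnorm (expmx (t%:C *: B)) <=
  (L / cos (pi / (2 * n%:R))) / (2 * pi * eps) * expR (t * alpha).
Proof.
move=> n3; have n1 : (1 < n)%N by exact: ltnW.
have np : 0 < n%:R :> R by rewrite ltr0n ltnW.
have sg := sin_g_gt0 R n1; set g := pi / (2 * n%:R) in sg *.
have g0 : 0 < g by rewrite divr_gt0 ?pi_gt0 // mulr_gt0.
have cg : 0 < cos g.
  apply: cos_gt0_pihalf; rewrite (lt_trans _ g0) ?oppr_lt0 ?divr_gt0 ?pi_gt0 //=.
  by rewrite /g ltr_pM2l ?pi_gt0 // ltf_pV2 ?posrE ?mulr_gt0 // ltr_pMr // ltr1n.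
have [rho Hrho] := support_cauchy eps0 P'0 P'D n3.
have sum_le : \sum_(j < n + n) support_fun B' eps (j%:R * (pi / n%:R)) <= L / (2 * sin g).
  apply: (@crofton_closed_curve R gamma' L _ _ n
     (fun j => support_fun B' eps (j%:R * (pi / n%:R))) n1).
  - by rewrite /gamma' closed.
  - move=> s /length_le; apply: le_trans; rewrite le_eqVlt; apply/orP; left; apply/eqP.
    by apply: eq_bigr => k _; congr (nc _); rewrite /gamma' opprB addrA subrK.
  move=> j e e0; have [_ [z Pz <-] zlt] := sup_adherent e0 (support_has_sup P'0 P'D (j%:R * (pi / n%:R))).
  have [s s01 zs] := enclosed' (j%:R * (pi / n%:R)) Pz; exists s => //.
  by rewrite (le_trans (ltW zlt)).
set d := pi / n%:R in Hrho sum_le.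
have dg : d = g *+ 2 by rewrite /d /g -mulr_natr; field; rewrite gt_eqF.
set Sg := \sum_(j < n + n) _ in Hrho sum_le.
have fac : 2 * (1 - cos d) / sin d * Sg <= L / cos g.
  have e := cos2Dsin2 g.
  rewrite dg sin_mulr2n cos_mulr2n.
  have -> : 2 * (1 - (cos g ^+ 2 *+ 2 - 1)) / (cos g * sin g *+ 2) = 2 * sin g / cos g.
    have -> : cos g ^+ 2 = 1 - sin g ^+ 2 by rewrite -e addrK.
    rewrite -[(cos g * sin g) *+ 2]mulr_natl -[(1 - _) *+ 2]mulr_natl.
    by field; rewrite !gt_eqF.
  have -> : L / cos g = 2 * sin g / cos g * (L / (2 * sin g)) by field; rewrite !gt_eqF.
  by rewrite ler_wpM2l // divr_ge0 ?mulr_ge0 // ltW.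
pose rho' := nc z0 + `|rho|.
set b := _ * expR _.
have pe0 : 0 < 2 * pi * eps by rewrite !mulr_gt0 ?pi_gt0.
have b0 : 0 <= b by rewrite mulr_ge0 ?expR_ge0 // divr_ge0 ?(ltW pe0) // divr_ge0 // ltW.
apply: opnorm_expmx_le => e e0.
have dp : 0 < e / (b + e) by rewrite divr_gt0 // ltr_wpDl.
pose C := t ^+ 2 * rho' ^+ 2 / 2.
have C0 : 0 <= C by rewrite divr_ge0 // mulr_ge0 ?sqr_ge0.
exists (Num.bound (C / (e / (b + e)))).+1 => N N0.
have Np : 0 < N%:R :> R by rewrite ltr0n (leq_trans _ N0).
have -> : 1%:M + N%:R^-1 *: (t%:C *: B) =
   (1 + (t / N%:R)%:C * z0)%:M + (t / N%:R)%:C *: B'.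
  have -> : (t / N%:R)%:C = N%:R^-1 * t%:C :> R[i] by rewrite mulrC rmorphM fmorphV rmorph_nat.
  rewrite scalerA /B' scalerBr scale_scalar_mx raddfD /= -addrA; congr (_ + _).
  by rewrite addrC subrK.
set a := 1 + _; set b' := (t / N%:R)%:C.
have KE z : complex.Re z <= support_fun B' eps 0 -> nc z <= rho ->
    nc ((a + b' * z) ^+ N) <= expR (t * alpha + C / N%:R).
  move=> Rz zr; rewrite ncX.
  have -> : a + b' * z = 1 + b' * (z0 + z) by rewrite /a mulrDr addrA.
  have h : nc (1 + b' * (z0 + z)) <= expR (t / N%:R * alpha + C / N%:R ^+ 2).
    rewrite (le_trans (nc_euler_factor _ _)) // ler_expR lerD //.
      rewrite ler_wpM2l ?divr_ge0 ?(ltW t0) //.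
      have : support_fun B' eps 0 <= alpha - complex.Re z0.
        apply: (support_le P'0 P'D) => w /P'E /Pre.
        by rewrite /coord_along cos0 sin0 mulr1 mulr0 addr0; case: (w) (z0) => [a1 a2] [b1 b2] /=; rewrite lerBrDr.
      by case: (z) (z0) Rz => [a1 a2] [b1 b2] /= *; lra.
    have -> : C / N%:R ^+ 2 = (t / N%:R) ^+ 2 * rho' ^+ 2 / 2 by rewrite /C; field; rewrite gt_eqF.
    rewrite ler_pM2r ?invr_gt0 // ler_wpM2l ?sqr_ge0 // lerXn2r ?nnegrE ?nc_ge0 ?addr_ge0 ?nc_ge0 //.
    by rewrite (le_trans (le_normcD _ _)) // lerD2l (le_trans zr) // ler_norm.
  have -> : expR (t * alpha + C / N%:R) = expR (t / N%:R * alpha + C / N%:R ^+ 2) ^+ N.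
    by rewrite -expRM_natl; congr expR; field; rewrite gt_eqF.
  by rewrite lerXn2r ?nnegrE ?nc_ge0 ?expR_ge0.
have := Hrho a b' N _ KE.
set K := expR _; set X := opnorm _ => hX.
have hX2 : 2 * pi * X <= K / eps * (L / cos g).
  by rewrite (le_trans hX) // ler_wpM2l // divr_ge0 ?expR_ge0 // ltW.
have p2 : 0 < 2 * pi :> R by rewrite mulr_gt0 ?pi_gt0.
have -> : X = (2 * pi * X) / (2 * pi) by rewrite mulrAC divff ?mul1r // gt_eqF.
apply: (@le_trans _ _ (b * expR (C / N%:R))).
  rewrite ler_pdivrMr ?mulr_gt0 ?pi_gt0 // (le_trans hX2) // /K expRD le_eqVlt.
  apply/orP; left; apply/eqP; rewrite /b.
  move: (2 * pi) p2 (expR _) (expR _) => p p2 E1 E2; field.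
  by rewrite !gt_eqF.
apply: expR_slack => //; rewrite ler_pdivrMr // mulrC -ler_pdivrMr //.
apply: le_trans (ltW (archi_boundP (divr_ge0 C0 (ltW dp)))) _.
by rewrite ler_nat ltnW.
Qed.

(** The number of sides tends to infinity in [polygon_exp_bound]. *)
Lemma curve_exp_bound :
  opnorm (expmx (t%:C *: B)) <= L / (2 * pi * eps) * expR (t * alpha).
Proof.
set o := opnorm _; set X := _ * expR _.
have cc : (fun k => o * cos (pi / 2 * harmonic k)) @ \oo --> o * cos (pi / 2 * 0).
  apply: cvgM; first exact: cvg_cst.
  apply: continuous_cvg; first exact: continuous_cos.
  by apply: cvgM; [exact: cvg_cst|exact: cvg_harmonic].
rewrite mulr0 cos0 mulr1 in cc.
rewrite -(cvg_lim _ cc) //; apply: limr_le; first by apply/cvg_ex; exists o.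
exists 2%N => // k /= k2.
have n3 : (2 < k.+1)%N by [].
have := polygon_exp_bound n3; rewrite -/o.
set g := pi / (2 * k.+1%:R).
have np : 0 < k.+1%:R :> R by rewrite ltr0n.
have gE : pi / 2 * harmonic k = g by rewrite /g /harmonic /= invfM mulrA.
have g0 : 0 < g by rewrite divr_gt0 ?pi_gt0 // mulr_gt0.
have cg : 0 < cos g.
  apply: cos_gt0_pihalf; rewrite (lt_trans _ g0) ?oppr_lt0 ?divr_gt0 ?pi_gt0 //=.
  by rewrite /g ltr_pM2l ?pi_gt0 // ltf_pV2 ?posrE ?mulr_gt0 // ltr_pMr // ltr1n ltnW.
have -> : L / cos g / (2 * pi * eps) * expR (t * alpha) = X / cos g.
  by rewrite /X [L / cos g / _]mulrAC [LHS]mulrAC.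
by rewrite ler_pdivlMr // gE.
Qed.
End CurveBound.

(** * Interior points of a closed curve *)
Section Interior.
Variable R : realType.

Lemma ray_continuous (z u : R[i]) : continuous (fun r : R => (z + r%:C * u : R[i]^o)).
Proof.
move=> r; apply/cvgrPdist_lt => e e0.
have eE : e = (complex.Re e)%:C by rewrite RRe_real // gtr0_real.
have e0' : 0 < complex.Re e by move: e0; rewrite {1}eE ltcR.
have nu : 0 < nc u + 1 by rewrite ltr_wpDl ?nc_ge0.
near=> s.
have -> : z + r%:C * u - (z + s%:C * u) = (r - s)%:C * u by rewrite rmorphB; ring.
rewrite eE norm_nc ltcR Normc.normcM nc_real.
have rs : `|r - s| < complex.Re e / (nc u + 1).
  by near: s; apply: (@nbhsx_ballx R R); rewrite divr_gt0.
apply: (@le_lt_trans _ _ (`|r - s| * (nc u + 1))).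
  by rewrite ler_wpM2l // lerDl.
by rewrite -ltr_pdivlMr.
Unshelve. all: by end_near. Qed.

(** If the whole curve had a smaller coordinate in the direction t, the ray from z
in that direction would avoid the curve, and the component of z would be
unbounded. *)
Lemma jordan_interior_enclosed (gamma : R -> R[i]^o) (z : R[i]) (t : R) :
  jordan_interior gamma z -> exists2 s, 0 <= s <= 1 & coord_along t z <= coord_along t (gamma s).
Proof.
move=> [zc [M [Mr bM]]]; apply: contrapT => no.
pose f (r : R) : R[i]^o := z + r%:C * unit_vec t.
pose A := f @` `[0, +oo[.
have Acon : connected A.
  apply: connected_continuous_connected.
    by apply/connected_intervalP; exact: interval_is_interval.
  by apply: continuous_subspaceT; exact: ray_continuous.
have Az : A z.
  by exists 0; rewrite /= ?in_itv /= ?lexx // /f rmorph0 mul0r addr0.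
have AC : A `<=` ~` (gamma @` `[0, 1]).
  move=> _ [r /= r0 <-] [s s01 gs]; apply: no; exists s; first by move: s01; rewrite /= in_itv.
  rewrite gs coord_alongD coord_along_unit_vec lerDl; by move: r0; rewrite in_itv /= andbT.
have sub := connected_component_max Az AC Acon.
pose K := complex.Re M + 1.
have MK : M < K%:C.
  by rewrite -(RRe_real Mr) ltcR /K ltrDl.
have rK : 0 <= `|K| + nc z + 1 by rewrite !addr_ge0 ?nc_ge0.
have Af : A (f (`|K| + nc z + 1)).
  by exists (`|K| + nc z + 1) => //=; rewrite in_itv /= rK.
have : `|f (`|K| + nc z + 1) : R[i]| <= K%:C by exact: (bM _ MK _ (sub _ Af)).
rewrite norm_nc lecR => h.
have : nc (f (`|K| + nc z + 1) - z) <= K + nc z.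
  by rewrite (le_trans (ncB_le _ _)) // lerD2r.
rewrite /f addrAC subrr add0r Normc.normcM nc_unit_vec mulr1 nc_real ger0_norm //.
have := ler_norm K; lra.
Qed.
End Interior.

(** * The two bounds for a matrix pencil *)
Section Assembly.
Variable R : realType.

Lemma singular_vector m (X : 'M[R[i]]_m) : X \notin unitmx ->
  exists2 v : 'cV_m, v != 0 & X *m v = 0.
Proof.
rewrite -unitmx_tr -row_free_unit -kermx_eq0 => /rowV0Pn[v /sub_kermxP vX v0].
exists v^T; first by rewrite -[X in _ != X]trmx0 (inj_eq trmx_inj).
by rewrite -[X]trmxK -trmx_mul vX trmx0.
Qed.

(** An eigenvalue belongs to all near-spectra at once. *)
Lemma near_spectrum_nonempty m (B : 'M[R[i]]_m) : (0 < m)%N ->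
  exists z : R[i], forall eps, 0 < eps -> near_spectrum B eps z.
Proof.
case: m B => // m B _; have [s [szs _ sE]] := eigenvalue_seq B.
case: s szs sE => // a s _ /(_ a (mem_head _ _)) /singular_vector[v v0 Bv].
exists a => eps eps0; exists v.
by rewrite -[a%:M - B]opprB mulNmx Bv oppr0 enorm0 mulr_gt0 // enorm_gt0.
Qed.

Lemma near_spectrum_inv_norm m (B : 'M[R[i]]_m) eps z : 0 < eps ->
  near_spectrum B eps z -> ((eps^-1)%:E < inv_norm (z%:M - B))%E.
Proof.
move=> eps0 [v vz]; rewrite /inv_norm; case: ifPn => [u|_]; last exact: ltry.
rewrite lte_fin ltNge; apply/negP => le1.
move: vz; rewrite ltNge => /negP; apply.
rewrite -ler_pdivlMl //.
apply: (@le_trans _ _ (opnorm (invmx (z%:M - B)) * enorm ((z%:M - B) *m v))).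
  by rewrite -{1}[v](mulKmx u) opnormP.
by rewrite ler_wpM2r ?enorm_ge0.
Qed.

Lemma curve_length_ge0 (gamma : R -> R[i]^o) : (0 <= curve_length gamma)%E.
Proof.
apply: le_trans (ereal_sup_ubound _); last first.
  by exists [:: 1] => //; split => //=; rewrite ltr01.
by rewrite lee_fin sumr_ge0 // => k _; exact: nc_ge0.
Qed.

Lemma kreiss_bound m (B : 'M[R[i]]_m) (kappa t : R) : (0 < m)%N -> 0 <= t ->
  (forall z v, 0 < complex.Re z ->
    complex.Re z * enorm v <= kappa * enorm ((z%:M - B) *m v)) ->
  opnorm (expmx (t%:C *: B)) <= expR 1 * m%:R * kappa.
Proof. by case: m B => // m B _ t0 HB; exact: kreiss_semigroup. Qed.

(** Otherwise z belongs to the near-spectra of levels slightly above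
|(z - B) v| / |v|, and one of these levels contradicts the hypothesis. *)
Lemma kreiss_resolvent m (B : 'M[R[i]]_m) (kappa : R) :
  (forall eps z, 0 < eps -> near_spectrum B eps z -> complex.Re z / eps <= kappa) ->
  forall z v, 0 < complex.Re z -> complex.Re z * enorm v <= kappa * enorm ((z%:M - B) *m v).
Proof.
move=> H z v z0; rewrite leNgt; apply/negP => lt1.
set w := enorm ((z%:M - B) *m v) in lt1.
have w0 : 0 <= w by exact: enorm_ge0.
have v0 : 0 < enorm v.
  rewrite lt_neqAle enorm_ge0 andbT eq_sym enorm_eq0; apply/eqP => v0.
  by move: lt1; rewrite /w v0 mulmx0 enorm0 !mulr0 ltxx.
pose n := w / enorm v.
have n0 : 0 <= n by rewrite divr_ge0 // ltW.
have kn : kappa * n < complex.Re z by rewrite /n mulrA ltr_pdivrMr.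
have near_e e : n < e -> near_spectrum B e z.
  by move=> ne; exists v; rewrite -/w -ltr_pdivrMr.
have [k0|k0] := leP kappa 0.
  have n1 : 0 < n + 1 by rewrite ltr_wpDl.
  have := H _ _ n1 (near_e _ _); rewrite ltrDl ltr01 => /(_ isT).
  by rewrite leNgt (le_lt_trans k0) // divr_gt0.
pose e := n + (complex.Re z - kappa * n) / (2 * kappa).
have ne : n < e by rewrite ltrDl divr_gt0 ?subr_gt0 // mulr_gt0.
have e0 : 0 < e by apply: le_lt_trans ne.
have := H _ _ e0 (near_e _ ne); rewrite ler_pdivrMr // leNgt => /negP; apply.
have -> : kappa * e = (kappa * n + complex.Re z) / 2 by rewrite /e; field; rewrite gt_eqF.
lra.
Qed.

End Assembly.

Unset Implicit Arguments.

Theorem theorem4p8 (R : realType) (n d : nat) (A E : 'M[R[i]]_n) (mu : R[i])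
    (Q : 'M[R[i]]_(n, n - d)) (Qt : 'M[R[i]]_(n, d)) (G : 'M[R[i]]_(n - d))
    (D : 'M[R[i]]_(n - d, d)) (N : 'M[R[i]]_d)
    (A_E_regular : regular_pencil A E)
    (A_E_stable : forall lambda : R[i],
       finite_eigenvalue A E lambda -> complex.Re lambda < 0)
    (mu_unit : A - mu *: E \in unitmx)
    (A_E_schur : schur_splitting A E mu Q Qt G D N) :
  (forall (eps t : R) (gamma : R -> R[i]^o),
     0 < eps -> 0 < t ->
     jordan_curve gamma ->
     pseudospectrum A E eps `<=` jordan_interior gamma ->
     ((opnorm (expmx (t%:C *: (invmx G + mu%:M))))%:E
        <= curve_length gamma
           * expeR (t%:E * pseudospectral_abscissa A E eps)
           * ((2 * pi * eps)^-1)%:E)%E)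
  /\
  (forall t : R,
     0 <= t ->
     ((opnorm (expmx (t%:C *: (invmx G + mu%:M))))%:E
        <= (expR 1 * (n - d)%N%:R)%:E * kreiss_constant A E)%E).
Proof.
set B := invmx G + mu%:M.
have m0 : (0 < n - d)%N by rewrite subn_gt0 (schur_ltn A_E_schur).
have [z0 z0B] := near_spectrum_nonempty B m0.
have sub eps z : 0 < eps -> near_spectrum B eps z -> pseudospectrum A E eps z.
  move=> eps0 zB; exists mu, d, Q, Qt, G, D, N; split => //.
  exact: near_spectrum_inv_norm.
have abs_ge eps z : 0 < eps -> near_spectrum B eps z ->
    ((complex.Re z)%:E <= pseudospectral_abscissa A E eps)%E.
  by move=> eps0 zB; apply: ereal_sup_ubound; exists z => //; exact: sub.
split=> [eps t gamma eps0 t0 [_ closed _] inside|t t0].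
  have enclosed th z : near_spectrum B eps z ->
      exists2 s, 0 <= s <= 1 & coord_along th z <= coord_along th (gamma s).
    by move=> zB; apply: jordan_interior_enclosed; apply: inside; exact: sub.
  have c0 : 0 < (2 * pi * eps)^-1 by rewrite invr_gt0 !mulr_gt0 ?pi_gt0.
  set alpha := pseudospectral_abscissa A E eps.
  have alphaN : (-oo < alpha)%E by apply: lt_le_trans (abs_ge _ _ eps0 (z0B _ eps0)); exact: ltNyr.
  have expa : (0 < expeR (t%:E * alpha))%E.
    rewrite expeR_gt0 //; case: (alpha) alphaN => [a| |] // _; first exact: ltNyr.
    by rewrite gt0_muley ?lte_fin.
  have := curve_length_ge0 gamma; case lenE : (curve_length gamma) => [L| |] // L0; last first.
    by rewrite gt0_mulye // gt0_mulye // ?leey // lte_fin.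
  have len s : itv_partition 0 1 s -> \sum_(0 <= k < size s)
      nc (gamma (nth 1 (0 :: s) k.+1) - gamma (nth 1 (0 :: s) k)) <= L.
    by move=> sP; rewrite -lee_fin -lenE; apply: ereal_sup_ubound; exists s.
  (* If the abscissa is infinite, any real bound for the near-spectrum serves. *)
  have [a aalpha aRe] : exists2 a : R, (a%:E <= alpha)%E &
      forall z, near_spectrum B eps z -> complex.Re z <= a.
    have H z := @abs_ge eps z eps0; rewrite -/alpha in H.
    case: (alpha) alphaN H => [a _ H| _ _|] //; first by exists a => // z /H; rewrite lee_fin.
    exists (L + nc (gamma 0)); first exact: leey.
    move=> z /(enclosed 0)[s s01]; rewrite /coord_along cos0 sin0 !mulr1 !mulr0 !addr0 => /le_trans; apply.
    rewrite (le_trans (ler_norm _)) // (le_trans (nc_Re _)) //.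
    rewrite -[gamma s](subrK (gamma 0)) (le_trans (le_normcD _ _)) // lerD2r.
    exact: curve_dist_le.
  have := curve_exp_bound eps0 t0 closed len (z0B _ eps0) enclosed aRe.
  rewrite -lee_fin => /le_trans; apply.
  apply: (@le_trans _ _ (L%:E * expeR (t%:E * a%:E) * ((2 * pi * eps)^-1)%:E)%E).
    have -> : expeR (t%:E * a%:E) = (expR (t * a))%:E by [].
    by rewrite -!EFinM lee_fin mulrAC.
  apply: lee_wpmul2r; first by rewrite lee_fin ltW.
  apply: lee_wpmul2l => //; rewrite lee_expeR.
  by apply: lee_wpmul2l => //; rewrite lee_fin ltW.
case kE : (kreiss_constant A E) => [kappa| |].
- rewrite -EFinM lee_fin; apply: kreiss_bound => //; apply: kreiss_resolvent => eps z eps0 zB.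
  rewrite -lee_fin -kE; apply: le_trans (ereal_sup_ubound _); last by exists eps.
  by rewrite EFinM; apply: lee_wpmul2r; [rewrite lee_fin invr_ge0 ltW|exact: abs_ge].
- by rewrite gt0_muley ?leey // lte_fin mulr_gt0 ?expR_gt0 // ltr0n.
(* The near-spectrum is not empty, so the Kreiss constant is not -oo. *)
have : ((complex.Re z0)%:E * (1^-1)%:E <= kreiss_constant A E)%E.
  apply: le_trans (ereal_sup_ubound _); last by exists 1 => //=; exact: ltr01.
  by apply: lee_wpmul2r; [rewrite lee_fin invr_ge0|apply: abs_ge => //; exact: z0B].
by rewrite kE.
Qed.
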